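(* Let $H_\omega=-\Delta+V_\omega$ be the Anderson model on the Sierpinski lattice $\mathbb{G}$. For $L\in\mathbb{N}$ let $B_L=\{y\in\mathbb{G}: d(O,y)\le 2^L\}$ and $H_\omega^{B_L}=\mathbb{1}_{B_L}H_\omega\mathbb{1}_{B_L}$ regarded as an operator on $\ell^2(B_L)$. Then there exists a non-random, right-continuous, non-decreasing function $N(E)$ such that almost surely $$N(E)=\lim_{L\to\infty}\frac{1}{|B_L|}\mathbb{E}\,\mathcal N(E;H_\omega^{B_L})=\lim_{L\to\infty}\frac{1}{|B_L|}\mathcal N(E;H_\omega^{B_L})$$ for all continuity points $E$ of $N$. ($N$ is called the integrated density of states.) If moreover $\inf\operatorname{supp}P_0=0$, $P_0$ is not concentrated on a single point, and there are $C,\kappa>0$ with $P_0([0,\varepsilon])\ge C\varepsilon^\kappa$ for all sufficiently small $\varepsilon>0$, then $$\lim_{E\searrow0}\frac{\log|\log N(E)|}{\log E}=-\frac{\log3}{\log5}.$$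
   Context: Let $a_1=(0,0)$, $a_2=(1,0)$, $a_3=(1/2,\sqrt3/2)$, $T_0$ the unit equilateral triangle with these vertices, $T_{n+1}=T_n\cup(T_n+2^na_2)\cup(T_n+2^na_3)$. $\mathbb{G}_n$ is the set of vertices of the unit triangles (translates of $T_0$) in $T_n$, with $x\sim y$ iff $x\ne y$ are vertices of a common unit triangle; $\mathbb{G}_n'$ is its mirror image in the $y$-axis; the Sierpinski lattice is $\mathbb{G}=\bigcup_n(\mathbb{G}_n\cup\mathbb{G}_n')$ with these edges (every vertex has degree 4). $d$ is the graph distance, $O=(0,0)$, $|A|$ is cardinality. $\Delta f(x)=\sum_{y\sim x}(f(y)-f(x))$ on $\ell^2(\mathbb{G})$. $H_\omega=-\Delta+V_\omega$ with $\{V_\omega(x)\}_{x\in\mathbb{G}}$ i.i.d. real random variables with common distribution $P_0$, $\operatorname{supp}P_0=\{x:P_0((x-\varepsilon,x+\varepsilon))>0\ \forall\varepsilon>0\}$. For a self-adjoint operator $X$ on a finite-dimensional space, $\mathcal N(E;X)$ is the number of eigenvalues (with multiplicity) of $X$ that are $\le E$. *)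

(* Defs.v *)
From HB Require Import structures.
From mathcomp Require Import all_boot all_order all_algebra.
From mathcomp Require Import all_classical all_reals all_analysis.
Set Implicit Arguments. Unset Strict Implicit. Unset Printing Implicit Defensive.
Import Order.TTheory GRing.Theory Num.Theory.
Local Open Scope classical_set_scope.
Local Open Scope ring_scope.

(* A point (a, b) : int * int stands for the point a*a_2 + b*a_3 of the plane,
   a_2 = (1,0), a_3 = (1/2, sqrt 3 / 2).  All vertices of G lie on this lattice. *)
Definition pt := (int * int)%type.
Definition O : pt := (0, 0).
Definition padd (p q : pt) : pt := (p.1 + q.1, p.2 + q.2).
(* mirror image in the y-axis: (x,y) |-> (-x,y), i.e. a*a2+b*a3 |-> (-a-b)*a2 + b*a3 *)
Definition mirror (p : pt) : pt := (- p.1 - p.2, p.2).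

(* cell n t : the unit triangle t + T_0 is one of the unit triangles of T_n
   (T_0 = {t=0}, T_{n+1} = T_n u (T_n + 2^n a_2) u (T_n + 2^n a_3)). *)
Fixpoint cell (n : nat) (t : pt) : Prop :=
  match n with
  | 0 => t = O
  | n'.+1 => cell n' t \/ cell n' (t.1 - (expn 2 n')%:Z, t.2)
                       \/ cell n' (t.1, t.2 - (expn 2 n')%:Z)
  end.

Definition tri_verts (t : pt) : set pt := [set t; padd t (1, 0); padd t (0, 1)].

Definition unit_tri (Tr : set pt) : Prop :=
  exists n t, cell n t /\ (Tr = tri_verts t \/ Tr = mirror @` tri_verts t).

Definition vertex (x : pt) : Prop := exists Tr, unit_tri Tr /\ Tr x.

Definition adj (x y : pt) : Prop :=
  x <> y /\ exists Tr, unit_tri Tr /\ Tr x /\ Tr y.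

Fixpoint within (k : nat) (x y : pt) : Prop :=
  match k with
  | 0 => x = y
  | k'.+1 => within k' x y \/ exists z, adj x z /\ within k' z y
  end.

Section Operators.
Variable R : realType.

Definition deg (x : pt) : R := (\sum_(y \in [set y | adj x y]) (1 : R))%R.

(* kernel of the graph Laplacian: (Delta f)(x) = sum_{y~x} (f y - f x)
   = sum_y lap x y * f y *)
Definition lap (x y : pt) : R :=
  (if `[< adj x y >] then 1 else 0) - (if x == y then deg x else 0).

(* A finite box of lattice points containing B_L: every edge changes each
   lattice coordinate by at most 1, so d(O,y) <= 2^L forces |a|,|b| <= 2^L. *)
Definition box (L : nat) := ('I_(expn 2 L).*2.+1 * 'I_(expn 2 L).*2.+1)%type.
Definition pt_of (L : nat) (p : box L) : pt :=
  ((nat_of_ord p.1)%:Z - (expn 2 L)%:Z, (nat_of_ord p.2)%:Z - (expn 2 L)%:Z).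

Definition BallL (L : nat) : {set box L} :=
  [set p | `[< vertex (pt_of p) /\ within (expn 2 L) O (pt_of p) >]].

Definition HB (L : nat) (V : pt -> R) : 'M[R]_#|BallL L| :=
  \matrix_(i, j)
    (let x := pt_of (enum_val i) in let y := pt_of (enum_val j) in
     - lap x y + (if x == y then V x else 0)).

Definition Ncount (E : R) (n : nat) (X : 'M[R]_n) : R :=
  (\sum_(r \in [set r : R | root (char_poly X) r /\ r <= E])
      ((mup r (char_poly X))%:R : R))%R.

Definition closed_itv (a b : R) : set R := `[a, b].
Definition open_itv (x e : R) : set R := `]x - e, x + e[.
Definition supp (P0 : probability R R) : set R :=
  [set x : R | forall e : R, 0 < e -> (0 < P0 (open_itv x e))%E].

Definition iid_potential d (T : measurableType d) (P : probability T R)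
    (V : pt -> T -> R) (P0 : probability R R) : Prop :=
  (forall x, vertex x -> measurable_fun setT (V x)) /\
  (forall x, vertex x -> forall A : set R, measurable A ->
       P (V x @^-1` A) = P0 A) /\
  (forall S : seq pt, uniq S -> (forall x, x \in S -> vertex x) ->
   forall A : pt -> set R, (forall x, measurable (A x)) ->
     P (\big[setI/setT]_(x <- S) (V x @^-1` A x)) =
     (\prod_(x <- S) P (V x @^-1` A x))%E).

End Operators.

(* Main.v *)
(* Deleting the corners of the level-m triangles in B_L decouples H into copies of one finite
   matrix with independent potentials.  By Cauchy interlacing this changes the eigenvalue count
   by at most the number of deleted corners, a proportion O(3^-m) of B_L.  Hence the normalised
   mean counts form a Cauchy sequence, and a law of large numbers over the disjoint triangles,
   used at rational energies, gives almost sure convergence to the same limit.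

   For the tail take 5^m of order 1/E.  A function has oscillation squared at most
   20 (5/3)^m times its energy on a level-m triangle, so if a fixed fraction of the sites of the
   triangle has V >= t > 0 then |f|^2 <= C 5^m <f, H f> there.  Only the other triangles
   contribute eigenvalues below E, and by Chernoff's bound they have probability at most
   exp(- c 3^m).  Conversely the tent glued from harmonic functions has energy of order (3/5)^m
   and norm squared of order 3^m, so it yields an eigenvalue below E as soon as V <= E/2 on the
   whole triangle, which has probability at least (C (E/2)^kappa)^(3^(m+3)).  In both bounds
   3^m is of order E^(- log 3 / log 5). *)
Require Import Defs.
From HB Require Import structures.
From mathcomp Require Import all_boot all_order all_algebra.
From mathcomp Require Import complex ring lra zify.
From mathcomp Require Import all_classical all_reals all_analysis.
From mathcomp Require Import measurable_realfun.
Import Order.TTheory GRing.Theory Num.Theory numFieldNormedType.Exports.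
Local Open Scope classical_set_scope.
Local Open Scope ring_scope.

Set Implicit Arguments. Unset Strict Implicit. Unset Printing Implicit Defensive.

(** * Symmetric matrices and eigenvalue counting *)

Section SpectralTheorem.
Variable R : realType.

(** The obstacle is the transfer of laws: [iid_potential] speaks only of finite families of sets,
    whereas eigenvalue counts are discontinuous functions of many potentials. They do not change,
    however, when the potential is lowered slightly, so dyadic approximation from below makes them
    pointwise limits of functions of finitely many discrete observations; measurability, equality of
    means and product formulas for disjoint blocks all pass through this limit. The law of large
    numbers needs only second moments, because the number of blocks grows geometrically. The limit
    of the mean counts need not be right-continuous in the energy: N is its right regularisation,
    and monotonicity carries the convergence from rational energies to continuity points of N, with
    one null set for all of them. The factors 3/5 and 5/3 come from a single identity for a once
    subdivided triangle, which gives both the oscillation bound and the harmonic extensions that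
    attain it. Each tail estimate holds at fixed m for every larger ball, so it survives the limit
    in L. *)

Definition qform n (A : 'M[R]_n) (w : 'rV[R]_n) : R := (w *m A *m w^T) 0 0.
Definition nsq n (w : 'rV[R]_n) : R := (w *m w^T) 0 0.

Lemma nsqE n (w : 'rV[R]_n) : nsq w = \sum_i w 0 i ^+ 2.
Proof. by rewrite /nsq mxE; apply: eq_bigr => i _; rewrite mxE expr2. Qed.

Lemma qformE n (A : 'M[R]_n) (w : 'rV[R]_n) :
  qform A w = \sum_i \sum_j w 0 i * w 0 j * A i j.
Proof.
rewrite /qform mxE exchange_big /=; apply: eq_bigr => j _.
rewrite !mxE mulr_suml; apply: eq_bigr => i _; ring.
Qed.

Lemma nsq_ge0 n (w : 'rV[R]_n) : 0 <= nsq w.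
Proof. by rewrite nsqE; apply: sumr_ge0 => i _; exact: sqr_ge0. Qed.

Lemma nsq_gt0 n (w : 'rV[R]_n) : w != 0 -> 0 < nsq w.
Proof.
move=> w0; rewrite lt0r nsq_ge0 andbT nsqE psumr_eq0; last by move=> i _; exact: sqr_ge0.
apply: contra w0 => /allP w0; apply/eqP/rowP => i; rewrite mxE; apply/eqP.
by have := w0 i (mem_index_enum i); rewrite sqrf_eq0.
Qed.

Lemma nsq_orth n m (W : 'M[R]_(n, m)) v : W *m W^T = 1%:M -> nsq (v *m W) = nsq v.
Proof. by move=> WW; rewrite /nsq trmx_mul mulmxA -(mulmxA v) WW mulmx1. Qed.

(** An eigenvalue a exists over [R[i]]. As A is real and symmetric, v A v* equals its own conjugate;
    it is also a |v|^2, so a is real and therefore a root of the real characteristic polynomial. *)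
Lemma symmetric_eigenvalue n (A : 'M[R]_n.+1) : A^T = A -> exists a, eigenvalue A a.
Proof.
move=> Asym; pose f : {rmorphism R -> R[i]} := real_complex R.
have [a /eigenvalueP[v vA v0]] := eigenvalue_closed (map_mx f A) (ltn0Sn n).
have fC x : (f x)^* = f x by rewrite conj_Creal // complex_real.
have cA : map_mx Num.conj (map_mx f A)^T = map_mx f A.
  by apply/matrixP => i j; rewrite !mxE fC -{1}Asym mxE.
have aR : a \is Num.real.
  apply/CrealP.
  pose s := (v *m (map_mx Num.conj v^T)) 0 0.
  have s0 : s != 0.
    rewrite /s mxE psumr_eq0; last by move=> i _; rewrite !mxE mul_conjC_ge0.
    apply: contra v0 => /allP w0; apply/eqP/rowP => i; rewrite mxE; apply/eqP.
    by have := w0 i (mem_index_enum i); rewrite !mxE mul_conjC_eq0.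
  have E : (v *m map_mx f A *m (map_mx Num.conj v^T)) 0 0 = a * s.
    by rewrite vA -scalemxAl mxE.
  have sc : s^* = s.
    rewrite /s mxE rmorph_sum; apply: eq_bigr => i _; rewrite !mxE rmorphM /= conjCK; ring.
  have : (a * s)^* = a * s.
    rewrite -E -[in RHS]cA.
    have -> : forall M : 'M[R[i]]_1, (M 0 0)^* = (map_mx Num.conj (M^T)) 0 0 by move=> M; rewrite !mxE.
    rewrite !trmx_mul !map_mxM /= mulmxA.
    have -> : map_mx Num.conj (map_mx Num.conj v^T)^T = v by apply/matrixP => i j; rewrite !mxE conjCK.
    by [].
  by rewrite rmorphM /= sc => /(mulIf s0).
have [x xa] : exists x, a = f x by exists (complex.Re a); rewrite /f /= RRe_real.
exists x; rewrite eigenvalue_root_char -(fmorph_root f) map_char_poly -eigenvalue_root_char -xa.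
by apply/eigenvalueP; exists v.
Qed.

(* The reflection exchanging the unit vectors [v] and [e_0]. *)
Lemma orthogonal_completion n (v : 'rV[R]_n.+1) : nsq v = 1 ->
  exists2 H : 'M[R]_n.+1, H *m H^T = 1%:M & row 0 H = v.
Proof.
move=> v1; pose e : 'rV[R]_n.+1 := delta_mx 0 0.
have ee : e *m e^T = 1%:M.
  by rewrite /e trmx_delta mul_delta_mx; apply/matrixP=> i j; rewrite !mxE !ord1.
have vv : v *m v^T = 1%:M.
  by apply/matrixP=> i j; rewrite !ord1 !mxE -[RHS]v1 nsqE; apply: eq_bigr => k _; rewrite mxE expr2.
have [<-|ve] := eqVneq e v.
  by exists 1%:M; rewrite ?trmx1 ?mulmx1 // row1.
pose u := e - v; pose s := nsq u.
have s0 : s != 0 by rewrite gt_eqF // nsq_gt0 // subr_eq0.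
have uu : u *m u^T = s%:M by apply/matrixP=> i j; rewrite !ord1 /s /nsq [RHS]mxE eqxx.
pose c := (e *m v^T) 0 0.
have ev : e *m v^T = c%:M by apply/matrixP=> i j; rewrite !ord1 /c [RHS]mxE eqxx.
have ve' : v *m e^T = c%:M by rewrite -[v]trmxK -trmx_mul ev tr_scalar_mx.
have sE : s = 2 - 2 * c.
  have : u *m u^T = (1 - c - (c - 1))%:M.
    by rewrite /u linearB /= mulmxBl !mulmxBr ee vv ev ve' -!raddfB.
  by rewrite uu => /matrixP /(_ 0 0); rewrite !mxE eqxx !mulr1n => ->; ring.
pose X := (2 / s) *: (u^T *m u).
have XX : X *m X = X + X.
  rewrite /X -scalemxAl -scalemxAr -mulmxA (mulmxA u) uu mul_scalar_mx.
  rewrite -scalemxAr !scalerA (_ : 2 / s * _ = 2 / s + 2 / s) ?scalerDl //; by field.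
have XT : X^T = X by rewrite /X linearZ /= trmx_mul trmxK.
have HT : (1%:M - X)^T = 1%:M - X by rewrite linearB /= trmx1 XT.
exists (1%:M - X).
  rewrite HT mulmxBl mul1mx mulmxBr mulmx1 XX.
  by rewrite opprB addrK subrK.
rewrite rowE -/e mulmxBr mulmx1 /X -scalemxAr mulmxA.
have -> : e *m u^T = (1 - c)%:M by rewrite /u linearB /= mulmxBr ee ev -raddfB.
rewrite mul_scalar_mx scalerA.
have -> : 2 / s * (1 - c) = 1 by rewrite mulrAC (_ : 2 * (1 - c) = s) ?divff // sE; ring.
by rewrite scale1r /u opprB addrC subrK.
Qed.

(** Deflation: in an orthonormal basis that starts with a unit eigenvector the first row of A is a
    multiple of e_0, symmetry gives the same for the first column, and the induction applies to the
    remaining block. *)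
Theorem symmetric_spectral n (A : 'M[R]_n) : A^T = A ->
  exists (Q : 'M[R]_n) (d : 'rV[R]_n), Q *m Q^T = 1%:M /\ Q *m A *m Q^T = diag_mx d.
Proof.
elim: n A => [|n IH] A Asym.
  by exists 0, 0; split; apply/matrixP=> -[].
have [a /eigenvalueP[v0 v0A v00]] := symmetric_eigenvalue Asym.
pose v := (Num.sqrt (nsq v0))^-1 *: v0.
have vA : v *m A = a *: v by rewrite /v -scalemxAl v0A !scalerA mulrC.
have v1 : nsq v = 1.
  rewrite /nsq /v linearZ /= -scalemxAl -scalemxAr scalerA mxE -/(nsq v0) -invfM -expr2 sqr_sqrtr ?nsq_ge0 //.
  by rewrite mulVf // gt_eqF // nsq_gt0.
have [H HH Hv] := orthogonal_completion v1.
pose B : 'M[R]_(1 + n) := H *m A *m H^T.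
have Bsym : B^T = B by rewrite /B !trmx_mul trmxK Asym mulmxA.
have B0 : row 0 B = a *: delta_mx 0 0.
  by rewrite /B !row_mul Hv vA -scalemxAl -Hv -row_mul HH row1.
have B0j (j : 'I_(1 + n)) : B (lshift n 0) j = a * (j == lshift n 0)%:R.
  have := congr1 (fun M : 'rV[R]_(1 + n) => M 0 j) B0.
  have -> : lshift n 0 = 0 :> 'I_(1 + n) by exact/val_inj.
  by rewrite [in RHS]mxE [in RHS]mxE [in LHS]mxE eqxx.
pose A' := drsubmx B.
have BE : B = block_mx a%:M 0 0 A'.
  rewrite -[LHS]submxK /A'; congr block_mx.
  - by apply/matrixP => i j; rewrite !ord1 2!mxE B0j eqxx mulr1 !mxE eqxx.
  - by apply/matrixP => i j; rewrite !ord1 2!mxE B0j mxE eq_rlshift mulr0.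
  - by rewrite -Bsym; apply/matrixP => i j; rewrite !ord1 3!mxE B0j mxE eq_rlshift mulr0.
have A'sym : A'^T = A' by rewrite /A' trmx_drsub Bsym.
have [Q' [d' [QQ QA]]] := IH _ A'sym.
pose S : 'M[R]_(1 + n) := block_mx 1%:M 0 0 Q'.
have SS : S *m S^T = 1%:M.
  by rewrite /S tr_block_mx mulmx_block !trmx0 trmx1 !mulmx0 !mul0mx !mulmx1 QQ !addr0 !add0r -scalar_mx_block.
exists (S *m H), (row_mx a%:M d' : 'rV[R]_(1 + n)); split.
  by rewrite trmx_mul mulmxA -(mulmxA S) HH mulmx1.
have -> : S *m H *m A *m (S *m H)^T = S *m B *m S^T by rewrite /B trmx_mul !mulmxA.
rewrite BE /S tr_block_mx !mulmx_block !trmx0 trmx1 !(mulmx0, mul0mx, addr0, add0r) !mulmx1 !mul1mx QA.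
transitivity (block_mx (diag_mx (a%:M : 'rV[R]_1)) 0 0 (diag_mx d')); last by rewrite -diag_mx_row.
suff -> : diag_mx (a%:M : 'rV[R]_1) = a%:M by [].
by apply/matrixP=> i j; rewrite !ord1 !mxE eqxx.
Qed.

End SpectralTheorem.

(** * Eigenvalue counts and the min-max principle *)

Section EigenvalueCount.
Variable R : realType.

Lemma char_poly_orthogonal n (A Q : 'M[R]_n) (d : 'rV[R]_n) :
  Q *m Q^T = 1%:M -> Q *m A *m Q^T = diag_mx d ->
  char_poly A = \prod_i ('X - (d 0 i)%:P).
Proof.
move=> QQ QAQ.
have -> : char_poly A = char_poly (diag_mx d); last first.
  by rewrite char_poly_trig ?diag_mx_is_trig //; apply: eq_bigr => i _; rewrite mxE eqxx.
rewrite -QAQ /char_poly /char_poly_mx !map_mxM /=; set Q' := map_mx _ Q.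
have Q'Q' : Q' *m map_mx polyC Q^T = 1%:M by rewrite -map_mxM QQ map_mx1.
have -> : 'X%:M - Q' *m map_mx polyC A *m map_mx polyC Q^T =
  Q' *m ('X%:M - map_mx polyC A) *m map_mx polyC Q^T.
  by rewrite mulmxBr mulmxBl mul_mx_scalar -scalemxAl Q'Q' scalemx1.
by rewrite !det_mulmx mulrAC -det_mulmx Q'Q' det1 mul1r.
Qed.

Lemma mup_prod_XsubC (I : finType) (d : I -> R) x :
  mup x (\prod_i ('X - (d i)%:P)) = (\sum_i (d i == x))%N.
Proof.
suff [] : \prod_i ('X - (d i)%:P) != 0 /\
  mup x (\prod_i ('X - (d i)%:P)) = (\sum_i (d i == x))%N by [].
apply: (big_ind2 (fun (p : {poly R}) (k : nat) => p != 0 /\ mup x p = k)).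
- by split; rewrite ?oner_neq0 // mupNroot // rootC oner_eq0.
- by move=> p1 k1 p2 k2 [p10 <-] [p20 <-]; rewrite mulf_neq0 // mupM.
- move=> i _; split; first by rewrite polyXsubC_eq0.
  by have := mup_XsubCX 1 x (d i); rewrite expr1 => ->; case: eqP.
Qed.

(** Ties the count by root multiplicities to the diagonal form: once the two sums are exchanged, an
    index i with d_i <= E is met by exactly one root and any other index by none. *)
Lemma Ncount_diag n (E : R) (A Q : 'M[R]_n) (d : 'rV[R]_n) :
  Q *m Q^T = 1%:M -> Q *m A *m Q^T = diag_mx d ->
  Ncount E A = #|[set i | d 0 i <= E]%SET|%:R.
Proof.
move=> QQ QAQ; rewrite /Ncount (char_poly_orthogonal QQ QAQ).
pose s := undup [seq d 0 i | i <- enum 'I_n & d 0 i <= E].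
have sE x : reflect (exists2 i, d 0 i <= E & x = d 0 i) (x \in s).
  rewrite mem_undup; apply: (iffP mapP) => -[j].
    by rewrite mem_filter => /andP[jE _] ->; exists j.
  by move=> jE ->; exists j => //; rewrite mem_filter jE mem_enum.
have -> : [set r : R | root (\prod_i ('X - (d 0 i)%:P)) r /\ r <= E] = [set` s].
  apply/seteqP; split=> x /=.
    case; rewrite /root horner_prod => /prodf_eq0[j _]; rewrite hornerXsubC subr_eq0 => /eqP -> jE.
    by apply/sE; exists j.
  move=> /sE[i iE ->]; split=> //; rewrite /root horner_prod; apply/prodf_eq0; exists i => //.
  by rewrite hornerXsubC subrr.
rewrite -fsbig_seq ?undup_uniq //.
under eq_bigr do rewrite mup_prod_XsubC natr_sum.
rewrite exchange_big /= -sum1_card natr_sum [RHS]big_mkcond /=.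
apply: eq_bigr => i _; rewrite inE; case: ifPn => iE.
  rewrite (bigD1_seq (d 0 i)) ?undup_uniq //=; last by apply/sE; exists i.
  by rewrite eqxx big1 ?addr0 // => j; rewrite eq_sym => /negbTE ->.
rewrite big1_seq // => x /andP[_ /sE[j jE ->]].
by case: eqP => // ij; rewrite ij jE in iE.
Qed.

(** A natural number, since it serves as the number of rows of matrices of eigenvectors; for
    symmetric matrices the truncation loses nothing ([ncountE]). *)
Definition ncount n (E : R) (A : 'M[R]_n) : nat := Num.truncn (Ncount E A).

Lemma orthonormal_rows n k (Q : 'M[R]_n) (g : 'I_k -> 'I_n) : injective g ->
  Q *m Q^T = 1%:M -> rowsub g Q *m (rowsub g Q)^T = 1%:M.
Proof.
move=> ginj QQ; apply/matrixP=> i j.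
have := congr1 (fun M : 'M[R]_n => M (g i) (g j)) QQ.
by rewrite !mxE (inj_eq ginj) => <-; apply: eq_bigr => l _; rewrite !mxE.
Qed.

Lemma qform_rowsub n k (A Q : 'M[R]_n) (d : 'rV[R]_n) (g : 'I_k -> 'I_n) v :
  injective g -> Q *m A *m Q^T = diag_mx d ->
  qform A (v *m rowsub g Q) = \sum_i d 0 (g i) * v 0 i ^+ 2.
Proof.
move=> ginj QAQ.
have -> : qform A (v *m rowsub g Q) = qform (rowsub g Q *m A *m (rowsub g Q)^T) v.
  by rewrite /qform trmx_mul !mulmxA.
have -> : rowsub g Q *m A *m (rowsub g Q)^T = diag_mx (\row_i d 0 (g i)).
  apply/matrixP=> i j; rewrite !mxE.
  have := congr1 (fun M : 'M[R]_n => M (g i) (g j)) QAQ.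
  rewrite !mxE (inj_eq ginj) => <-; apply: eq_bigr => l _; rewrite !mxE; congr (_ * _).
  by apply: eq_bigr => m _; rewrite !mxE.
rewrite qformE; apply: eq_bigr => i _; rewrite (bigD1 i) //= big1 ?addr0 => [|j ji].
  by rewrite !mxE eqxx mulr1n; ring.
by rewrite !mxE eq_sym (negbTE ji) mulr0n mulr0.
Qed.

Lemma ncountE n (E : R) (A : 'M[R]_n) : A^T = A -> Ncount E A = (ncount E A)%:R.
Proof.
move=> /symmetric_spectral[Q [d [QQ QAQ]]].
by rewrite /ncount (Ncount_diag E QQ QAQ) natrK.
Qed.

(** The rows of W are the eigenvectors with eigenvalue at most E. Together with [ncount_high] for
    the remaining ones this is what the variational bounds use of the spectral theorem. *)
Lemma ncount_low n (E : R) (A : 'M[R]_n) : A^T = A ->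
  exists W : 'M[R]_(ncount E A, n), W *m W^T = 1%:M /\
    forall v, qform A (v *m W) <= E * nsq v.
Proof.
move=> /symmetric_spectral[Q [d [QQ QAQ]]].
rewrite /ncount (Ncount_diag E QQ QAQ) natrK; set S := finset _.
have ginj : injective (@enum_val _ (mem S)) by exact: enum_val_inj.
exists (rowsub (@enum_val _ (mem S)) Q); split; first exact: orthonormal_rows.
move=> v; rewrite (qform_rowsub _ ginj QAQ) nsqE mulr_sumr; apply: ler_sum => i _.
by apply: ler_wpM2r; rewrite ?sqr_ge0 //; have := enum_valP i; rewrite inE.
Qed.

Lemma ncount_high n (E : R) (A : 'M[R]_n) : A^T = A -> (ncount E A <= n)%N /\
  exists W : 'M[R]_(n - ncount E A, n), W *m W^T = 1%:M /\
    forall v, v != 0 -> E * nsq v < qform A (v *m W).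
Proof.
move=> /symmetric_spectral[Q [d [QQ QAQ]]].
rewrite /ncount (Ncount_diag E QQ QAQ) natrK; set S := finset _.
split; first by rewrite -[leqRHS]card_ord max_card.
have -> : (n - #|S|)%N = #|~: S|%SET.
  by have := cardsC S; rewrite card_ord => sE; rewrite -[X in (X - _)%N]sE addKn.
have ginj : injective (@enum_val _ (mem (~: S)%SET)) by exact: enum_val_inj.
exists (rowsub (@enum_val _ (mem (~: S)%SET)) Q); split; first exact: orthonormal_rows.
move=> v v0; rewrite (qform_rowsub _ ginj QAQ) nsqE mulr_sumr.
have dE (i : 'I_#|(~: S)%SET|) : E < d 0 (enum_val i) by have := enum_valP i; rewrite !inE -ltNge.
have [i vi] : exists i, v 0 i != 0.
  have [/existsP //|/existsPn vi] := boolP [exists i, v 0 i != 0].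
  by case/eqP: v0; apply/rowP => i; rewrite mxE; apply/eqP; have := vi i; rewrite negbK.
rewrite (bigD1 i) //= [ltRHS](bigD1 i) //=; apply: ltr_leD.
  by rewrite ltr_pM2r // lt0r sqr_ge0 sqrf_eq0 vi.
by apply: ler_sum => j _; rewrite ler_wpM2r ?sqr_ge0 // ltW.
Qed.

(** Dimension count behind the min-max principle: the span of W meets the span of the eigenvectors
    above E only in 0, because the form exceeds E times the norm there. *)
Lemma ncount_ge n k (E : R) (A : 'M[R]_n) (W : 'M[R]_(k, n)) : A^T = A ->
  row_free W -> (forall v, qform A (v *m W) <= E * nsq (v *m W)) ->
  (k <= ncount E A)%N.
Proof.
move=> Asym Wf WE; have [kn [U [UU UE]]] := ncount_high E Asym.
have Uf : row_free U by apply/row_freeP; exists U^T.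
have : (W :&: U)%MS = 0.
  apply/eqP; rewrite -submx0; apply/rV_subP => w; rewrite sub_capmx => /andP[/submxP[v wv] /submxP[u wu]].
  rewrite submx0 wu; have [->|u0] := eqVneq u 0; first by rewrite mul0mx.
  by have := UE _ u0; rewrite -wu wv ltNge (le_trans (WE v)) // -wv wu nsq_orth.
move/mxrank_disjoint_sum => dWU; have := rank_leq_col (W + U)%MS.
rewrite dWU; move: Wf Uf; rewrite /row_free => /eqP -> /eqP ->.
by move: kn; clear; lia.
Qed.

(** The same dimension count, now against the eigenvectors at or below E. *)
Lemma ncount_le n k (E : R) (A : 'M[R]_n) (W : 'M[R]_(k, n)) : A^T = A ->
  row_free W -> (forall v, v != 0 -> E * nsq (v *m W) < qform A (v *m W)) ->
  (ncount E A + k <= n)%N.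
Proof.
move=> Asym Wf WE; have [U [UU UE]] := ncount_low E Asym.
have Uf : row_free U by apply/row_freeP; exists U^T.
have : (U :&: W)%MS = 0.
  apply/eqP; rewrite -submx0; apply/rV_subP => w; rewrite sub_capmx => /andP[/submxP[u wu] /submxP[v wv]].
  rewrite submx0 wv; have [->|v0] := eqVneq v 0; first by rewrite mul0mx.
  by have := WE _ v0; rewrite -wv wu ltNge nsq_orth // UE.
move/mxrank_disjoint_sum => dWU; have := rank_leq_col (U + W)%MS.
by rewrite dWU; move: Wf Uf; rewrite /row_free => /eqP -> /eqP ->.
Qed.

(** Comparing the shifted forms A - E and A' - E' covers a change of energy and a change of
    potential at once. *)
Lemma ncount_mono n (E E' : R) (A A' : 'M[R]_n) : A^T = A -> A'^T = A' ->
  (forall w, qform A' w - E' * nsq w <= qform A w - E * nsq w) ->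
  (ncount E A <= ncount E' A')%N.
Proof.
move=> As A's h; have [W [WW WE]] := ncount_low E As.
apply: (@ncount_ge _ _ _ _ W) => //; first by apply/row_freeP; exists W^T.
move=> v; have := h (v *m W); have := WE v; rewrite nsq_orth //; lra.
Qed.

Lemma mulmx_mxblock (N : nat) (r : 'I_N -> nat) n (B : forall c, 'M[R]_(r c, n))
    (A : 'M[R]_n) :
  (\mxcol_c B c) *m A *m (\mxcol_c B c)^T = \mxblock_(c, c') (B c *m A *m (B c')^T).
Proof. by rewrite mxcol_mul tr_mxcol mul_mxcol_mxrow. Qed.

Lemma nsq_mxrow (N : nat) (r : 'I_N -> nat) (v : forall c, 'rV[R]_(r c)) :
  nsq (\mxrow_c v c) = \sum_c nsq (v c).
Proof. by rewrite /nsq tr_mxrow mul_mxrow_mxcol summxE. Qed.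

Lemma qform_mxdiag (N : nat) (r : 'I_N -> nat) (v : forall c, 'rV[R]_(r c))
   (D : forall c, 'M[R]_(r c)) :
  qform (\mxdiag_c D c) (\mxrow_c v c) = \sum_c qform (D c) (v c).
Proof. by rewrite /qform mul_mxrow_mxdiag tr_mxrow mul_mxrow_mxcol summxE. Qed.

(** * Decoupling into orthogonal blocks *)

Section Compression.
Variables (b n N : nat) (E : R) (A : 'M[R]_b) (M : 'I_N -> 'M[R]_(n, b)).
Hypothesis Asym : A^T = A.
Hypothesis MM : forall c, M c *m (M c)^T = 1%:M.
Hypothesis MM0 : forall c c', c != c' -> M c *m (M c')^T = 0.
Hypothesis MAM0 : forall c c', c != c' -> M c *m A *m (M c')^T = 0.

Let Ac c := M c *m A *m (M c)^T.

Let Acsym c : (Ac c)^T = Ac c.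
Proof. by rewrite /Ac !trmx_mul trmxK Asym mulmxA. Qed.

Section Assemble.
Variables (r : 'I_N -> nat) (W : forall c, 'M[R]_(r c, n)).
Hypothesis WW : forall c, W c *m (W c)^T = 1%:M.
Let U : 'M[R]_(\sum_c r c, b) := \mxcol_c (W c *m M c).

Let UU : U *m U^T = 1%:M.
Proof.
have := mulmx_mxblock (fun c => W c *m M c) 1%:M; rewrite mulmx1 => ->.
rewrite -mxdiagZ; apply: eq_mxblock => c c'; rewrite mulmx1 trmx_mul mulmxA -(mulmxA (W c)).
case: eqP => [<-|/eqP cc'].
  by rewrite conform_mx_id MM mulmx1 WW.
by rewrite MM0 // mulmx0 mul0mx.
Qed.

Let UAU : U *m A *m U^T = \mxdiag_c (W c *m Ac c *m (W c)^T).
Proof.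
rewrite mulmx_mxblock; apply: eq_mxblock => c c'; rewrite trmx_mul.
have -> : W c *m M c *m A *m ((M c')^T *m (W c')^T) = W c *m (M c *m A *m (M c')^T) *m (W c')^T.
  by rewrite !mulmxA.
case: eqP => [<-|/eqP cc']; first by rewrite conform_mx_id.
by rewrite MAM0 // mulmx0 mul0mx.
Qed.

Let qU v : qform A (v *m U) = \sum_c qform (Ac c) (submxrow v c *m W c).
Proof.
have -> : qform A (v *m U) = qform (U *m A *m U^T) v.
  by rewrite /qform trmx_mul !mulmxA.
rewrite UAU -[v in LHS]submxrowK qform_mxdiag; apply: eq_bigr => c _.
by rewrite /qform trmx_mul !mulmxA.
Qed.

(** Rows chosen block by block stay orthonormal, and distinct blocks do not interact through A, so
    the form of a combination is the sum of the block forms: test spaces of the blocks can be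
    stacked into one. *)
Lemma compression_ge : (forall c v, qform (Ac c) (v *m W c) <= E * nsq v) ->
  (\sum_c r c <= ncount E A)%N.
Proof.
move=> WE; apply: (@ncount_ge _ _ _ _ U) => //; first by apply/row_freeP; exists U^T.
move=> v; rewrite nsq_orth // qU -[v in leRHS]submxrowK nsq_mxrow mulr_sumr.
by apply: ler_sum => c _; exact: WE.
Qed.

Lemma compression_le : (forall c v, v != 0 -> E * nsq v < qform (Ac c) (v *m W c)) ->
  (ncount E A + \sum_c r c <= b)%N.
Proof.
move=> WE; apply: (@ncount_le _ _ _ _ U) => //; first by apply/row_freeP; exists U^T.
move=> v v0; rewrite nsq_orth // qU -[v in ltLHS]submxrowK nsq_mxrow mulr_sumr.
have WE' c : E * nsq (submxrow v c) <= qform (Ac c) (submxrow v c *m W c).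
  have [->|/(WE c)/ltW //] := eqVneq (submxrow v c) 0.
  by rewrite mul0mx /nsq /qform !mul0mx !mxE mulr0.
have [c vc] : exists c, submxrow v c != 0.
  have [/existsP //|/existsPn vi] := boolP [exists c, submxrow v c != 0].
  case/eqP: v0; rewrite -[v]submxrowK -mxrow0; apply: eq_mxrow => c.
  by apply/eqP; have := vi c; rewrite negbK.
rewrite (bigD1 c) //= [ltRHS](bigD1 c) //=; apply: ltr_leD; first exact: WE.
by apply: ler_sum => j _; exact: WE'.
Qed.

End Assemble.

(* Cauchy interlacing: deleting [b - N * n] coordinates decouples the blocks. *)
Theorem ncount_blocks :
  (\sum_c ncount E (Ac c) <= ncount E A)%N /\
  (ncount E A + N * n <= \sum_c ncount E (Ac c) + b)%N.
Proof.
split.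
  pose W c := projT1 (cid (ncount_low E (Acsym c))).
  have hW c := projT2 (cid (ncount_low E (Acsym c))).
  by apply: (@compression_ge _ W) => c; [exact: (hW c).1 | exact: (hW c).2].
have hi c := ncount_high E (Acsym c).
pose W c := projT1 (cid (hi c).2).
have hW c := projT2 (cid (hi c).2).
have : (ncount E A + \sum_c (n - ncount E (Ac c)) <= b)%N.
  by apply: (@compression_le _ W) => c; [exact: (hW c).1 | exact: (hW c).2].
have -> : (N * n = \sum_c (n - ncount E (Ac c)) + \sum_c ncount E (Ac c))%N.
  rewrite -big_split /= (eq_bigr (fun=> n)) ?sum_nat_const ?card_ord //.
  by move=> c _; rewrite subnK // (hi c).1.
by move=> h; rewrite addnA [leqRHS]addnC leq_add2r.
Qed.

End Compression.

End EigenvalueCount.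

(** * Geometry of the lattice *)

Section Cells.

Definition pw (n : nat) : int := (expn 2 n)%:Z.

Lemma pw0 : pw 0 = 1. Proof. by []. Qed.
Lemma pwS n : pw n.+1 = pw n + pw n.
Proof. by rewrite /pw expnS mul2n -addnn PoszD. Qed.
Lemma pw_gt0 n : 0 < pw n.
Proof. by rewrite /pw ltz_nat expn_gt0. Qed.
Lemma pwD k m : pw (k + m) = pw m * pw k.
Proof. by rewrite /pw expnD mulnC PoszM. Qed.

Lemma ptP (p q : pt) : p.1 = q.1 -> p.2 = q.2 -> p = q.
Proof. by case: p q => [a b] [c e] /= -> ->. Qed.

Definition psub (p q : pt) : pt := (p.1 - q.1, p.2 - q.2).

Lemma paddK q : cancel (padd ^~ q) (psub ^~ q).
Proof. by move=> p; apply: ptP => /=; rewrite addrK. Qed.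
Lemma psubK q : cancel (psub ^~ q) (padd ^~ q).
Proof. by move=> p; apply: ptP => /=; rewrite subrK. Qed.

Lemma mem_map_padd (s : seq pt) q p : (p \in map (padd ^~ q) s) = (psub p q \in s).
Proof.
apply/mapP/idP => [[x xs ->]|h]; first by rewrite paddK.
by exists (psub p q); rewrite ?psubK.
Qed.

Fixpoint cells (n : nat) : seq pt :=
  if n is n'.+1 then cells n' ++ map (padd ^~ (pw n', 0)) (cells n') ++
                       map (padd ^~ (0, pw n')) (cells n')
  else [:: O].

Lemma mem_cellsS n (t : pt) : (t \in cells n.+1) =
  [|| t \in cells n, psub t (pw n, 0) \in cells n | psub t (0, pw n) \in cells n].
Proof. by rewrite /= !mem_cat !mem_map_padd. Qed.

Lemma cellP n (t : pt) : cell n t <-> t \in cells n.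
Proof.
elim: n t => [|n IH] t; first by rewrite inE; split=> [->|/eqP].
rewrite mem_cellsS /psub /= !subr0 /=; split.
  by case=> [/IH -> //|[/IH ->|/IH ->]]; rewrite !orbT.
by case/or3P => /IH h; [left | right; left | right; right].
Qed.

Lemma cells_bound n (t : pt) : t \in cells n -> 0 <= t.1 /\ 0 <= t.2 /\ t.1 + t.2 < pw n.
Proof.
elim: n t => [|n IH] t; first by rewrite inE => /eqP ->.
rewrite mem_cellsS pwS => h; have := pw_gt0 n; by case/or3P: h => /IH /=; lia.
Qed.

Lemma cells_mono n n' : (n <= n')%N -> {subset cells n <= cells n'}.
Proof.
move=> /subnK <- t tn; elim: (n' - n)%N => // k IH.
by rewrite addSn mem_cellsS IH.
Qed.

(** The two shifted copies in T_(n+1) have coordinate sum at least 2^n, so a cell below that height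
    already lies in the unshifted copy. *)
Lemma cells_small n n' (t : pt) : t \in cells n -> t.1 + t.2 < pw n' -> t \in cells n'.
Proof.
move=> tn tn'; have [|/ltnW/cells_mono /(_ t)] := leqP n n'; first by move=> /cells_mono; exact.
move=> _; elim: n tn => [|n IH] tn.
  by move: tn; rewrite inE => /eqP ->; apply: (@cells_mono 0) => //; rewrite inE.
have [|nn'] := leqP n.+1 n'; first by move=> /cells_mono; exact.
have pwn : pw n' <= pw n by rewrite /pw lez_nat leq_pexp2l.
have := cells_bound tn; move: tn; rewrite mem_cellsS => /or3P[|/cells_bound /=|/cells_bound /=];
  [by move=> /IH|move=> ? ?; exfalso; lia|move=> ? ?; exfalso; lia].
Qed.

Lemma uniq_cells n : uniq (cells n).
Proof.
elim: n => //= n IH; rewrite !cat_uniq !map_inj_uniq ?IH //=; try exact: can_inj (paddK _).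
rewrite andbT; have p0 := pw_gt0 n; apply/andP; split; apply/hasPn => t; rewrite ?mem_cat !mem_map_padd.
  by apply/contraL=> /cells_bound h; apply/negP => /orP[] /cells_bound /=; lia.
by apply/contraL=> /cells_bound /= h; apply/negP => /cells_bound /=; lia.
Qed.

Lemma size_cells n : size (cells n) = (3 ^ n)%N.
Proof. by elim: n => //= n IH; rewrite !size_cat !size_map IH expnS; lia. Qed.

Definition scale m (t : pt) : pt := (pw m * t.1, pw m * t.2).

(** Self-similarity: scaling T_k by 2^m and filling each of its triangles with a copy of T_m yields
    T_(k+m). *)
Lemma cells_add k m :
  cells (k + m) = [seq padd (scale m t) s | t <- cells k, s <- cells m].
Proof.
elim: k => [|k IH] /=.
  rewrite cats0 -[LHS]map_id; apply: eq_map => t; apply: ptP => /=; lia.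
rewrite !allpairs_cat IH; congr (_ ++ (_ ++ _)).
  rewrite allpairs_mapl map_allpairs; apply: eq_allpairs => t s; apply: ptP => /=; rewrite ?pwD; lia.
rewrite allpairs_mapl map_allpairs; apply: eq_allpairs => t s; apply: ptP => /=; rewrite ?pwD; lia.
Qed.

Definition tri (t : pt) : seq pt := [:: t; padd t (1, 0); padd t (0, 1)].

Lemma mem_tri (t v : pt) : reflect
  [\/ v = t, v = padd t (1, 0) | v = padd t (0, 1)] (v \in tri t).
Proof.
rewrite !inE; apply: (iffP or3P) => -[h|h|h];
  (try by move/eqP: h => h; [constructor 1|constructor 2|constructor 3]).
- by constructor 1; exact/eqP.
- by constructor 2; exact/eqP.
- by constructor 3; exact/eqP.
- by constructor 1; exact/eqP.
- by constructor 2; exact/eqP.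
- by constructor 3; exact/eqP.
Qed.

Lemma mem_tri_padd (t v q : pt) : (v \in tri (padd t q)) = (psub v q \in tri t).
Proof.
case: t v q => [a b] [c e] [g h].
rewrite /tri /padd /psub !inE !xpair_eqE /=; apply/idP/idP; lia.
Qed.

Lemma mem_triE (t v : pt) : v \in tri t ->
  (v.1 = t.1 /\ v.2 = t.2) \/ (v.1 = t.1 + 1 /\ v.2 = t.2) \/ (v.1 = t.1 /\ v.2 = t.2 + 1).
Proof. by case/mem_tri => -> /=; lia. Qed.

Lemma uniq_tri (t : pt) : uniq (tri t).
Proof.
case: t => a b; rewrite /tri /padd /= !inE !xpair_eqE. lia.
Qed.

Definition verts n : seq pt := undup (flatten [seq tri t | t <- cells n]).

Lemma vertsP n (v : pt) : reflect (exists2 t : pt, t \in cells n & v \in tri t) (v \in verts n).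
Proof. by rewrite mem_undup; exact: flatten_mapP. Qed.

Lemma verts_bound n (v : pt) : v \in verts n -> 0 <= v.1 /\ 0 <= v.2 /\ v.1 + v.2 <= pw n.
Proof. by case/vertsP => t /cells_bound h /mem_triE; lia. Qed.

Definition corners n : seq pt := [:: (0, 0); (pw n, 0); (0, pw n)].

Definition intv n : seq pt := [seq v <- verts n | v \notin corners n].

Definition cnt n v : nat := count (fun t => v \in tri t) (cells n).

Lemma cntS n (v : pt) : cnt n.+1 v = (cnt n v + cnt n (psub v (pw n, 0%R)) + cnt n (psub v (0%R, pw n)))%N.
Proof.
rewrite /cnt /= !count_cat !count_map addnA; congr (_ + _ + _)%N;
  by apply: eq_count => t /=; rewrite mem_tri_padd.
Qed.

Lemma cnt_gt0 n (v : pt) : (0 < cnt n v)%N = (v \in verts n).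
Proof. by rewrite -has_count; apply/hasP/vertsP. Qed.

Lemma cnt_out n (v : pt) : ~~ [&& 0 <= v.1, 0 <= v.2 & v.1 + v.2 <= pw n] -> cnt n v = 0%N.
Proof.
move=> h; apply/eqP; rewrite -leqn0 leqNgt cnt_gt0; apply: contra h => /verts_bound; lia.
Qed.

Lemma mem_corners n (v : pt) : (v \in corners n) =
  [|| (v.1 == 0) && (v.2 == 0), (v.1 == pw n) && (v.2 == 0) | (v.1 == 0) && (v.2 == pw n)].
Proof. by case: v => a b; rewrite !inE !xpair_eqE. Qed.

(* Two subtriangles of T_(n+1) meet only in a common corner. *)
Lemma cnt_val n (v : pt) :
  if v \in corners n then cnt n v = 1%N else cnt n v = 0%N \/ cnt n v = 2%N.
Proof.
elim: n v => [|n IH] v.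
  rewrite mem_corners /cnt pw0 /=; case: v => a b; rewrite /tri !inE /= /padd !xpair_eqE /=.
  by case: ifP; lia.
have := (IH v, IH (psub v (pw n, 0)), IH (psub v (0, pw n))).
rewrite cntS !mem_corners pwS /psub /= !subr0; case=> -[].
move=> i1 i2 i3; move: (@cnt_out n v) (@cnt_out n (psub v (pw n, 0))) (@cnt_out n (psub v (0, pw n))) i1 i2 i3.
rewrite /psub /= !subr0.
have q0 := pw_gt0 n; case: v => a b /=; move: (pw n) q0 (cnt n _) (cnt n _) (cnt n _) => q q0 c1 c2 c3.
(* The three junctions of T_(n+1): each is a corner of two of the copies, which contribute 1 each,
   and lies outside the third. *)
have [J|nJ] := boolP [|| (a == q) && (b == 0), (a == 0) && (b == q) | (a == q) && (b == q)].
  case/or3P: J => /andP[/eqP a0 /eqP b0] o1 o2 o3.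
  - have {}o3 : c1 = 0%N by apply: o3; lia.
    do 4 (case: ifP => [h|/negbT h]; try (exfalso; move: h q0 a0 b0; clear; lia); clear h); lia.
  - have {}o2 : c2 = 0%N by apply: o2; lia.
    do 4 (case: ifP => [h|/negbT h]; try (exfalso; move: h q0 a0 b0; clear; lia); clear h); lia.
  - have {}o1 : c3 = 0%N by apply: o1; lia.
    do 4 (case: ifP => [h|/negbT h]; try (exfalso; move: h q0 a0 b0; clear; lia); clear h); lia.
(* The outer corners of T_(n+1): each is a corner of one copy and lies outside the other two. *)
have [/or3P[]/andP[/eqP a0 /eqP b0] o1 o2 o3|nC] :=
  boolP [|| (a == 0) && (b == 0), (a == q + q) && (b == 0) | (a == 0) && (b == q + q)].
- rewrite o2 ?o3; [|lia|lia]; move=> d1 d2 d3; move: d1.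
  case: ifP => [_|/negbT h]; last by (exfalso; move: h q0 a0 b0; clear; lia).
  by move=> ->.
- rewrite o1 ?o3; [|lia|lia]; move=> d1 d2 d3; move: d2.
  case: ifP => [_|/negbT h]; last by (exfalso; move: h q0 a0 b0; clear; lia).
  by move=> ->.
- rewrite o1 ?o2; [|lia|lia]; move=> d1 d2 d3; move: d3.
  case: ifP => [_|/negbT h]; last by (exfalso; move: h q0 a0 b0; clear; lia).
  by move=> ->.
(* Elsewhere every term is 0 or 2, and the triangles bounding two copies share no point but a
   junction, so at most one term is non-zero. *)
move=> o1 o2 o3 d1 d2 d3.
have {}d1 : c3 = 0%N \/ c3 = 2%N by move: d1; case: ifP => [h|_ //]; exfalso; move: h q0 nJ nC; clear; lia.
have {}d2 : c2 = 0%N \/ c2 = 2%N by move: d2; case: ifP => [h|_ //]; exfalso; move: h q0 nJ nC; clear; lia.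
have {}d3 : c1 = 0%N \/ c1 = 2%N by move: d3; case: ifP => [h|_ //]; exfalso; move: h q0 nJ nC; clear; lia.
have e12 : c3 = 0%N \/ c2 = 0%N.
  have [h|/o1 ->] := boolP [&& 0 <= a, 0 <= b & a + b <= q]; [right; apply: o2|by left].
  by move: h q0 nJ nC; clear; lia.
have e13 : c3 = 0%N \/ c1 = 0%N.
  have [h|/o1 ->] := boolP [&& 0 <= a, 0 <= b & a + b <= q]; [right; apply: o3|by left].
  by move: h q0 nJ nC; clear; lia.
have e23 : c2 = 0%N \/ c1 = 0%N.
  have [h|/o2 ->] := boolP [&& 0 <= a - q, 0 <= b & a - q + b <= q]; [right; apply: o3|by left].
  by move: h q0 nJ nC; clear; lia.
move: d1 d2 d3 e12 e13 e23; clear; lia.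
Qed.

End Cells.

(** * Both halves of the lattice, vertices and balls *)

Section Lattice.

Lemma count_mem_subset (T : eqType) (s u : seq T) :
  uniq s -> uniq u -> {subset s <= u} -> count (mem s) u = size s.
Proof.
move=> us uu su; rewrite -size_filter; apply: perm_size; apply: uniq_perm => //.
  exact: filter_uniq.
by move=> x; rewrite mem_filter; apply: andb_idr => /su.
Qed.

Lemma sum_seq_const (T : Type) (s : seq T) k : (\sum_(x <- s) k = size s * k)%N.
Proof. by rewrite big_const_seq count_predT iter_addn addn0 mulnC. Qed.

Lemma sum_cnt n : (\sum_(v <- verts n) cnt n v = 3 ^ n.+1)%N.
Proof.
under eq_bigr do rewrite /cnt -sum1_count big_mkcond /=.
rewrite exchange_big /= (eq_big_seq (fun=> 3%N)) => [|t tn].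
  by rewrite sum_seq_const size_cells expnSr.
rewrite -big_mkcond sum1_count (eq_count (a2 := mem (tri t))) //.
rewrite count_mem_subset ?uniq_tri ?undup_uniq // => v vt.
by apply/vertsP; exists t.
Qed.

Lemma cnt_corner n (v : pt) : v \in corners n -> cnt n v = 1%N.
Proof. by have := cnt_val n v; case: ifP. Qed.

Lemma corners_verts n : {subset corners n <= verts n}.
Proof. by move=> v /cnt_corner vn; rewrite -cnt_gt0 vn. Qed.

Lemma uniq_corners n : uniq (corners n).
Proof. have := pw_gt0 n; rewrite /corners /= !inE !xpair_eqE; lia. Qed.

Lemma mem_intv n (v : pt) : (v \in intv n) = (cnt n v == 2).
Proof.
rewrite mem_filter -cnt_gt0; have := cnt_val n v; case: ifP => /= _; first by move=> ->.
by case=> ->.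
Qed.

Lemma size_verts n : size (verts n) = (3 + size (intv n))%N.
Proof.
rewrite -(count_predC (mem (corners n))) count_mem_subset ?uniq_corners ?undup_uniq //.
  by rewrite /intv size_filter.
exact: corners_verts.
Qed.

(** Double counting of incidences: the 3^n cells have three vertices each, a corner lies in one cell
    and any other vertex in two. *)
Lemma size_intv n : (3 + 2 * size (intv n) = 3 ^ n.+1)%N.
Proof.
rewrite -sum_cnt (bigID (mem (corners n))) /=; congr addn.
  rewrite (eq_bigr (fun=> 1%N)) => [|v /cnt_corner //].
  by rewrite sum1_count count_mem_subset ?uniq_corners ?undup_uniq //; exact: corners_verts.
rewrite -big_filter -/(intv n) (eq_big_seq (fun=> 2%N)) => [|v].
  by rewrite sum_seq_const mulnC.
by rewrite mem_intv => /eqP.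
Qed.

Lemma intv_verts n : {subset intv n <= verts n}.
Proof. by move=> v; rewrite mem_filter => /andP[]. Qed.

Lemma uniq_intv n : uniq (intv n).
Proof. by rewrite filter_uniq // undup_uniq. Qed.

Lemma mirrorK : involutive mirror.
Proof. by move=> p; apply: ptP => //=; rewrite opprB opprK addrAC subrr add0r. Qed.

Definition side (b : bool) (p : pt) : pt := if b then mirror p else p.

Lemma sideK b : involutive (side b).
Proof. by case: b => //; exact: mirrorK. Qed.

(** A unit triangle of the lattice is coded by its half ([true] for the mirrored one) and a cell of
    T_n in that half. *)
Definition cells2 n : seq (bool * pt) := [seq (b, t) | b <- [:: false; true], t <- cells n].
Definition tri2 (c : bool * pt) : seq pt := map (side c.1) (tri c.2).
(** The position in the lattice of the point [s] of T_m when T_m is put into the level-m triangle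
    with index [c]. *)
Definition place m (c : bool * pt) (s : pt) : pt := side c.1 (padd (scale m c.2) s).

Lemma mem_cells2 n (c : bool * pt) : (c \in cells2 n) = (c.2 \in cells n).
Proof.
apply/allpairsP/idP => [[[b t]] /= [_ h ->] //|h].
by exists c; split=> //; [rewrite !inE; case: (c.1) | case: c h].
Qed.

Lemma uniq_cells2 n : uniq (cells2 n).
Proof. by apply: allpairs_uniq => //; [exact: uniq_cells | move=> [? ?] [? ?] _ _ []-> ->]. Qed.

Lemma size_cells2 n : size (cells2 n) = (2 * 3 ^ n)%N.
Proof. by rewrite size_allpairs size_cells. Qed.

Lemma mem_tri2 (c : bool * pt) (x : pt) : (x \in tri2 c) = (side c.1 x \in tri c.2).
Proof. by rewrite -{1}(sideK c.1 x) mem_map //; exact: inv_inj (sideK _). Qed.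

Lemma uniq_tri2 c : uniq (tri2 c).
Proof. by rewrite map_inj_uniq ?uniq_tri //; exact: inv_inj (sideK _). Qed.

Lemma cells2_mono n n' : (n <= n')%N -> {subset cells2 n <= cells2 n'}.
Proof. by move=> nn' c; rewrite !mem_cells2; exact: cells_mono. Qed.

Lemma tri_vertsE t : tri_verts t = [set` tri t].
Proof.
apply/seteqP; split=> v /=; rewrite /tri_verts.
  by move=> [[->|->]|->]; apply/mem_tri; [constructor 1|constructor 2|constructor 3].
by case/mem_tri => ->; [left; left|left; right|right].
Qed.

Lemma unit_triP Tr : unit_tri Tr <-> exists n (c : bool * pt), c \in cells2 n /\ Tr = [set` tri2 c].
Proof.
have mE t : mirror @` tri_verts t = [set` tri2 (true, t)].
  rewrite tri_vertsE; apply/seteqP; split=> v /=.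
    by move=> [u ut <-]; rewrite mem_tri2 sideK.
  by rewrite mem_tri2 => vt; exists (mirror v); rewrite ?mirrorK.
split=> [[n [t [/cellP tn h]]]|[n [[b t] [ct ->]]]].
  by exists n; case: h => ->; [exists (false, t)|exists (true, t)]; rewrite mem_cells2; split;
     rewrite ?mE // tri_vertsE /tri2 map_id.
exists n, t; split; first by apply/cellP; rewrite mem_cells2 in ct.
by case: b ct => _; [right; rewrite mE|left; rewrite tri_vertsE /tri2 map_id].
Qed.

Lemma vertexP x : vertex x <-> exists n (c : bool * pt), c \in cells2 n /\ x \in tri2 c.
Proof.
split=> [[Tr [/unit_triP[n [c [cn ->]]] /= xc]]|[n [c [cn xc]]]]; first by exists n, c.
by exists [set` tri2 c]; split=> //; apply/unit_triP; exists n, c.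
Qed.

Lemma adjP x y : adj x y <-> x <> y /\ exists n (c : bool * pt), [/\ c \in cells2 n, x \in tri2 c & y \in tri2 c].
Proof.
split=> [[xy [Tr [/unit_triP[n [c [cn ->]]] [/= xc yc]]]]|[xy [n [c [cn xc yc]]]]].
  by split=> //; exists n, c.
by split=> //; exists [set` tri2 c]; split=> //; apply/unit_triP; exists n, c.
Qed.

(** Graph distance to [O] on vertices: the coordinate sum or, on the mirrored half, that of the
    mirror image, (-a-b) + b = -a. *)
Definition height (p : pt) : int := if 0 <= p.1 then p.1 + p.2 else - p.1.

Lemma height_side b (p : pt) : 0 <= p.1 -> 0 <= p.2 -> height (side b p) = p.1 + p.2.
Proof. by move=> h1 h2; rewrite /height; case: b => /=; case: ifP => //; lia. Qed.

Lemma tri2_height n (c : bool * pt) (x : pt) : c \in cells2 n -> x \in tri2 c ->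
  c.2.1 + c.2.2 <= height x <= c.2.1 + c.2.2 + 1.
Proof.
rewrite mem_cells2 mem_tri2 => /cells_bound[h1 [h2 _]] /mem_triE h.
rewrite -(sideK c.1 x) height_side; lia.
Qed.

Lemma cells2_small n n' (c : bool * pt) (x : pt) :
  c \in cells2 n' -> x \in tri2 c -> height x < pw n -> c \in cells2 n.
Proof.
move=> cn xc; have /andP[h1 _] := tri2_height cn xc; move: cn; rewrite !mem_cells2 => cn hx.
by apply: cells_small cn _; lia.
Qed.

Definition count2 n (x : pt) : nat := count (fun c => x \in tri2 c) (cells2 n).

Lemma count2E n x : count2 n x = (cnt n x + cnt n (mirror x))%N.
Proof.
rewrite /count2 /cells2 /= cats0 count_cat !count_map; congr addn;
  by apply: eq_count => t /=; rewrite mem_tri2.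
Qed.

Lemma cnt_mirror n (p : pt) : 0 <= p.1 -> 0 <= p.2 -> p != O -> cnt n (mirror p) = 0%N.
Proof.
case: p => a b /= a0 b0; rewrite xpair_eqE => ab; apply: cnt_out => /=; lia.
Qed.

(** Source of the degree 4. The strict height bound excludes the outer corners, whose second cell
    lies beyond level n; [O] is a corner of each half and gets one cell from either. *)
Lemma count2_vertex n x : vertex x -> height x < pw n -> count2 n x = 2%N.
Proof.
move=> /vertexP[n' [c [cn' xc]]] hx; have cn := cells2_small cn' xc hx.
have [p xE [p1 p2]] : exists2 p, x = side c.1 p & p \in verts n /\ p.1 + p.2 < pw n.
  exists (side c.1 x); first by rewrite sideK.
  have pn : side c.1 x \in verts n by apply/vertsP; exists c.2; rewrite -?mem_cells2 -?mem_tri2.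
  split=> //; have [b1 [b2 _]] := verts_bound pn.
  by rewrite -(height_side c.1 b1 b2) sideK.
have -> : count2 n x = (cnt n p + cnt n (mirror p))%N.
  by rewrite count2E xE; case: (c.1) => //=; rewrite mirrorK addnC.
have [b1 [b2 _]] := verts_bound p1; have [p0|p0] := eqVneq p O.
  have -> : mirror p = p by rewrite p0.
  by rewrite cnt_corner // mem_corners p0.
rewrite cnt_mirror // addn0; move: p1; rewrite -cnt_gt0; have := cnt_val n p.
rewrite mem_corners; case: ifP => [h|_ [->|->] //].
by case: p {xE} b1 b2 p2 p0 h => a b /=; rewrite xpair_eqE; lia.
Qed.

(** In T_(n+1) the point p is no outer corner, so it lies in two cells, and only one of them can
    have p as its lower corner. The other cell has its lower corner one step closer to [O]. *)
Lemma verts_pred n (p : pt) : p \in verts n -> p != O ->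
  exists n' (t : pt), [/\ t \in cells n', p \in tri t & t.1 + t.2 + 1 = p.1 + p.2].
Proof.
move=> pn p0; have [b1 [b2 b3]] := verts_bound pn.
have pn1 : p \in verts n.+1.
  by case/vertsP: pn => t tn pt; apply/vertsP; exists t => //; apply: cells_mono tn.
have c2 : cnt n.+1 p = 2%N.
  move: pn1; rewrite -cnt_gt0; have := cnt_val n.+1 p.
  rewrite mem_corners; case: ifP => [h|_ [->|->] //].
  by case: p {pn} b1 b2 b3 p0 h => a b /=; rewrite xpair_eqE pwS; have := pw_gt0 n; lia.
have [/hasP[t tn /andP[pt tp]]|/hasPn h] := boolP (has (fun t => (p \in tri t) && (t != p)) (cells n.+1)).
  exists n.+1, t; split=> //; have := mem_triE pt; move: tp.
  by case: (p) (t) => [a b] [e f] /=; rewrite xpair_eqE; lia.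
have : (cnt n.+1 p <= count_mem p (cells n.+1))%N.
  rewrite /cnt -!sum1_count big_mkcond [leqRHS]big_mkcond /= big_seq [leqRHS]big_seq.
  by apply: leq_sum => t /h /=; rewrite negb_and negbK => /orP[/negbTE ->|->] //; case: (_ \in _).
by rewrite c2 count_uniq_mem ?uniq_cells //; case: (_ \in _).
Qed.

(** At height exactly 2^L the given cell may stick out of T_L; then the cell below x supplied by
    [verts_pred] is used. *)
Lemma ball_cell L (x : pt) : vertex x -> height x <= pw L -> exists2 c : bool * pt, c \in cells2 L & x \in tri2 c.
Proof.
move=> /vertexP[n [c [cn xc]]] hx.
have [xL|xL] := ltP (height x) (pw L); first by exists c => //; exact: cells2_small cn xc xL.
have pn : side c.1 x \in verts n by apply/vertsP; exists c.2; rewrite -?mem_cells2 -?mem_tri2.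
have [b1 [b2 _]] := verts_bound pn.
have hE : height x = (side c.1 x).1 + (side c.1 x).2 by rewrite -(height_side c.1 b1 b2) sideK.
have p0 : side c.1 x != O.
  by apply/eqP => e; move: xL; rewrite hE e /=; have := pw_gt0 L; lia.
have [n' [t [tn' pt tp]]] := verts_pred pn p0.
exists (c.1, t); last by rewrite mem_tri2.
rewrite mem_cells2; apply: cells_small tn' _ => /=. lia.
Qed.

Lemma adj_height x y : adj x y -> `|height x - height y| <= 1.
Proof.
by move=> /adjP[_ [n [c [cn /(tri2_height cn) + /(tri2_height cn)]]]]; lia.
Qed.

Lemma within_height k x y : Defs.within k x y -> `|height x - height y| <= k%:Z.
Proof.
elim: k x => [|k IH] x /=; first by move=> ->; rewrite subrr.
by case=> [/IH|[z [/adj_height + /IH]]]; lia.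
Qed.

Lemma within_snoc k x y z : Defs.within k x y -> adj y z -> Defs.within k.+1 x z.
Proof.
elim: k x => [|k IH] x /=; first by move=> -> yz; right; exists z.
case=> [h|[u [xu uy]]] yz; first by left; exact: IH yz.
by right; exists u; split=> //; exact: IH yz.
Qed.

Lemma within_mono k k' x y : (k <= k')%N -> Defs.within k x y -> Defs.within k' x y.
Proof. by move=> /subnK <- h; elim: (k' - k)%N => //= m IH; left. Qed.

Lemma within_vertex k b n (p : pt) : p \in verts n -> p.1 + p.2 = k%:Z -> Defs.within k O (side b p).
Proof.
elim: k n p => [|k IH] n p pn pk; have [b1 [b2 _]] := verts_bound pn.
  have -> : p = O by apply: ptP => /=; lia.
  by case: (b).
have p0 : p != O by apply/eqP => e; move: pk; rewrite e /=; lia.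
have [n' [t [tn' pt tp]]] := verts_pred pn p0.
apply: (@within_snoc _ _ (side b t)).
  by apply: (IH n'); [apply/vertsP; exists t => //; rewrite inE eqxx | lia].
apply/adjP; split=> [/(inv_inj (sideK b)) e|]; first by move: tp; rewrite e; lia.
by exists n', (b, t); rewrite mem_cells2 !mem_tri2 !sideK; split=> //; rewrite inE eqxx.
Qed.

(** The ball is exactly the two copies of T_L: an edge changes [height] by at most 1, and conversely
    [verts_pred] descends to [O] in [height] many steps. *)
Lemma ballP L x : (vertex x /\ Defs.within (expn 2 L) O x) <->
  exists2 c : bool * pt, c \in cells2 L & x \in tri2 c.
Proof.
split=> [[vx /within_height]|[c cL xc]].
  by rewrite {1}/height /= => h; apply: ball_cell => //; rewrite /pw; lia.
split; first by apply/vertexP; exists L, c.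
have pn : side c.1 x \in verts L by apply/vertsP; exists c.2; rewrite -?mem_cells2 -?mem_tri2.
have [b1 [b2 b3]] := verts_bound pn.
rewrite -(sideK c.1 x); apply: (@within_mono (absz ((side c.1 x).1 + (side c.1 x).2))).
  by move: b3; rewrite /pw; lia.
by apply: within_vertex pn _; lia.
Qed.

Definition ballpts L : seq pt := verts L ++ [seq mirror v | v <- verts L & v != O].

Lemma mem_ballpts L x : reflect (exists2 c : bool * pt, c \in cells2 L & x \in tri2 c) (x \in ballpts L).
Proof.
rewrite mem_cat; apply: (iffP orP) => [[/vertsP[t tL xt]|/mapP[v]]|[[[] t]]].
- by exists (false, t); rewrite ?mem_cells2 ?mem_tri2.
- rewrite mem_filter => /andP[_ /vertsP[t tL xt]] ->.
  by exists (true, t); rewrite ?mem_cells2 ?mem_tri2 // sideK.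
- rewrite mem_cells2 mem_tri2 /= => tL xt.
  have mv : mirror x \in verts L by apply/vertsP; exists t.
  have [m0|m0] := eqVneq (mirror x) O.
    by left; rewrite -(mirrorK x) m0; move: mv; rewrite m0.
  by right; apply/mapP; exists (mirror x); rewrite ?mirrorK // mem_filter m0.
- by rewrite mem_cells2 mem_tri2 /= => tL xt; left; apply/vertsP; exists t.
Qed.

Lemma uniq_ballpts L : uniq (ballpts L).
Proof.
rewrite cat_uniq undup_uniq map_inj_uniq ?filter_uniq ?undup_uniq //; last exact: inv_inj mirrorK.
rewrite andbT; apply/hasPn => _ /mapP[v + ->]; rewrite mem_filter => /andP[v0 /verts_bound[b1 [b2 _]]].
by rewrite -cnt_gt0 cnt_mirror.
Qed.

(** The two halves share only [O], so the size is 2 |[verts L]| - 1, and 2 |[verts L]| = 3^(L+1) +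
    3. *)
Lemma size_ballpts L : size (ballpts L) = (3 ^ L.+1 + 2)%N.
Proof.
rewrite size_cat size_map size_filter.
have : count (pred1 O) (verts L) = 1%N.
  rewrite count_uniq_mem ?undup_uniq //.
  by have -> : O \in verts L by apply: corners_verts; rewrite inE eqxx.
have := count_predC (pred1 O) (verts L); have := size_intv L; have := size_verts L.
move=> sv si; rewrite -[X in _ = X -> _]/(size (verts L)) => cc c1.
have -> : count (fun v => v != O) (verts L) = (size (verts L) - 1)%N.
  by rewrite -cc c1 add1n subn1.
by move: sv si; move: (3 ^ _)%N (size (intv L)) (size (verts L)) => a b c; lia.
Qed.

End Lattice.

(** * Triangles of level m inside a ball *)

Section Placement.

Lemma mirror_disjoint (p : pt) : 0 <= p.1 -> 0 <= p.2 ->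
  0 <= (mirror p).1 -> p = O.
Proof. by move=> h1 h2 /= h3; apply: ptP => /=; lia. Qed.

Lemma side_disjoint b b' (p p' : pt) : side b p = side b' p' ->
  0 <= p.1 -> 0 <= p.2 -> 0 <= p'.1 -> 0 <= p'.2 -> b != b' -> p = O /\ p' = O.
Proof.
move=> e p1 p2 p1' p2' bb'.
have e' : p' = mirror p by rewrite -(sideK b' p') -e; case: (b) (b') bb' => -[] //= _; rewrite ?mirrorK.
have p0 : p = O by apply: mirror_disjoint => //; rewrite -e'.
by rewrite e' p0.
Qed.

Lemma unit_range (q a : int) : 0 < q -> - q <= q * a -> q * a <= q ->
  a = 0 \/ a = 1 \/ a = -1.
Proof.
move=> q0 h1 h2.
have : -1 <= a by rewrite -(ler_pM2l q0) mulrN1.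
have : a <= 1 by rewrite -(ler_pM2l q0) mulr1.
lia.
Qed.

(** A coincidence forces the indices t and t' to differ by at most 1 in each coordinate; distinct
    triangles that close meet only in corners, and s is not a corner. *)
Lemma padd_scale_inj m (t t' s s' : pt) : s \in intv m -> s' \in verts m ->
  padd (scale m t) s = padd (scale m t') s' -> t = t' /\ s = s'.
Proof.
rewrite mem_filter => /andP[sc /verts_bound[b1 [b2 b3]]] /verts_bound[b1' [b2' b3']].
case=> e1 e2; have q0 := pw_gt0 m; move: sc; rewrite mem_corners.
move: t t' s s' b1 b2 b3 b1' b2' b3' e1 e2 => [t1 t2] [t1' t2'] [s1 s2] [s1' s2'] /=.
move: (pw m) q0 => q q0 b1 b2 b3 b1' b2' b3' e1 e2 sc.
have e1' : s1' - s1 = q * (t1 - t1') by rewrite mulrBr; lia.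
have e2' : s2' - s2 = q * (t2 - t2') by rewrite mulrBr; lia.
have d1 : t1 - t1' = 0 \/ t1 - t1' = 1 \/ t1 - t1' = -1.
  by apply: unit_range q0 _ _; lia.
have d2 : t2 - t2' = 0 \/ t2 - t2' = 1 \/ t2 - t2' = -1.
  by apply: unit_range q0 _ _; lia.
have [z1 z2] : t1 - t1' = 0 /\ t2 - t2' = 0.
  move: e1' e2' d1 d2; move: (t1 - t1') (t2 - t2') => a b.
  clear e1 e2; move=> e1 e2 [a0|[a0|a0]] [c0|[c0|c0]]; subst a b;
    rewrite ?mulr0 ?mulr1 ?mulrN1 in e1 e2; try (split; done); exfalso; move: sc; lia.
move: e1' e2'; rewrite z1 z2 !mulr0 => e1' e2'.
by split; apply: ptP => /=; lia.
Qed.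

Lemma padd_scale_ge0 k m (t s : pt) : t \in cells k -> s \in verts m ->
  0 <= (padd (scale m t) s).1 /\ 0 <= (padd (scale m t) s).2.
Proof.
move=> /cells_bound[t1 [t2 _]] /verts_bound[s1 [s2 _]] /=; have /ltW q := pw_gt0 m.
by rewrite !addr_ge0 // mulr_ge0.
Qed.

(** The hypotheses are asymmetric on purpose: [s'] may be a corner, so that an interior site of one
    triangle is separated from every vertex of the others. The two halves meet only in [O], a
    corner. *)
Lemma place_inj k m (c c' : bool * pt) (s s' : pt) :
  c \in cells2 k -> c' \in cells2 k -> s \in intv m -> s' \in verts m ->
  place m c s = place m c' s' -> c = c' /\ s = s'.
Proof.
case: c c' => [b t] [b' t']; rewrite !mem_cells2 /= => ct ct' sm sm' e.
have [h1 h2] := padd_scale_ge0 ct (intv_verts sm).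
have [h1' h2'] := padd_scale_ge0 ct' sm'.
have [bb|bb] := eqVneq b b'.
  subst b'; move: e => /(inv_inj (sideK b)) /= e.
  by have [-> ->] := padd_scale_inj sm sm' e.
have [p0 _] := side_disjoint e h1 h2 h1' h2' bb.
move: p0; have [t1 [t2 _]] := cells_bound ct; have [s1 [s2 _]] := verts_bound (intv_verts sm).
case=> e1 e2; have q0 := pw_gt0 m.
have [z1 z2] : s.1 = 0 /\ s.2 = 0.
  have : 0 <= pw m * t.1 by rewrite mulr_ge0 // ltW.
  have : 0 <= pw m * t.2 by rewrite mulr_ge0 // ltW.
  by move: e1 e2 => /=; lia.
by move: sm; rewrite mem_filter mem_corners z1 z2.
Qed.

Definition subcell m (c : bool * pt) (u : pt) : bool * pt := (c.1, padd (scale m c.2) u).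

Lemma padd_tri (q u : pt) : tri (padd q u) = map (padd q) (tri u).
Proof.
rewrite /tri /=; congr [:: _; _; _]; apply: ptP => /=; lia.
Qed.

Lemma tri2_subcell m c u : tri2 (subcell m c u) = map (place m c) (tri u).
Proof. by rewrite /tri2 [(subcell _ _ _).1]/= [(subcell _ _ _).2]/= padd_tri -map_comp. Qed.

Lemma sum_cells2_add (V : nmodType) k m (F : bool * pt -> V) :
  \sum_(c <- cells2 (k + m)) F c = \sum_(c <- cells2 k) \sum_(u <- cells m) F (subcell m c u).
Proof.
rewrite !big_allpairs_dep /=; apply: eq_bigr => b _.
by rewrite cells_add big_allpairs_dep.
Qed.

Lemma subcell_cells2 k m c u : c \in cells2 k -> u \in cells m -> subcell m c u \in cells2 (k + m).
Proof.
rewrite !mem_cells2 => ct um; rewrite cells_add; apply/allpairsP.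
by exists (c.2, u).
Qed.

Lemma place_verts k m c s : c \in cells2 k -> s \in verts m -> place m c s \in ballpts (k + m).
Proof.
move=> ck /vertsP[u um su]; apply/mem_ballpts; exists (subcell m c u).
  exact: subcell_cells2.
by rewrite tri2_subcell map_f.
Qed.

Lemma ballpts_place k m x : x \in ballpts (k + m) ->
  exists c s, [/\ c \in cells2 k, s \in verts m & x = place m c s].
Proof.
move/mem_ballpts => [c]; rewrite mem_cells2 cells_add => /allpairsP[[t u] /= [tk um cE]] xc.
have cE' : c = subcell m (c.1, t) u by rewrite /subcell /= -cE; case: (c).
move: xc; rewrite cE' tri2_subcell => /mapP[s su ->].
by exists (c.1, t), s; split=> //; [rewrite mem_cells2 | apply/vertsP; exists u].
Qed.

(** Within one half all cells are translates of the same upward triangle, which two of its vertices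
    determine; cells of different halves share at most [O]. *)
Lemma pair_unique n (c c' : bool * pt) (x y : pt) : c \in cells2 n -> c' \in cells2 n -> x != y ->
  x \in tri2 c -> y \in tri2 c -> x \in tri2 c' -> y \in tri2 c' -> c = c'.
Proof.
case: c c' => [b t] [b' t']; rewrite !mem_cells2 !mem_tri2 /= => ct ct' xy xc yc xc' yc'.
have [bb|bb] := eqVneq b b'.
  subst b'; congr pair; have {}xy : side b x != side b y by rewrite (inj_eq (inv_inj (sideK b))).
  move: xy (mem_triE xc) (mem_triE yc) (mem_triE xc') (mem_triE yc').
  move: (side b x) (side b y) => [x1 x2] [y1 y2]; rewrite xpair_eqE /= => *; apply: ptP; lia.
have inO z : side b z \in tri t -> side b' z \in tri t' -> z = O.
  have [t1 [t2 _]] := cells_bound ct; have [t1' [t2' _]] := cells_bound ct'.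
  move=> /mem_triE zt /mem_triE zt'.
  have [||||||z0 _] := @side_disjoint b b' (side b z) (side b' z); rewrite ?sideK //; try lia.
  by rewrite -(sideK b z) z0; case: (b).
by move: xy; rewrite (inO x) // (inO y) ?eqxx.
Qed.

End Placement.

(** * Energy forms *)

Section Energy.
Variable R : realType.
Implicit Types (f g : pt -> R).

Definition en (a b c : R) : R := (a - b) ^+ 2 + (b - c) ^+ 2 + (c - a) ^+ 2.
Definition trien f t : R := en (f t) (f (padd t (1, 0))) (f (padd t (0, 1))).
Definition energy m g : R := \sum_(t <- cells m) trien g t.

Lemma en_ge0 a b c : 0 <= en a b c.
Proof. by rewrite !addr_ge0 // sqr_ge0. Qed.

Lemma energy_ge0 m g : 0 <= energy m g.
Proof. by apply: sumr_ge0 => t _; exact: en_ge0. Qed.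

Lemma energyS m g : energy m.+1 g = energy m g + energy m (g \o padd ^~ (pw m, 0)) +
  energy m (g \o padd ^~ (0, pw m)).
Proof.
rewrite /energy /= !big_cat /= !big_map addrA; congr (_ + _ + _); apply: eq_bigr => t _;
  by rewrite /trien /=; congr (en (g _) (g _) (g _)); apply: ptP => /=; lia.
Qed.

Lemma eq_energy m f g : {in verts m, f =1 g} -> energy m f = energy m g.
Proof.
move=> fg; apply: eq_big_seq => t tm; rewrite /trien !fg //; apply/vertsP; exists t => //;
  by rewrite !inE eqxx ?orbT.
Qed.

(** The matrix of the quadratic form [en] on the three vertices of a triangle. *)
Definition edge_kernel (T : seq pt) (x y : pt) : R :=
  if (x \in T) && (y \in T) then (if x == y then 2 else -1) else 0.

Definition ext b (X : 'I_b -> pt) (w : 'rV[R]_b) (p : pt) : R :=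
  \sum_i w 0 i * (X i == p)%:R.

Lemma ext_inj b (X : 'I_b -> pt) w i : injective X -> ext X w (X i) = w 0 i.
Proof.
move=> Xi; rewrite /ext (bigD1 i) //= eqxx mulr1 big1 ?addr0 // => j ji.
by rewrite (inj_eq Xi) (negbTE ji) mulr0.
Qed.

Lemma ext_out b (X : 'I_b -> pt) w p : (forall i, X i != p) -> ext X w p = 0.
Proof. by move=> h; apply: big1 => i _; rewrite (negbTE (h i)) mulr0. Qed.

Lemma edge_kernelE (T : seq pt) x y : uniq T ->
  edge_kernel T x y = \sum_(p <- T) \sum_(q <- T) (x == p)%:R * (y == q)%:R * (if p == q then 2 else -1).
Proof.
move=> uT; rewrite /edge_kernel; have [xT|xT] /= := boolP (x \in T); last first.
  rewrite big1_seq // => p /andP[_ pT]; rewrite big1_seq // => q _.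
  by case: eqP => [xp|]; rewrite ?mul0r //; rewrite xp pT in xT.
rewrite (bigD1_seq x) //= [X in _ + X]big1 ?addr0 => [|p px]; last first.
  by apply: big1 => q _; rewrite eq_sym (negbTE px) !mul0r.
rewrite eqxx; case: ifPn => yT.
  rewrite (bigD1_seq y) //= eqxx big1 ?addr0 ?mul1r ?mulr1 // => q qy.
  by rewrite (eq_sym y) (negbTE qy) mulr0 mul0r.
rewrite big1_seq // => q /andP[_ qT].
by case: eqP => [yq|]; rewrite ?mulr0 ?mul0r //; rewrite yq qT in yT.
Qed.

Lemma form_edge_kernel b (X : 'I_b -> pt) (w : 'rV[R]_b) (T : seq pt) p q r : T = [:: p; q; r] -> uniq T ->
  \sum_i \sum_j w 0 i * w 0 j * edge_kernel T (X i) (X j) = en (ext X w p) (ext X w q) (ext X w r).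
Proof.
move=> TE uT; pose e := ext X w.
transitivity (\sum_(a <- T) \sum_(c <- T) (e a * e c) * (if a == c then 2 else -1)); last first.
  rewrite TE in uT *; move: uT; rewrite /= !inE negb_or => /and3P[/andP[pq pr] qr _].
  rewrite !big_cons !big_nil !eqxx !(eq_sym q p) !(eq_sym r p) !(eq_sym r q).
  rewrite (negbTE pq) (negbTE pr) (negbTE qr) /en /e; ring.
under eq_bigr => i _ do under eq_bigr => j _ do rewrite edge_kernelE // mulr_sumr.
under eq_bigr => i _ do rewrite exchange_big.
rewrite exchange_big /=; apply: eq_bigr => a _.
under eq_bigr => i _ do under eq_bigr => j _ do rewrite mulr_sumr.
under eq_bigr => i _ do rewrite exchange_big.
rewrite exchange_big /=; apply: eq_bigr => c _.
rewrite /e /ext big_distrlr /= mulr_suml; apply: eq_bigr => i _.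
rewrite mulr_suml; apply: eq_bigr => j _; ring.
Qed.

Definition cell_energy f (c : bool * pt) : R := trien (f \o side c.1) c.2.

Lemma cell_energy_ge0 f c : 0 <= cell_energy f c.
Proof. exact: en_ge0. Qed.

Lemma form_tri2 b (X : 'I_b -> pt) (w : 'rV[R]_b) (c : bool * pt) :
  \sum_i \sum_j w 0 i * w 0 j * edge_kernel (tri2 c) (X i) (X j) = cell_energy (ext X w) c.
Proof. by apply: form_edge_kernel; rewrite ?uniq_tri2. Qed.

Lemma form_tri b (X : 'I_b -> pt) (w : 'rV[R]_b) (t : pt) :
  \sum_i \sum_j w 0 i * w 0 j * edge_kernel (tri t) (X i) (X j) = trien (ext X w) t.
Proof. by apply: form_edge_kernel; rewrite ?uniq_tri. Qed.

Definition kernel_sum n (x y : pt) : R := \sum_(c <- cells2 n) edge_kernel (tri2 c) x y.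
Definition tri_kernel m (x y : pt) : R := \sum_(t <- cells m) edge_kernel (tri t) x y.

Lemma form_kernel_sum n b (X : 'I_b -> pt) (w : 'rV[R]_b) :
  \sum_i \sum_j w 0 i * w 0 j * kernel_sum n (X i) (X j) =
  \sum_(c <- cells2 n) cell_energy (ext X w) c.
Proof.
under eq_bigr => i _ do under eq_bigr => j _ do rewrite mulr_sumr.
under eq_bigr => i _ do rewrite exchange_big.
by rewrite exchange_big /=; apply: eq_bigr => c _; exact: form_tri2.
Qed.

Lemma form_tri_kernel m b (X : 'I_b -> pt) (w : 'rV[R]_b) :
  \sum_i \sum_j w 0 i * w 0 j * tri_kernel m (X i) (X j) = energy m (ext X w).
Proof.
under eq_bigr => i _ do under eq_bigr => j _ do rewrite mulr_sumr.
under eq_bigr => i _ do rewrite exchange_big.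
by rewrite exchange_big /=; apply: eq_bigr => c _; exact: form_tri.
Qed.

Lemma edge_kernelC T x y : edge_kernel T x y = edge_kernel T y x.
Proof. by rewrite /edge_kernel andbC eq_sym. Qed.

Lemma kernel_sumC n x y : kernel_sum n x y = kernel_sum n y x.
Proof. by apply: eq_bigr => c _; rewrite edge_kernelC. Qed.

Lemma tri_kernelC n x y : tri_kernel n x y = tri_kernel n y x.
Proof. by apply: eq_bigr => c _; rewrite edge_kernelC. Qed.

Lemma sum_cell_energy k m f :
  \sum_(c <- cells2 (k + m)) cell_energy f c = \sum_(c <- cells2 k) energy m (f \o place m c).
Proof.
rewrite sum_cells2_add; apply: eq_bigr => c _; apply: eq_bigr => u _.
rewrite /cell_energy /trien /place /=.
by congr (en (f (side _ _)) (f (side _ _)) (f (side _ _))); apply: ptP => /=; rewrite addrA.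
Qed.

(** The decoupling: a unit cell containing an interior site of a level-m triangle lies inside that
    triangle, so interior sites of different triangles have no common cell. *)
Lemma kernel_sum_place k m (c c' : bool * pt) (s s' : pt) :
  c \in cells2 k -> c' \in cells2 k -> s \in intv m -> s' \in intv m ->
  kernel_sum (k + m) (place m c s) (place m c' s') = if c == c' then tri_kernel m s s' else 0.
Proof.
move=> ck ck' sm sm'; rewrite /kernel_sum sum_cells2_add.
have memP d z (e : bool * pt) u : d \in cells2 k -> z \in intv m -> e \in cells2 k -> u \in cells m ->
    (place m d z \in tri2 (subcell m e u)) = (d == e) && (z \in tri u).
  move=> dk zm ek um; rewrite tri2_subcell; apply/mapP/andP => [[z' zu]|[/eqP -> zu]]; last by exists z.
  have zm' : z' \in verts m by apply/vertsP; exists u.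
  by move=> /(place_inj dk ek zm zm')[-> ->]; rewrite eqxx.
rewrite (bigD1_seq c) ?uniq_cells2 //= addrC big1_seq ?add0r => [|d /andP[dc dk]]; last first.
  rewrite big1_seq // => u /andP[_ um].
  by rewrite /edge_kernel memP // eq_sym (negbTE dc).
have [<-|cc'] := eqVneq c c'; last first.
  rewrite big1_seq // => u /andP[_ um].
  by rewrite /edge_kernel !memP // (eq_sym c') (negbTE cc') andbF.
have E : (place m c s == place m c s') = (s == s').
  by apply/eqP/eqP => [|-> //]; move=> /(place_inj ck ck sm (intv_verts sm'))[].
by apply: eq_big_seq => u um; rewrite /edge_kernel !memP // !eqxx E.
Qed.

(** Each of the two cells at x contributes two neighbours, and none is repeated because an edge lies
    in a single cell. *)
Lemma deg_vertex n x : vertex x -> height x < pw n -> deg R x = 4.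
Proof.
move=> vx hx.
pose D := [seq c <- cells2 n | x \in tri2 c].
pose s := [seq y <- undup (flatten [seq tri2 c | c <- D]) | y != x].
have us : uniq s by rewrite filter_uniq // undup_uniq.
have sP y : y \in s <-> y <> x /\ exists2 c, c \in D & y \in tri2 c.
  rewrite mem_filter mem_undup; split.
    by move=> /andP[/eqP yx /flatten_mapP[c cD yc]]; split=> //; exists c.
  by case=> /eqP -> [c cD yc]; apply/flatten_mapP; exists c.
have DP c : c \in D = (x \in tri2 c) && (c \in cells2 n) by rewrite mem_filter.
have -> : deg R x = (size s)%:R.
  rewrite /deg (_ : [set y | adj x y] = [set` s]); last first.
    apply/seteqP; split=> y /=.
      move=> /adjP[xy [n' [c [cn xc yc]]]]; apply/sP; split; first by move=> yx; exact: xy.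
      by exists c => //; rewrite DP xc (cells2_small cn xc hx).
    move=> /sP[yx [c]]; rewrite DP => /andP[xc cn] yc; apply/adjP; split; first by move=> yx'; exact: yx.
    by exists n, c.
  by rewrite -fsbig_seq // -sum1_size natr_sum.
suff -> : size s = 4%N by [].
have -> : size s = (\sum_(c <- D) \sum_(y <- s) (y \in tri2 c))%N.
  rewrite exchange_big -sum1_size; apply: eq_big_seq => y /sP[yx [c cD yc]].
  rewrite (bigD1_seq c) ?filter_uniq ?uniq_cells2 //= yc big1_seq // => c' /andP[cc'].
  rewrite DP => /andP[xc' cn'].
  case: (boolP (y \in _)) => // yc'; move: cD; rewrite DP => /andP[xc cn].
  case/eqP: cc'; apply: (@pair_unique n _ _ x y) => //; apply/eqP => xy; exact: yx.
rewrite (eq_big_seq (fun=> 2%N)) => [|c cD].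
  by rewrite sum_seq_const /D size_filter -/(count2 n x) (count2_vertex vx hx).
have xc : x \in tri2 c by move: cD; rewrite DP => /andP[].
have -> : (\sum_(y <- s) (y \in tri2 c) = count (mem (rem x (tri2 c))) s)%N.
  rewrite -sum1_count [RHS]big_mkcond; apply: eq_big_seq => y /sP[/eqP yx _].
  have e : (y \in rem x (tri2 c)) = (y \in tri2 c) by rewrite mem_rem_uniq ?uniq_tri2 // inE yx.
  by rewrite -[X in if X then _ else _]/(y \in rem x (tri2 c)) e; case: (_ \in _).
rewrite count_mem_subset ?rem_uniq ?uniq_tri2 //; first by rewrite size_rem.
by move=> y; rewrite mem_rem_uniq ?uniq_tri2 // inE => /andP[/eqP yx yc]; apply/sP; split=> //; exists c.
Qed.

(** The Laplacian assembled cell by cell: two cells with 2 on the diagonal give the degree 4, and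
    the unique cell of an edge gives its -1. *)
Lemma lap_kernel n x y : vertex x -> height x < pw n -> - lap R x y = kernel_sum n x y.
Proof.
move=> vx hx; rewrite /lap /kernel_sum; have [<-|xy] := eqVneq x y.
  rewrite (deg_vertex vx hx) asboolF => [|[]//].
  rewrite sub0r opprK (eq_bigr (fun c => 2 * (x \in tri2 c)%:R)) => [|c _].
    rewrite -mulr_sumr -natr_sum.
    have -> : (\sum_(c <- cells2 n) (x \in tri2 c) = count2 n x)%N.
      by rewrite /count2 -sum1_count [RHS]big_mkcond; apply: eq_bigr => c _; case: (_ \in _).
    by rewrite (count2_vertex vx hx); ring.
  by rewrite /edge_kernel andbb eqxx; case: ifP; rewrite ?mulr1 ?mulr0.
rewrite subr0; case: asboolP => [/adjP[_ [n' [c [cn' xc yc]]]]|nadj].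
  have cn := cells2_small cn' xc hx.
  rewrite (bigD1_seq c) ?uniq_cells2 //= big1_seq => [|c' /andP[cc' cn'']].
    by rewrite addr0 /edge_kernel xc yc (negbTE xy).
  rewrite /edge_kernel; case: ifP => // /andP[xc' yc'].
  by case/eqP: cc'; exact: pair_unique cn'' cn xy xc' yc' xc yc.
rewrite oppr0 big1_seq // => c /andP[_ cn]; rewrite /edge_kernel; case: ifP => // /andP[xc yc].
by case: nadj; apply/adjP; split; [exact/eqP | exists n, c].
Qed.

End Energy.

(** * The operator on a ball and on its blocks *)

Section BallMatrix.
Variable R : realType.

Definition xpt L (i : 'I_#|BallL L|) : pt := pt_of (enum_val i).

Lemma pt_of_inj L : injective (@pt_of L).
Proof.
move=> [a b] [a' b'] [/(addIr _) [/val_inj ->] /(addIr _) [/val_inj ->]] //.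
Qed.

Lemma xpt_inj L : injective (@xpt L).
Proof. by move=> i j /pt_of_inj /enum_val_inj. Qed.

Lemma mem_BallL L (p : box L) : (p \in BallL L) = (pt_of p \in ballpts L).
Proof. by rewrite inE; apply/asboolP/mem_ballpts => /ballP. Qed.

Lemma pt_of_surj L (x : pt) : x \in ballpts L -> exists p : box L, pt_of p = x.
Proof.
move=> /mem_ballpts[c]; rewrite mem_cells2 mem_tri2 => cL xc.
have xL : side c.1 x \in verts L by apply/vertsP; exists c.2.
have [b1 [b2 b3]] := verts_bound xL.
have [h1 h2] : (- pw L <= x.1 <= pw L) /\ (- pw L <= x.2 <= pw L).
  by rewrite -(sideK c.1 x); case: (c.1) b1 b2 b3 => /=; lia.
have k1 : (absz (x.1 + pw L)%R < (expn 2 L).*2.+1)%N by move: h1; rewrite /pw; lia.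
have k2 : (absz (x.2 + pw L)%R < (expn 2 L).*2.+1)%N by move: h2; rewrite /pw; lia.
exists (Ordinal k1, Ordinal k2); apply: ptP; rewrite /pt_of /=.
  by move: h1; rewrite /pw; lia.
by move: h2; rewrite /pw; lia.
Qed.

Lemma xpt_mem L (i : 'I_#|BallL L|) : xpt i \in ballpts L.
Proof. by rewrite -mem_BallL enum_valP. Qed.

Lemma xpt_surj L (x : pt) : x \in ballpts L -> exists i : 'I_#|BallL L|, xpt i = x.
Proof.
move=> xL; have [p px] := pt_of_surj xL.
have pL : p \in BallL L by rewrite mem_BallL px.
by exists (enum_rank_in pL p); rewrite /xpt enum_rankK_in.
Qed.

Lemma card_BallL L : #|BallL L| = (3 ^ L.+1 + 2)%N.
Proof.
transitivity (size [seq @xpt L i | i <- enum 'I_#|BallL L|]); first by rewrite size_map -cardE card_ord.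
rewrite -size_ballpts; apply: perm_size.
apply: uniq_perm.
- by rewrite map_inj_uniq ?enum_uniq //; exact: xpt_inj.
- exact: uniq_ballpts.
move=> x; apply/mapP/idP => [[i _ ->]|/xpt_surj[i <-]]; first exact: xpt_mem.
by exists i; rewrite ?mem_enum.
Qed.

Lemma ball_vertex L (x : pt) : x \in ballpts L -> vertex x /\ height x < pw L.+1.
Proof.
move=> /mem_ballpts[c cL xc]; split; first by apply/vertexP; exists L, c.
have := tri2_height cL xc; move: cL; rewrite mem_cells2 => /cells_bound.
by rewrite pwS; have := pw_gt0 L; lia.
Qed.

(** Level [L.+1] and not L: the outer corners of the ball keep their full degree 4, so cells leaving
    the ball still contribute to the diagonal. *)
Lemma HBE L (V : pt -> R) i j :
  HB L V i j = kernel_sum R L.+1 (xpt i) (xpt j) + (if i == j then V (xpt i) else 0).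
Proof.
have [vi hi] := ball_vertex (xpt_mem i).
by rewrite mxE /= -/(xpt i) -/(xpt j) (lap_kernel _ _ vi hi) (inj_eq (@xpt_inj L)).
Qed.

Lemma HB_sym L (V : pt -> R) : (HB L V)^T = HB L V.
Proof.
by apply/matrixP => i j; rewrite mxE !HBE kernel_sumC eq_sym; congr (_ + _); case: eqP => // ->.
Qed.

Lemma sum_diag_form b (v : 'I_b -> R) (w : 'rV[R]_b) :
  \sum_i \sum_j w 0 i * w 0 j * (if i == j then v i else 0) = \sum_i v i * w 0 i ^+ 2.
Proof.
apply: eq_bigr => i _; rewrite (bigD1 i) //= eqxx big1 ?addr0 => [|j ji]; first by ring.
by rewrite eq_sym (negbTE ji) mulr0.
Qed.

Lemma qform_HB L (V : pt -> R) w : qform (HB L V) w =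
  \sum_(c <- cells2 L.+1) cell_energy (ext (@xpt L) w) c + \sum_i V (xpt i) * w 0 i ^+ 2.
Proof.
rewrite qformE -form_kernel_sum -sum_diag_form -big_split /=; apply: eq_bigr => i _.
by rewrite -big_split /=; apply: eq_bigr => j _; rewrite HBE mulrDr.
Qed.

Definition ipt m (i : 'I_(size (intv m))) : pt := nth O (intv m) i.

Lemma ipt_inj m : injective (@ipt m).
Proof. by move=> i j /eqP; rewrite nth_uniq ?uniq_intv // => /eqP /val_inj. Qed.

Lemma ipt_mem m i : @ipt m i \in intv m.
Proof. exact: mem_nth. Qed.

Definition blockH m (v : 'I_(size (intv m)) -> R) : 'M[R]_(size (intv m)) :=
  \matrix_(i, j) (tri_kernel R m (ipt i) (ipt j) + (if i == j then v i else 0)).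

Lemma blockH_sym m v : (@blockH m v)^T = blockH v.
Proof.
by apply/matrixP => i j; rewrite !mxE tri_kernelC eq_sym; congr (_ + _); case: eqP => // ->.
Qed.

Lemma qform_blockH m v w : qform (@blockH m v) w =
  energy m (ext (@ipt m) w) + \sum_i v i * w 0 i ^+ 2.
Proof.
rewrite qformE -form_tri_kernel -sum_diag_form -big_split /=; apply: eq_bigr => i _.
by rewrite -big_split /=; apply: eq_bigr => j _; rewrite mxE mulrDr.
Qed.

Definition cellpot m (V : pt -> R) (c : bool * pt) : 'I_(size (intv m)) -> R :=
  fun i => V (place m c (ipt i)).

(** The blocks are the 2 * 3^k level-m triangles without their corners. The deleted corners form a
    scaled copy of B_k, which accounts for the error 3^(k+1) + 2. *)
Lemma ncount_cells k m (E : R) (V : pt -> R) :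
  (\sum_(c <- cells2 k) ncount E (@blockH m (cellpot V c)) <= ncount E (HB (k + m) V))%N /\
  (ncount E (HB (k + m) V) <=
     \sum_(c <- cells2 k) ncount E (@blockH m (cellpot V c)) + (3 ^ k.+1 + 2))%N.
Proof.
pose n := size (intv m); pose N := size (cells2 k).
pose cc (c : 'I_N) := nth (false, O) (cells2 k) c.
have ccP c : cc c \in cells2 k by exact: mem_nth.
have cc_inj : injective cc.
  by move=> c c' /eqP; rewrite nth_uniq ?uniq_cells2 // => /eqP /val_inj.
have /boolp.choice[/= u uE] : forall ci : 'I_N * 'I_n, exists i : 'I_#|BallL (k + m)|,
    xpt i = place m (cc ci.1) (ipt ci.2).
  by move=> [c i]; apply: xpt_surj; apply: place_verts => //; exact: intv_verts (ipt_mem i).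
have u_inj c c' i i' : (u (c, i) == u (c', i')) = (c == c') && (i == i').
  apply/eqP/andP => [e|[/eqP -> /eqP ->] //].
  have := congr1 (@xpt _) e; rewrite !uE /= => /(place_inj (ccP c) (ccP c') (ipt_mem i) (intv_verts (ipt_mem i'))).
  by case=> /cc_inj -> /ipt_inj ->.
pose A := HB (k + m) V.
(* Coordinate selection: conjugating by these matrices extracts submatrices of [A], which reduces
   the hypotheses of [ncount_blocks] to [kernel_sum_place]. *)
pose M c := rowsub (fun i => u (c, i)) (1%:M : 'M[R]_#|BallL (k + m)|).
have MAM c c' : M c *m A *m (M c')^T = mxsub (fun i => u (c, i)) (fun i => u (c', i)) A.
  rewrite /M -rowsubE; apply/matrixP => i j; rewrite !mxE (bigD1 (u (c', j))) //= big1 ?addr0.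
    by rewrite !mxE eqxx mulr1.
  by move=> l lj; rewrite !mxE eq_sym (negbTE lj) mulr0.
have MM c c' : M c *m (M c')^T = mxsub (fun i => u (c, i)) (fun i => u (c', i)) 1%:M.
  rewrite /M; apply/matrixP => i j; rewrite !mxE (bigD1 (u (c', j))) //= big1 ?addr0.
    by rewrite !mxE eqxx mulr1.
  by move=> l lj; rewrite !mxE (eq_sym (u (c', j)) l) (negbTE lj) mulr0.
have [|||h1 h2] := @ncount_blocks R #|BallL (k + m)| n N E A M (HB_sym _ V).
- by move=> c; rewrite MM; apply/matrixP => i j; rewrite !mxE u_inj eqxx.
- by move=> c c' cc'; rewrite MM; apply/matrixP => i j; rewrite !mxE u_inj (negbTE cc').
- move=> c c' cc'; rewrite MAM; apply/matrixP => i j; rewrite [LHS]mxE HBE !uE /= u_inj (negbTE cc') addr0.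
  rewrite -addSn kernel_sum_place ?ipt_mem ?(cells2_mono (leqnSn k)) //.
  by rewrite (inj_eq cc_inj) (negbTE cc') mxE.
have AcE c : M c *m A *m (M c)^T = @blockH m (cellpot V (cc c)).
  rewrite MAM; apply/matrixP => i j; rewrite [LHS]mxE HBE !uE /= u_inj eqxx /=.
  rewrite -addSn kernel_sum_place ?ipt_mem ?(cells2_mono (leqnSn k)) //.
  by rewrite eqxx mxE.
have SE : (\sum_c ncount E (M c *m A *m (M c)^T) =
    \sum_(c <- cells2 k) ncount E (@blockH m (cellpot V c)))%N.
  rewrite (big_nth (false, O)) big_mkord; apply: eq_bigr => c _.
  by rewrite AcE.
rewrite SE in h1 h2; split=> //.
have dim : (N * n + (3 ^ k.+1 + 2) = #|BallL (k + m)|)%N.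
  rewrite card_BallL /N size_cells2 -addnS expnD.
  have := size_intv m; rewrite -/n expnS => <-.
  by rewrite expnS; move: (3 ^ k)%N => q; lia.
by rewrite -(leq_add2r (N * n)); apply: leq_trans h2 _; rewrite -[leqRHS]addnA leq_add2l [leqRHS]addnC dim.
Qed.

End BallMatrix.

(** * Oscillation bounded by energy *)

Section Resistance.
Variable R : realType.
Implicit Types (f g : pt -> R).

Lemma sum_cover (T : eqType) (s u : seq T) (F : T -> R) :
  uniq s -> {subset s <= u} -> (forall x, x \in u -> 0 <= F x) ->
  \sum_(x <- s) F x <= \sum_(x <- u) F x.
Proof.
elim: s u => [|x s IH] u /=; first by move=> _ _ F0; rewrite big_nil big_seq sumr_ge0.
move=> /andP[xs us] su F0; have xu : x \in u by apply: su; rewrite inE eqxx.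
rewrite big_cons (perm_big _ (perm_to_rem xu)) big_cons lerD2l; apply: IH => //.
  move=> y ys; have := su y; rewrite inE ys orbT (perm_mem (perm_to_rem xu)) inE => /(_ isT).
  by case: eqP => // yx; rewrite yx (negbTE xs) in ys.
by move=> y /mem_rem; exact: F0.
Qed.

(* The sum of squares on the right is what remains of the energy after
   subtracting the harmonic extension of the corner values. *)
Lemma en_subdivide (a b c x y z : R) :
  en a x y + en x b z + en y z c = 3 / 5 * en a b c +
   (let u := x - (2 * a + 2 * b + c) / 5 in let v := y - (2 * a + b + 2 * c) / 5 in
    let w := z - (a + 2 * b + 2 * c) / 5 in
    2 * (u ^+ 2 + v ^+ 2 + w ^+ 2) + (u - v) ^+ 2 + (v - w) ^+ 2 + (w - u) ^+ 2).
Proof. by rewrite /en /=; field. Qed.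

(** Apply the bound on the three copies, then drop the squares in [en_subdivide]. Thus 3/5 is the
    renormalisation factor of the energy under one subdivision. *)
Lemma energy_trace m g :
  (3 / 5) ^+ m * en (g (0, 0)) (g (pw m, 0)) (g (0, pw m)) <= energy m g.
Proof.
elim: m g => [|m IH] g.
  rewrite expr0 mul1r /energy /= big_seq1 /trien pw0.
  by rewrite (_ : padd O (1, 0) = (1, 0)) // (_ : padd O (0, 1) = (0, 1)).
rewrite energyS.
have := IH (g \o padd ^~ (0, pw m)); have := IH (g \o padd ^~ (pw m, 0)); have := IH g.
rewrite /= /padd /= !add0r !addr0 -pwS.
set e1 := energy _ _; set e2 := energy _ _; set e3 := energy _ _ => h1 h2 h3.
apply: le_trans (lerD (lerD h1 h2) h3).
rewrite -!mulrDr exprSr -mulrA; apply: ler_wpM2l; first by rewrite exprn_ge0.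
rewrite [leRHS]en_subdivide lerDl /=.
do 3 (apply: addr_ge0; last exact: sqr_ge0); apply: mulr_ge0 => //.
by do 2 (apply: addr_ge0; last exact: sqr_ge0); exact: sqr_ge0.
Qed.

Lemma corner_diff m g v w : v \in corners m -> w \in corners m ->
  (g v - g w) ^+ 2 <= (5 / 3) ^+ m * energy m g.
Proof.
move=> vm wm; have h := energy_trace m g.
have h' : en (g (0, 0)) (g (pw m, 0)) (g (0, pw m)) <= (5 / 3) ^+ m * energy m g.
  rewrite -ler_pdivrMl ?exprn_gt0 // -exprVn (_ : (5 / 3)^-1 = 3 / 5 :> R) //.
  by rewrite invf_div.
apply: le_trans h'; have := sqr_ge0 (g (0, 0) - g (pw m, 0)).
have := sqr_ge0 (g (pw m, 0) - g (0, pw m)); have := sqr_ge0 (g (0, pw m) - g (0, 0)).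
move: vm wm; rewrite /en !inE => /or3P[]/eqP-> /or3P[]/eqP->; lra.
Qed.

(** Chaining: inside the subtriangle containing v the induction reaches a corner shared with the
    whole triangle, and [corner_diff] leads from there to w. The geometric growth (5/3)^m keeps the
    constant bounded. *)
Lemma resistance m g v w : v \in verts m -> w \in corners m ->
  (g v - g w) ^+ 2 <= 20 * (5 / 3) ^+ m * energy m g.
Proof.
elim: m g v w => [|m IH] g v w vm wm.
  have vc : v \in corners 0.
    case/vertsP: vm => t t0 /mem_triE; move: t0; rewrite inE => /eqP ->.
    by rewrite mem_corners pw0 => -[|[]] [-> ->].
  apply: le_trans (corner_diff g vc wm) _; rewrite !expr0 !mul1r mulr1.
  by have := energy_ge0 0 g; lra.
(* [tau] is the lower corner of a subtriangle containing [v]; its corner [tau + tau]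
   is a corner of the whole triangle. *)
have [tau [v' [v'm vE tc ttc Eg]]] : exists (tau v' : pt), [/\ v' \in verts m, v = padd v' tau,
    tau \in corners m, padd tau tau \in corners m.+1 & energy m (g \o padd ^~ tau) <= energy m.+1 g].
  case/vertsP: vm => t; rewrite mem_cellsS energyS => /or3P[] tm vt.
  - exists (0, 0), v; split; rewrite ?inE ?eqxx //.
    + by apply/vertsP; exists t.
    + by apply: ptP => /=; rewrite addr0.
    + rewrite (eq_energy (g := g)) => [|u _]; last by congr g; apply: ptP => /=; rewrite addr0.
      by rewrite -addrA lerDl addr_ge0 // energy_ge0.
  - exists (pw m, 0), (psub v (pw m, 0)); split; rewrite ?psubK ?mem_corners //= ?pwS ?eqxx ?orbT ?addr0 //.
    + by apply/vertsP; exists (psub t (pw m, 0)); rewrite // -mem_tri_padd psubK.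
    + by rewrite addrAC lerDr addr_ge0 // energy_ge0.
  - exists (0, pw m), (psub v (0, pw m)); split; rewrite ?psubK ?mem_corners //= ?pwS ?eqxx ?orbT ?addr0 //.
    + by apply/vertsP; exists (psub t (0, pw m)); rewrite // -mem_tri_padd psubK.
    + by rewrite lerDr addr_ge0 // energy_ge0.
have h1 := IH (g \o padd ^~ tau) v' tau v'm tc; rewrite /= -vE in h1.
have h2 := corner_diff g ttc wm.
pose X := (5 / 3) ^+ m * energy m.+1 g.
have {}h1 : (g v - g (padd tau tau)) ^+ 2 <= 20 * X.
  apply: le_trans h1 _; rewrite -mulrA ler_wpM2l // ler_wpM2l // exprn_ge0 //; lra.
have {}h2 : (g (padd tau tau) - g w) ^+ 2 <= 5 / 3 * X by rewrite /X mulrA -exprS.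
rewrite [in leRHS]exprS (_ : 20 * _ * _ = 100 / 3 * X); last by rewrite /X; field.
move: h1 h2; move: (g v) (g (padd tau tau)) (g w) => a b c h1 h2.
(* Young's inequality in the form (a - c)^2 <= 4/3 (a - b)^2 + 4 (b - c)^2. The constant 20 solves
   4/3 K + 4 * 5/3 = 5/3 K. *)
have := sqr_ge0 ((a - b) / 3 - (b - c)); nra.
Qed.

Lemma size_verts_le m : (size (verts m) <= 3 ^ m.+1)%N.
Proof. rewrite size_verts; have := size_intv m; lia. Qed.

Lemma le_size_verts m : (3 ^ m <= size (verts m))%N.
Proof. rewrite size_verts; have := size_intv m; rewrite expnS; lia. Qed.

Lemma le_size_intv m : (0 < m)%N -> (3 ^ m <= size (intv m))%N.
Proof.
case: m => // m _; have := size_intv m.+1; rewrite expnS.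
have : (0 < 3 ^ m)%N by rewrite expn_gt0.
by rewrite !expnS; move: (3 ^ m)%N => q; lia.
Qed.

(** All values are compared with a = g(0,0), at squared distance at most D. Averaging over G gives
    3^m a^2 <= 2/(t theta) P + 2 * 3^m D, and the at most 3 * 3^m vertices contribute 2 a^2 + 2 D
    each; hence 12 = 6 * 2 and, since 3^m D = 20 * 5^m E, 360 = 18 * 20. *)
Lemma good_cell m g (V : pt -> R) (G : seq pt) (t theta : R) : (0 < m)%N ->
  0 < t -> 0 < theta ->
  (forall s, s \in intv m -> 0 <= V s) ->
  uniq G -> {subset G <= intv m} -> (forall s, s \in G -> t <= V s) ->
  theta * (size (intv m))%:R <= (size G)%:R ->
  \sum_(s <- verts m) g s ^+ 2 <=
    (12 / (t * theta) + 360) * 5 ^+ m * (energy m g + \sum_(s <- intv m) V s * g s ^+ 2).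
Proof.
move=> m0 t0 th0 V0 uG GI GV Gsz.
set E := energy m g; set P := \sum_(s <- intv m) _.
have E0 : 0 <= E := energy_ge0 m g.
have P0 : 0 <= P by rewrite /P big_seq; apply: sumr_ge0 => s sm; rewrite mulr_ge0 ?sqr_ge0 ?V0.
pose a := g (0, 0); pose D := 20 * (5 / 3) ^+ m * E.
have D0 : 0 <= D by rewrite mulr_ge0 // mulr_ge0 // exprn_ge0 //; lra.
have gD s : s \in verts m -> (g s - a) ^+ 2 <= D.
  by move=> sm; apply: resistance => //; rewrite inE eqxx.
pose k : R := (size G)%:R; pose q : R := 3 ^+ m.
have q0 : 0 < q by rewrite exprn_gt0.
have kq : theta * q <= k.
  apply: le_trans Gsz; rewrite ler_pM2l // /q -natrX ler_nat; exact: le_size_intv.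
have sumc (T : Type) (s : seq T) (c : R) : \sum_(x <- s) c = (size s)%:R * c.
  by rewrite big_const_seq count_predT iter_addr addr0 mulr_natl.
have h1 : k * a ^+ 2 <= 2 / t * P + 2 * k * D.
  have : k * a ^+ 2 <= \sum_(s <- G) (2 / t * (V s * g s ^+ 2) + 2 * D).
    rewrite /k -sumc big_seq [leRHS]big_seq; apply: ler_sum => s sG.
    have h : (g s - a) ^+ 2 <= D by apply: gD; apply: intv_verts; exact: GI.
    have h' : g s ^+ 2 <= V s / t * g s ^+ 2.
      by rewrite ler_peMl ?sqr_ge0 // ler_pdivlMr // mul1r GV.
    rewrite (_ : 2 / t * _ = 2 * (V s / t * g s ^+ 2)); last by field; rewrite gt_eqF.
    by have := sqr_ge0 (2 * g s - a); nra.
  rewrite big_split /= -mulr_sumr sumc -/k.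
  move=> h0.
  have SP : 2 / t * (\sum_(s <- G) V s * g s ^+ 2) <= 2 / t * P.
    apply: ler_wpM2l; first by rewrite divr_ge0 // ltW.
    by apply: sum_cover => //; rewrite ?uniq_intv // => s sm; rewrite mulr_ge0 ?sqr_ge0 ?V0.
  by apply: le_trans h0 _; rewrite (_ : 2 * k * D = k * (2 * D)) ?lerD2r //; ring.
have h2 : \sum_(s <- verts m) g s ^+ 2 <= 3 * q * (2 * a ^+ 2 + 2 * D).
  apply: (@le_trans _ _ ((size (verts m))%:R * (2 * a ^+ 2 + 2 * D))).
    rewrite -sumc big_seq [leRHS]big_seq; apply: ler_sum => s sm.
    by have := gD s sm; have := sqr_ge0 (g s - 2 * a); nra.
  apply: ler_wpM2r; first by rewrite addr_ge0 // mulr_ge0 // sqr_ge0.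
  by rewrite /q -exprS -natrX ler_nat size_verts_le.
have k0 : 0 < k by apply: lt_le_trans kq; rewrite mulr_gt0.
have h3 : q * a ^+ 2 <= 2 / (t * theta) * P + 2 * q * D.
  have h : k * (q * a ^+ 2) <= k * (2 / (t * theta) * P + 2 * q * D).
    apply: (@le_trans _ _ (q * (2 / t * P + 2 * k * D))).
      by rewrite mulrCA ler_pM2l.
    have : theta * q * (2 / (t * theta) * P) <= k * (2 / (t * theta) * P).
      by apply: ler_wpM2r kq; rewrite mulr_ge0 // divr_ge0 // mulr_ge0 ?ltW.
    rewrite (_ : theta * q * (2 / (t * theta) * P) = q * (2 / t * P)); first by lra.
    by field; rewrite !gt_eqF.
  by rewrite ler_pM2l in h.
have qD : q * D = 20 * 5 ^+ m * E.
  have e : 3 ^+ m * (5 / 3) ^+ m = 5 ^+ m :> R by rewrite -exprMn; congr (_ ^+ _); field.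
  by rewrite /q /D -e; ring.
have p5 : 1 <= 5 ^+ m :> R by rewrite exprn_ege1 // ler1n.
have c0 : 0 <= 12 / (t * theta) by rewrite divr_ge0 // mulr_ge0 ?ltW.
move: h2 h3 qD c0 p5; have -> : 12 / (t * theta) = 6 * (2 / (t * theta)) by ring.
move: (2 / (t * theta)) (5 ^+ m) => r p h2 h3 qD c0 p5.
have pP : 6 * r * P <= 6 * r * P * p by rewrite ler_peMr // mulr_ge0.
have p0 : 0 <= p by lra.
have r0 : 0 <= r by lra.
have pE : 0 <= 6 * r * p * E by rewrite !mulr_ge0 ?ler0n.
have pP' : 0 <= 360 * p * P by rewrite !mulr_ge0 ?ler0n.
by apply: le_trans h2 _; lra.
Qed.

End Resistance.

(** * Low eigenvalues are confined to bad triangles *)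

Section BadCells.
Variable R : realType.

Definition good_cells m (t theta : R) (v : 'I_(size (intv m)) -> R) : bool :=
  theta * (size (intv m))%:R <= #|[set i | t <= v i]%SET|%:R.

Lemma sum_ipt m (F : pt -> R) : \sum_(s <- intv m) F s = \sum_(i < size (intv m)) F (ipt i).
Proof. by rewrite (big_nth O) big_mkord. Qed.

Lemma sum_xpt L (F : pt -> R) : \sum_(p <- ballpts L) F p = \sum_(i < #|BallL L|) F (xpt i).
Proof.
transitivity (\sum_(p <- [seq @xpt L i | i <- enum 'I_#|BallL L|]) F p); last by rewrite big_map big_enum.
apply/perm_big; rewrite perm_sym; apply: uniq_perm; first by rewrite map_inj_uniq ?enum_uniq //; exact: xpt_inj.
  exact: uniq_ballpts.
move=> x; apply/mapP/idP => [[i _ ->]|/xpt_surj[i <-]]; first exact: xpt_mem.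
by exists i; rewrite ?mem_enum.
Qed.

Lemma good_cell_bound m g (V : pt -> R) c (t theta : R) : (0 < m)%N -> 0 < t -> 0 < theta ->
  (forall i, 0 <= cellpot (m := m) V c i) ->
  good_cells t theta (cellpot (m := m) V c) ->
  \sum_(s <- verts m) g (place m c s) ^+ 2 <=
    (12 / (t * theta) + 360) * 5 ^+ m *
    (energy m (g \o place m c) + \sum_(s <- intv m) V (place m c s) * g (place m c s) ^+ 2).
Proof.
move=> m0 t0 th0 V0 gd.
pose S := [set i | t <= cellpot (m := m) V c i]%SET.
have imP s : s \in intv m -> exists i : 'I_(size (intv m)), s = ipt i.
  by move=> /(nthP O)[i im <-]; exists (Ordinal im).
apply: (@good_cell R m (g \o place m c) (V \o place m c) [seq ipt i | i <- enum S] t theta) => //.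
- by move=> s /imP[i ->]; exact: V0.
- by rewrite map_inj_uniq ?enum_uniq //; exact: ipt_inj.
- by move=> s /mapP[i _ ->]; exact: ipt_mem.
- by move=> s /mapP[i + ->]; rewrite mem_enum inE.
- by rewrite size_map -cardE.
Qed.

(** On the vectors vanishing at every vertex of every bad triangle the form exceeds E; their
    codimension is at most 3^(m+1) per bad triangle. *)
Lemma ncount_bad k m (E t theta : R) (V : pt -> R) : (0 < m)%N -> 0 < t -> 0 < theta ->
  (forall x, x \in ballpts (k + m) -> 0 <= V x) ->
  E * ((12 / (t * theta) + 360) * 5 ^+ m) < 1 ->
  (ncount E (HB (k + m) V) <=
    count (fun c => ~~ good_cells t theta (cellpot (m := m) V c)) (cells2 k) * 3 ^ m.+1)%N.
Proof.
move=> m0 t0 th0 V0; set C := (_ + _) * _ => EC.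
have C0 : 0 < C.
  by rewrite mulr_gt0 ?addr_gt0 ?divr_gt0 ?mulr_gt0 ?exprn_gt0 ?ltr0n.
pose L := (k + m)%N; pose bad c := ~~ good_cells t theta (cellpot (m := m) V c).
pose badpts := [seq place m c s | c <- [seq c <- cells2 k | bad c], s <- verts m].
pose G := [set i : 'I_#|BallL L| | xpt i \notin badpts]%SET.
have cG : (#|~: G| <= count bad (cells2 k) * 3 ^ m.+1)%N.
  apply: (@leq_trans (size badpts)).
    rewrite cardE -(size_map (@xpt L)); apply: uniq_leq_size.
      by rewrite map_inj_uniq ?enum_uniq //; exact: xpt_inj.
    by move=> x /mapP[i + ->]; rewrite mem_enum !inE negbK.
  by rewrite size_allpairs size_filter leq_mul2l size_verts_le orbT.
suff : (ncount E (HB L V) + #|G| <= #|BallL L|)%N.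
  rewrite -[in leqRHS](card_ord #|BallL L|) -(cardsC G) addnC leq_add2l => h.
  exact: leq_trans h cG.
pose W : 'M[R]_(#|G|, #|BallL L|) := rowsub (@enum_val _ (mem G)) 1%:M.
have WW : W *m W^T = 1%:M by apply: orthonormal_rows; [exact: enum_val_inj | rewrite trmx1 mulmx1].
apply: (@ncount_le R _ _ E (HB L V) W); first exact: HB_sym.
  by apply/row_freeP; exists W^T.
move=> v v0; set w := v *m W.
have wn : 0 < nsq w by rewrite /w nsq_orth // nsq_gt0.
have wG i : i \notin G -> w 0 i = 0.
  move=> iG; rewrite /w mxE big1 // => j _; rewrite !mxE.
  case: eqP => [ji|_]; last by rewrite mulr0.
  by move: iG; rewrite -ji (enum_valP j).
pose f := ext (@xpt L) w.
have fx i : f (xpt i) = w 0 i by apply: ext_inj; exact: xpt_inj.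
suff h : nsq w <= C * qform (HB L V) w.
  rewrite -(ltr_pM2l C0); apply: lt_le_trans h.
  by rewrite mulrA (mulrC C) gtr_pMl.
rewrite qform_HB -/f.
(* Three losses in the favourable direction: cells beyond the ball add energy, corner sites add
   potential, and corners common to two triangles are counted twice in [E3]. *)
have E1 : \sum_(c <- cells2 k) energy m (f \o place m c) <= \sum_(c <- cells2 L.+1) cell_energy f c.
  rewrite -sum_cell_energy; apply: sum_cover; first exact: uniq_cells2.
    exact: cells2_mono.
  by move=> c _; exact: cell_energy_ge0.
have E2 : \sum_(c <- cells2 k) \sum_(s <- intv m) V (place m c s) * f (place m c s) ^+ 2 <=
    \sum_i V (xpt i) * w 0 i ^+ 2.
  rewrite [leLHS](_ : _ = \sum_(x <- [seq place m c s | c <- cells2 k, s <- intv m]) V x * f x ^+ 2); last first.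
    by rewrite [RHS]big_allpairs_dep.
  rewrite [leRHS](eq_bigr (fun i => V (xpt i) * f (xpt i) ^+ 2)) => [|i _]; last by rewrite fx.
  rewrite -(@sum_xpt L (fun x => V x * f x ^+ 2)); apply: sum_cover.
  - apply: allpairs_uniq; rewrite ?uniq_cells2 ?uniq_intv // => -[c s] [c' s'].
    move=> /allpairsP[[c1 s1] /= [c1k s1m [-> ->]]] /allpairsP[[c2 s2] /= [c2k s2m [-> ->]]] e.
    by have [-> ->] := place_inj c1k c2k s1m (intv_verts s2m) e.
  - by move=> x /allpairsP[[c s] /= [ck sm ->]]; apply: place_verts => //; exact: intv_verts.
  - by move=> x xL; rewrite mulr_ge0 ?sqr_ge0 ?V0.
have E3 : nsq w <= \sum_(c <- cells2 k) \sum_(s <- verts m) f (place m c s) ^+ 2.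
  rewrite nsqE; under eq_bigr do rewrite -fx.
  rewrite -(@sum_xpt L (fun x => f x ^+ 2)).
  rewrite [leRHS](_ : _ = \sum_(x <- [seq place m c s | c <- cells2 k, s <- verts m]) f x ^+ 2); last first.
    by rewrite [RHS]big_allpairs_dep.
  apply: sum_cover => [||x _]; [exact: uniq_ballpts | | exact: sqr_ge0].
  by move=> x /ballpts_place[c [s [ck sm ->]]]; apply/allpairsP; exists (c, s).
apply: le_trans E3 _; apply: le_trans _ (ler_wpM2l (ltW C0) (lerD E1 E2)).
rewrite -big_split mulr_sumr big_seq [leRHS]big_seq; apply: ler_sum => c ck.
have [gc|bc] := boolP (good_cells t theta (cellpot (m := m) V c)).
  apply: good_cell_bound => // i; apply: V0; apply: place_verts => //; exact: intv_verts (ipt_mem i).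
rewrite big1_seq => [|s /andP[_ sm]].
  rewrite mulr_ge0 ?(ltW C0) // addr_ge0 ?energy_ge0 // big_seq sumr_ge0 // => s sm.
  by rewrite mulr_ge0 ?sqr_ge0 // V0 // place_verts // intv_verts.
have [i ix] := xpt_surj (place_verts ck sm).
rewrite -ix fx wG ?expr0n // inE negbK ix; apply/allpairsP; exists (c, s) => //.
by rewrite mem_filter ck /= /bad bc.
Qed.

End BadCells.

(** * Harmonic functions and the tent *)

Section TestFunction.
Variable R : realType.
Implicit Types (f g : pt -> R).

Definition glue m f1 f2 f3 (p : pt) : R :=
  if p.1 + p.2 <= pw m then f1 p
  else if pw m <= p.1 then f2 (psub p (pw m, 0)) else f3 (psub p (0, pw m)).

Lemma glue_energy m f1 f2 f3 :
  f1 (pw m, 0) = f2 (0, 0) -> f1 (0, pw m) = f3 (0, 0) -> f2 (0, pw m) = f3 (pw m, 0) ->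
  energy m.+1 (glue m f1 f2 f3) = energy m f1 + energy m f2 + energy m f3.
Proof.
move=> e12 e13 e23; rewrite energyS; have q0 := pw_gt0 m; congr (_ + _ + _);
  apply: eq_energy => -[a b] /verts_bound[];
  rewrite /glue /psub /padd /= => a0 [b0 ab].
- by rewrite ab.
- case: ifP => h; last by rewrite (_ : pw m <= a + pw m) ?addr0 ?addrK ?subr0 //; lia.
  have -> : a = 0 by lia.
  have -> : b = 0 by lia.
  by rewrite !add0r e12.
- case: ifP => h.
    have -> : a = 0 by lia.
    have -> : b = 0 by lia.
    by rewrite !add0r e13.
  case: ifP => h'; last by rewrite addr0 subr0 addrK.
  rewrite [X in f2 X](_ : _ = (0, pw m)); last by apply: ptP => /=; lia.
  by rewrite [X in f3 X](_ : _ = (pw m, 0)) ?e23 //; apply: ptP => /=; lia.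
Qed.

(** Harmonic extension of corner values: the weights 2/5, 2/5, 1/5 at the midpoints make all the
    squares in [en_subdivide] vanish, so the factor 3/5 is attained. *)
Fixpoint harm m (a b c : R) : pt -> R :=
  if m is m'.+1 then
    let x := (2 * a + 2 * b + c) / 5 in let y := (2 * a + b + 2 * c) / 5 in
    let z := (a + 2 * b + 2 * c) / 5 in
    glue m' (harm m' a x y) (harm m' x b z) (harm m' y z c)
  else fun p => if p == (0, 0) then a else if p == (1, 0) then b else c.

Lemma harm_corner m a b c : [/\ harm m a b c (0, 0) = a, harm m a b c (pw m, 0) = b &
  harm m a b c (0, pw m) = c].
Proof.
elim: m a b c => [|m IH] a b c; first by rewrite pw0.
have q0 := pw_gt0 m; rewrite /= /glue /psub /= pwS; split.
- by have [] := IH a ((2 * a + 2 * b + c) / 5) ((2 * a + b + 2 * c) / 5).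
- rewrite ifF ?ifT; [|lia|lia].
  rewrite [X in harm _ _ _ _ X](_ : _ = (pw m, 0)); last by apply: ptP => /=; lia.
  by have [] := IH ((2 * a + 2 * b + c) / 5) b ((a + 2 * b + 2 * c) / 5).
- rewrite ifF ?ifF; [|lia|lia].
  rewrite [X in harm _ _ _ _ X](_ : _ = (0, pw m)); last by apply: ptP => /=; lia.
  by have [] := IH ((2 * a + b + 2 * c) / 5) ((a + 2 * b + 2 * c) / 5) c.
Qed.

Lemma harm0 m a b c : harm m a b c (0, 0) = a. Proof. by have [] := harm_corner m a b c. Qed.
Lemma harm1 m a b c : harm m a b c (pw m, 0) = b. Proof. by have [] := harm_corner m a b c. Qed.
Lemma harm2 m a b c : harm m a b c (0, pw m) = c. Proof. by have [] := harm_corner m a b c. Qed.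

Lemma harm_energy m a b c : energy m (harm m a b c) = (3 / 5) ^+ m * en a b c.
Proof.
elim: m a b c => [|m IH] a b c.
  by rewrite /energy big_seq1 expr0 mul1r.
rewrite /= glue_energy ?IH; first by rewrite exprSr /en; field.
all: by rewrite ?harm0 ?harm1 ?harm2.
Qed.

Lemma harm_ge m a b c mu p : mu <= a -> mu <= b -> mu <= c -> mu <= harm m a b c p.
Proof.
elim: m a b c p => [|m IH] a b c p ha hb hc /=; first by case: ifP => // _; case: ifP.
rewrite /glue; case: ifP => _; first by apply: IH => //; lra.
by case: ifP => _; apply: IH => //; lra.
Qed.

(** Value 0 at the outer corners of T_(m+1), 1 at the three junctions, harmonic on each copy of T_m;
    every copy has corner energy 2, hence 6 in [tent_energy]. *)
Definition tent m : pt -> R := glue m (harm m 0 1 1) (harm m 1 0 1) (harm m 1 1 0).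

Lemma tent_energy m : energy m.+1 (tent m) = 6 * (3 / 5) ^+ m.
Proof.
rewrite /tent glue_energy ?harm_energy ?harm0 ?harm1 ?harm2 //.
by rewrite /en; ring.
Qed.

Lemma tent_corner m p : p \in corners m.+1 -> tent m p = 0.
Proof.
have q0 := pw_gt0 m; rewrite /tent !inE /glue /psub pwS => /or3P[] /eqP -> /=.
- by rewrite ?(ltW q0) harm0.
- rewrite ifF ?ifT; [|lia|lia].
  by rewrite [X in harm _ _ _ _ X](_ : _ = (pw m, 0)) ?harm1 //; apply: ptP => /=; lia.
- rewrite ifF ?ifF; [|lia|lia].
  by rewrite [X in harm _ _ _ _ X](_ : _ = (0, pw m)) ?harm2 //; apply: ptP => /=; lia.
Qed.

(** This copy of T_m is the middle piece of [harm m.+1 0 1 1], with corner values 3/5, 1 and 4/5;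
    harmonic functions stay above their least corner value. *)
Lemma tent_ge m p : p \in verts m -> 3 / 5 <= tent m.+1 (padd p (pw m, 0)).
Proof.
move=> /verts_bound; case: p => a b /= [a0 [b0 ab]]; have q0 := pw_gt0 m.
rewrite /tent /= {1}/glue pwS ifT /=; last by lia.
rewrite /glue /=; case: ifP => h; first last.
  by rewrite ifT; [apply: harm_ge; lra | lia].
have -> : a = 0 by lia.
have -> : b = 0 by lia.
rewrite [X in harm _ _ _ _ X](_ : _ = (pw m, 0)) ?harm1 //; first lra.
Qed.

(** The energy is 6 (3/5)^(m+1), and at least 3^m sites carry values of at least 3/5, so the squared
    norm is at least 9/25 * 3^m; the quotient is 10 / 5^m. *)
Lemma test_function m : exists w : 'rV[R]_(size (intv m.+2)),
  0 < nsq w /\ energy m.+2 (ext (@ipt m.+2) w) <= 10 / 5 ^+ m * nsq w.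
Proof.
pose phi := tent m.+1; pose w : 'rV[R]_(size (intv m.+2)) := \row_i phi (ipt i).
have wE : nsq w = \sum_(s <- verts m.+2) phi s ^+ 2.
  rewrite nsqE (bigID (mem (corners m.+2))) /= [X in _ = X + _]big1 ?add0r => [|s sc].
    rewrite -[RHS]big_filter -/(intv m.+2); apply: etrans (esym (@sum_ipt R m.+2 (fun s => phi s ^+ 2))).
    by apply: eq_bigr => i _; rewrite mxE.
  by rewrite /phi tent_corner ?expr0n.
have wge : 9 / 25 * 3 ^+ m <= nsq w.
  rewrite wE; apply: (@le_trans _ _ (\sum_(s <- map (padd ^~ (pw m, 0)) (verts m)) phi s ^+ 2)).
    rewrite big_map; apply: (@le_trans _ _ (\sum_(s <- verts m) 9 / 25)).
      rewrite big_const_seq count_predT iter_addr addr0 -[leRHS]mulr_natr ler_wpM2l //.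
      by rewrite -natrX ler_nat le_size_verts.
    rewrite big_seq [leRHS]big_seq; apply: ler_sum => s /tent_ge h.
    by rewrite /phi; move: h; move: (tent _ _) => x h; nra.
  apply: sum_cover => [||x _]; last exact: sqr_ge0.
    by rewrite map_inj_uniq ?undup_uniq //; exact: can_inj (paddK _).
  move=> x; rewrite mem_map_padd => /vertsP[t tm xt].
  apply/vertsP; exists (padd t (pw m, 0)); last by rewrite mem_tri_padd.
  by rewrite !mem_cellsS paddK tm !orbT.
have w0 : 0 < nsq w by apply: lt_le_trans wge; rewrite mulr_gt0 ?exprn_gt0.
exists w; split=> //.
rewrite (eq_energy (g := phi)) => [|s sm].
  rewrite tent_energy; apply: (@le_trans _ _ (10 / 5 ^+ m * (9 / 25 * 3 ^+ m))).
    rewrite exprS expr_div_n le_eqVlt; apply/orP; left; apply/eqP; field.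
    by rewrite gt_eqF ?exprn_gt0.
  by apply: ler_wpM2l wge; rewrite divr_ge0 // exprn_ge0.
have [sc|sc] := boolP (s \in corners m.+2).
  rewrite /phi tent_corner //; apply: ext_out => i; apply/eqP => e.
  by have := ipt_mem i; rewrite e mem_filter sc.
have si : s \in intv m.+2 by rewrite mem_filter sc.
have /(nthP O)[i im <-] := si.
by rewrite -[nth O _ i]/(ipt (Ordinal im)) ext_inj ?mxE //; exact: ipt_inj.
Qed.

Lemma ncount_block_gt0 m (E : R) (v : 'I_(size (intv m.+2)) -> R) :
  10 / 5 ^+ m <= E / 2 -> (forall i, v i <= E / 2) -> (0 < ncount E (blockH v))%N.
Proof.
move=> mE vE; have [w [w0 wE]] := test_function m.
apply: (@ncount_ge R _ 1 E (blockH v) w); first exact: blockH_sym.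
  rewrite /row_free rank_rV; suff -> : w != 0 by [].
  by apply: contraTneq w0 => ->; rewrite /nsq mul0mx mxE ltxx.
move=> u; have -> : u *m w = u 0 0 *: w.
  by rewrite [u]mx11_scalar mul_scalar_mx mxE eqxx.
have -> : qform (blockH v) (u 0 0 *: w) = u 0 0 ^+ 2 * qform (blockH v) w.
  by rewrite /qform linearZ /= -!scalemxAl -scalemxAr !mxE; ring.
have -> : nsq (u 0 0 *: w) = u 0 0 ^+ 2 * nsq w.
  by rewrite /nsq linearZ /= -!scalemxAl -scalemxAr !mxE; ring.
rewrite mulrCA ler_wpM2l ?sqr_ge0 // qform_blockH.
have -> : E * nsq w = E / 2 * nsq w + E / 2 * nsq w by field.
apply: lerD.
  by apply: le_trans wE _; exact: ler_wpM2r (ltW w0) _ _ mE.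
by rewrite nsqE mulr_sumr; apply: ler_sum => i _; rewrite ler_wpM2r ?sqr_ge0.
Qed.

End TestFunction.

(** * Random potentials *)

Section Mean.
Context (R : realType) (d : measure_display) (T : measurableType d) (P : probability T R).
Implicit Types X Y : T -> R.

Definition bounded_rv X : Prop := measurable_fun setT X /\ exists B : R, forall w, `|X w| <= B.
Definition mean X : R := \int[P]_w X w.

Lemma bounded_rv_integrable X : bounded_rv X -> P.-integrable setT (EFin \o X).
Proof.
move=> [mX [B XB]]; apply: measurable_bounded_integrable => //.
  by apply: le_lt_trans (probability_le1 P measurableT) _; rewrite ltry.
by exists B; split=> [|M BM]; [exact: num_real | move=> w _; exact: le_trans (XB w) (ltW BM)].
Qed.

Lemma meanE X : bounded_rv X -> ('E_P[X] = (mean X)%:E)%E.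
Proof.
move=> bX; rewrite expectation.unlock /mean /Rintegral fineK //.
by apply: integrable_fin_num => //; exact: bounded_rv_integrable.
Qed.

Lemma bounded_rv_cst r : bounded_rv (fun=> r).
Proof. by split; [exact: measurable_cst | exists `|r|]. Qed.

Lemma bounded_rvD X Y : bounded_rv X -> bounded_rv Y -> bounded_rv (fun w => X w + Y w).
Proof.
move=> [mX [B XB]] [mY [C YC]]; split; first exact: measurable_funD.
by exists (B + C) => w; apply: le_trans (ler_normD _ _) (lerD _ _).
Qed.

Lemma bounded_rvM X Y : bounded_rv X -> bounded_rv Y -> bounded_rv (fun w => X w * Y w).
Proof.
move=> [mX [B XB]] [mY [C YC]]; split; first exact: measurable_funM.
by exists (B * C) => w; rewrite normrM ler_pM.
Qed.

Lemma bounded_rvZ r X : bounded_rv X -> bounded_rv (fun w => r * X w).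
Proof. by move=> bX; apply: bounded_rvM bX; exact: bounded_rv_cst. Qed.

Lemma bounded_rv_sum (I : Type) (s : seq I) (F : I -> T -> R) :
  (forall i, bounded_rv (F i)) -> bounded_rv (fun w => \sum_(i <- s) F i w).
Proof.
move=> bF; elim: s => [|i s IH].
  by rewrite (_ : (fun _ => _) = fun=> 0); [exact: bounded_rv_cst | apply/funext => w; rewrite big_nil].
rewrite (_ : (fun _ => _) = fun w => F i w + \sum_(i <- s) F i w); first exact: bounded_rvD.
by apply/funext => w; rewrite big_cons.
Qed.

Lemma bounded_rv_indic (A : set T) : measurable A -> bounded_rv \1_A.
Proof.
move=> mA; split; first exact: measurable_indic.
by exists 1 => w; rewrite ger0_norm ?indic_ge0 // indicE; case: (_ \in _); rewrite ?ler01.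
Qed.

Lemma mean_cst r : mean (fun=> r) = r.
Proof.
rewrite /mean Rintegral_cst //.
exact: (etrans (congr1 (fun z => r * fine z) (@probability_setT _ _ _ P)) (mulr1 r)).
Qed.

Lemma meanD X Y : bounded_rv X -> bounded_rv Y -> mean (fun w => X w + Y w) = mean X + mean Y.
Proof. by move=> bX bY; rewrite /mean RintegralD //; exact: bounded_rv_integrable. Qed.

Lemma meanZ r X : bounded_rv X -> mean (fun w => r * X w) = r * mean X.
Proof. by move=> bX; rewrite /mean RintegralZl //; exact: bounded_rv_integrable. Qed.

Lemma mean_sum (I : Type) (s : seq I) (F : I -> T -> R) :
  (forall i, bounded_rv (F i)) -> mean (fun w => \sum_(i <- s) F i w) = \sum_(i <- s) mean (F i).
Proof.
move=> bF; elim: s => [|i s IH].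
  by rewrite big_nil -[RHS]mean_cst; congr mean; apply/funext => w; rewrite big_nil.
rewrite big_cons -IH -meanD //; last exact: bounded_rv_sum.
by congr mean; apply/funext => w; rewrite big_cons.
Qed.

Lemma mean_le X Y : bounded_rv X -> bounded_rv Y -> (forall w, X w <= Y w) -> mean X <= mean Y.
Proof.
by move=> bX bY XY; rewrite /mean le_Rintegral //; exact: bounded_rv_integrable.
Qed.

(** Replace X by Z = min(X, Y), which lies below Y everywhere and equals X almost surely. *)
Lemma mean_le_ae X Y : bounded_rv X -> bounded_rv Y -> {ae P, forall w, X w <= Y w} -> mean X <= mean Y.
Proof.
move=> bX bY XY; rewrite -lee_fin -!meanE // expectation.unlock.
pose Z w := Num.min (X w) (Y w).
have bZ : bounded_rv Z.
  split; first by apply: measurable_minr; [exact: bX.1|exact: bY.1].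
  have [_ [B XB]] := bX; have [_ [C YC]] := bY.
  exists (Num.max B C) => w; rewrite /Z /Num.min; case: ifP => _.
    by rewrite le_max XB.
  by rewrite le_max YC orbT.
rewrite (_ : (\int[P]_w (X w)%:E)%E = (\int[P]_w (Z w)%:E)%E).
  apply: le_integral => //; [exact: bounded_rv_integrable|exact: bounded_rv_integrable|].
  by move=> w _; rewrite lee_fin /Z ge_min lexx orbT.
apply: ae_eq_integral => //; [by apply/measurable_EFinP; exact: bX.1|by apply/measurable_EFinP; exact: bZ.1|].
by apply: filterS XY => w XYw _; rewrite /Z min_l.
Qed.

Lemma mean_indic (A : set T) : measurable A -> mean \1_A = fine (P A).
Proof.
move=> mA; rewrite /mean /Rintegral integral_indic // setIT //.
Qed.

Lemma mean_cvg (Xn : nat -> T -> R) X (B : R) : (forall n, measurable_fun setT (Xn n)) ->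
  (forall n w, `|Xn n w| <= B) -> (forall w, (Xn ^~ w) @ \oo --> X w) ->
  bounded_rv X /\ (fun n => mean (Xn n)) @ \oo --> mean X.
Proof.
move=> mX XB cX.
have mX' : measurable_fun setT X by apply: (measurable_fun_cvg mX) => w _; exact: cX.
have bX : bounded_rv X.
  split=> //; exists B => w.
  have h : (fun n => `|Xn n w|) @ \oo --> `|X w| by apply: cvg_norm; exact: cX.
  rewrite -(cvg_lim _ h) //; apply: limr_le; first by apply/cvg_ex; exists `|X w|.
  by apply: nearW => n; exact: XB.
split=> //.
have [|||||_ _ h] := @dominated_convergence _ T R P setT measurableT
  (fun n w => (Xn n w)%:E) (fun w => (X w)%:E) (fun=> B%:E).
- by move=> n; apply/measurable_EFinP.
- by apply/measurable_EFinP.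
- by apply: aeW => w _; apply/fine_cvgP; split; [exact: nearW | exact: cX].
- exact: bounded_rv_integrable (bounded_rv_cst B).
- by apply: aeW => w n _; rewrite /= lee_fin XB.
rewrite /mean /Rintegral; apply: fine_cvg.
rewrite fineK //; by apply: integrable_fin_num => //; exact: bounded_rv_integrable.
Qed.

End Mean.

(** * Laws of functions of finitely many potentials *)

Section Independence.
Context (R : realType) (d : measure_display) (T : measurableType d) (P : probability T R).
Context (P0 : probability R R) (V : pt -> T -> R).
Hypothesis iid : iid_potential P V P0.

Lemma iid_meas x : vertex x -> measurable_fun setT (V x).
Proof. by case: iid => h _; exact: h. Qed.

Lemma iid_preimage x (B : set R) : vertex x -> measurable B -> measurable (V x @^-1` B).
Proof. by move=> vx mB; rewrite -[X in measurable X]setTI; exact: iid_meas. Qed.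

Lemma iid_prob (I : finType) (x : I -> pt) (B : I -> set R) :
  injective x -> (forall i, vertex (x i)) -> (forall i, measurable (B i)) ->
  P (\big[setI/setT]_i (V (x i) @^-1` B i)) = (\prod_i fine (P0 (B i)))%:E.
Proof.
move=> xi vx mB; have [_ [law ind]] := iid.
(* The hypothesis wants a set for each point rather than for each index; injectivity of [x] makes
   the choice unambiguous, and points off its range get [setT]. *)
pose A p := if [pick i | x i == p] is Some i then B i else setT.
have Ax i : A (x i) = B i.
  rewrite /A; case: pickP => [j /eqP /xi -> //|/(_ i)]; by rewrite eqxx.
have mA p : measurable (A p) by rewrite /A; case: pickP => [j _|_ //]; exact: mB.
have := ind [seq x i | i <- index_enum I] _ _ A mA.
rewrite !big_map; under eq_bigr do rewrite Ax.
move=> -> //; first last.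
- by move=> p /mapP[i _ ->].
- by rewrite map_inj_uniq ?index_enum_uniq.
rewrite (big_morph EFin (id1 := 1%E) (op1 := *%E)) //; apply: eq_bigr => i _.
by rewrite Ax law // fineK // fin_num_measure.
Qed.

Section Observation.
Variables (J : finType) (D : R -> J).
Hypothesis mD : forall j, measurable (D @^-1` [set j]).

(** A finite-valued record of the potential at the points [x]. A function of it is a finite
    combination of indicators, so its mean and its independence reduce to [iid_prob]. *)
Definition obs (I : finType) (x : I -> pt) (w : T) : {ffun I -> J} := [ffun i => D (V (x i) w)].
Definition obs_prob (j : J) : R := fine (P0 (D @^-1` [set j])).

Lemma obs_event (I : finType) (x : I -> pt) (u : {ffun I -> J}) :
  [set w | obs x w = u] = \big[setI/setT]_i (V (x i) @^-1` (D @^-1` [set u i])).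
Proof.
rewrite -bigcap_seq; apply/seteqP; split=> w /=.
  by move=> <- i _ /=; rewrite ffunE.
by move=> h; apply/ffunP => i; rewrite ffunE; apply: h => /=; rewrite mem_index_enum.
Qed.

Lemma obs_meas (I : finType) (x : I -> pt) u : (forall i, vertex (x i)) ->
  measurable [set w | obs x w = u].
Proof. by move=> vx; rewrite obs_event; apply: bigsetI_measurable => i _; exact: iid_preimage. Qed.

Lemma obs_law (I : finType) (x : I -> pt) u : injective x -> (forall i, vertex (x i)) ->
  P [set w | obs x w = u] = (\prod_i obs_prob (u i))%:E.
Proof. by move=> xi vx; rewrite obs_event iid_prob. Qed.

Lemma obs_expand (I : finType) (x : I -> pt) (F : {ffun I -> J} -> R) w :
  F (obs x w) = \sum_u F u * \1_[set w | obs x w = u] w.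
Proof.
rewrite (bigD1 (obs x w)) //= indicE mem_set // mulr1 big1 ?addr0 // => u ux.
by rewrite indicE memNset ?mulr0 //= => e; rewrite e eqxx in ux.
Qed.

Lemma obs_bounded_rv (I : finType) (x : I -> pt) (F : {ffun I -> J} -> R) :
  (forall i, vertex (x i)) -> bounded_rv (fun w => F (obs x w)).
Proof.
move=> vx; rewrite (_ : (fun w => _) = fun w => \sum_u F u * \1_[set w | obs x w = u] w).
  by apply: bounded_rv_sum => u; apply: bounded_rvZ; apply: bounded_rv_indic; exact: obs_meas.
by apply/funext => w; rewrite obs_expand.
Qed.

Lemma mean_obs (I : finType) (x : I -> pt) (F : {ffun I -> J} -> R) :
  injective x -> (forall i, vertex (x i)) ->
  mean P (fun w => F (obs x w)) = \sum_u F u * \prod_i obs_prob (u i).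
Proof.
move=> xi vx; have bi u : bounded_rv (\1_[set w | obs x w = u] : T -> R).
  by apply: bounded_rv_indic; exact: obs_meas.
transitivity (mean P (fun w => \sum_u F u * \1_[set w | obs x w = u] w)).
  by congr mean; apply/funext => w; rewrite obs_expand.
rewrite mean_sum => [|u]; last exact: bounded_rvZ.
by apply: eq_bigr => u _; rewrite meanZ // mean_indic ?obs_law //; exact: obs_meas.
Qed.

Lemma mean_obs_indep (I1 I2 : finType) (x1 : I1 -> pt) (x2 : I2 -> pt)
    (F1 : {ffun I1 -> J} -> R) (F2 : {ffun I2 -> J} -> R) :
  injective x1 -> injective x2 -> (forall i1 i2, x1 i1 <> x2 i2) ->
  (forall i, vertex (x1 i)) -> (forall i, vertex (x2 i)) ->
  mean P (fun w => F1 (obs x1 w) * F2 (obs x2 w)) =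
  mean P (fun w => F1 (obs x1 w)) * mean P (fun w => F2 (obs x2 w)).
Proof.
move=> i1 i2 i12 v1 v2; rewrite !mean_obs //.
pose A1 u := [set w | obs x1 w = u]; pose A2 u := [set w | obs x2 w = u].
have m12 u1 u2 : measurable (A1 u1 `&` A2 u2) by apply: measurableI; exact: obs_meas.
have PA u1 u2 : P (A1 u1 `&` A2 u2) = ((\prod_i obs_prob (u1 i)) * (\prod_i obs_prob (u2 i)))%:E.
  pose x (i : I1 + I2) := match i with inl i => x1 i | inr i => x2 i end.
  pose B (i : I1 + I2) := match i with inl i => D @^-1` [set u1 i] | inr i => D @^-1` [set u2 i] end.
  have := @iid_prob _ x B; rewrite !big_sumType /= => <-.
  - by rewrite /A1 /A2 !obs_event.
  - by move=> [a|a] [b|b] /=; [move/i1 -> | move/i12 | move/esym/i12 | move/i2 ->].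
  - by case.
  - by case=> i /=; exact: mD.
transitivity (mean P (fun w => \sum_u1 \sum_u2 (F1 u1 * F2 u2) * \1_(A1 u1 `&` A2 u2) w)).
  congr mean; apply/funext => w; rewrite (obs_expand x1) (obs_expand x2) big_distrlr /=.
  apply: eq_bigr => u1 _; apply: eq_bigr => u2 _; rewrite indicI /=; ring.
have b12 u1 u2 : bounded_rv (fun w => (F1 u1 * F2 u2) * \1_(A1 u1 `&` A2 u2) w).
  by apply: bounded_rvZ; exact: bounded_rv_indic.
rewrite mean_sum => [|u1]; last exact: bounded_rv_sum.
rewrite big_distrlr /=; apply: eq_bigr => u1 _.
rewrite mean_sum //; apply: eq_bigr => u2 _.
by rewrite meanZ ?mean_indic ?PA //=; [ring | exact: bounded_rv_indic].
Qed.

End Observation.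

Section Discretisation.

(** Unary code of the position of r on the grid of mesh 2^-n in [-n, n]: bit j tells whether r is at
    least -n + (j+1)/2^n, and for |r| <= n [val] returns the last grid point not exceeding r. *)
Let K n := (2 * n * 2 ^ n)%N.
Let D n (r : R) : {ffun 'I_(K n) -> bool} := [ffun j : 'I_(K n) => (j.+1)%:R <= (r + n%:R) * 2 ^+ n].
Let val n (u : {ffun 'I_(K n) -> bool}) : R := (\sum_j u j)%:R / 2 ^+ n - n%:R.

Let mD n u : measurable (@D n @^-1` [set u]).
Proof.
rewrite (_ : _ @^-1` _ = \big[setI/setT]_j
  (if u j then `[(j.+1)%:R / 2 ^+ n - n%:R, +oo[%classic else `]-oo, (j.+1)%:R / 2 ^+ n - n%:R[%classic)).
  by apply: bigsetI_measurable => j _; case: ifP.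
have E (r : R) (j : 'I_(K n)) : ((j.+1)%:R <= (r + n%:R) * 2 ^+ n) = ((j.+1)%:R / 2 ^+ n - n%:R <= r).
  by rewrite lerBlDr ler_pdivrMr // exprn_gt0.
rewrite -bigcap_seq; apply/seteqP; split=> r /=.
  by move=> <- j _; rewrite ffunE E; case: ifP => /= h; rewrite in_itv /= ?andbT // ltNge h.
move=> h; apply/ffunP => j; rewrite ffunE E; have := h j; rewrite /= mem_index_enum => /(_ isT).
by case: (u j); rewrite /= in_itv /= ?andbT // ltNge => /negbTE.
Qed.

Let D_bounds n r : `|r| <= n%:R -> val (D n r) <= r <= val (D n r) + (2 ^+ n)^-1.
Proof.
rewrite ler_norml => /andP[r1 r2]; pose y := (r + n%:R) * 2 ^+ n.
have q0 : 0 < 2 ^+ n :> R by rewrite exprn_gt0.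
have y0 : 0 <= y by rewrite mulr_ge0 ?(ltW q0) //; lra.
have tK : (Num.truncn y <= K n)%N.
  rewrite -(ler_nat R); apply: (@le_trans _ _ y); first by rewrite truncn_le.
  by rewrite /y /K !natrM natrX ler_pM2r //; lra.
have SE : (\sum_j D n r j = Num.truncn y)%N.
  rewrite -[RHS]card_ord -sum1_card (big_ord_widen_cond (K n) xpredT (fun=> 1%N) tK) [RHS]big_mkcond /=.
  by apply: eq_bigr => j _; rewrite ffunE -/y -truncn_ge_nat //; case: (_ < _)%N.
have /andP[h1 h2] := truncn_itv y0.
rewrite /val SE lerBlDr ler_pdivrMr // -/y h1 /=.
have : r + n%:R <= (Num.truncn y).+1%:R / 2 ^+ n by rewrite ler_pdivlMr // -/y ltW.
by rewrite -natr1 mulrDl mul1r; lra.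
Qed.

(* Eigenvalue counts [#{eigenvalues <= E}] are left constant in the potential, so along dyadic
   approximations of [V] from below they are eventually exact. *)
Definition left_constant (I : Type) (G : (I -> R) -> R) : Prop :=
  forall v, exists2 e : R, 0 < e & forall v', (forall i, v' i <= v i <= v' i + e) -> G v' = G v.

Let step (I : finType) (G : (I -> R) -> R) n (u : {ffun I -> {ffun 'I_(K n) -> bool}}) : R :=
  G (fun i => val (u i)).

Let step_cvg (I : finType) (G : (I -> R) -> R) (x : I -> pt) w : left_constant G ->
  (fun n => step G (obs (@D n) x w)) @ \oo --> G (fun i => V (x i) w).
Proof.
move=> Gc; have [e e0 Ge] := Gc (fun i => V (x i) w).
apply: cvg_near_cst.
have h1 : \forall n \near \oo, (2 ^+ n)^-1 <= e.
  have : (fun n => (2^-1 : R) ^+ n) @ \oo --> 0.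
    by apply: cvg_expr; rewrite ger0_norm; lra.
  move=> /cvgrPdist_le /(_ e e0); apply: filterS => n.
  by rewrite sub0r normrN ger0_norm ?exprn_ge0 ?invr_ge0 // exprVn.
have h2 : \forall n \near \oo, forall i, `|V (x i) w| <= n%:R.
  apply: filter_forall => i; exists (Num.truncn `|V (x i) w|).+1 => // n /= hn.
  apply: ltW; apply: lt_le_trans (truncnS_gt _) _; by rewrite ler_nat.
near=> n.
have hn : forall i, `|V (x i) w| <= n%:R by near: n.
have en : (2 ^+ n)^-1 <= e by near: n.
apply: Ge => i; rewrite ffunE; have /andP[-> /= h] := D_bounds (hn i).
by apply: le_trans h _; rewrite lerD2l.
Unshelve. all: by end_near. Qed.

Section Functional.
Variables (I : finType) (G : (I -> R) -> R) (B : R).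
Hypotheses (GB : forall v, `|G v| <= B) (Gc : left_constant G).

Definition eval_at (x : I -> pt) (w : T) : R := G (fun i => V (x i) w).

(** Left constancy makes the step functions eventually equal to [eval_at] at each outcome, which
    gives measurability, and dominated convergence gives the means. *)
Let eval_cvg x : (forall i, vertex (x i)) ->
  bounded_rv (eval_at x) /\ (fun n => mean P (fun w => step G (obs (@D n) x w))) @ \oo --> mean P (eval_at x).
Proof.
move=> vx; apply: (@mean_cvg _ _ _ P (fun n w => step G (obs (@D n) x w)) _ B).
- by move=> n; have [] := @obs_bounded_rv _ _ (@mD n) I x (@step I G n) vx.
- by move=> n w; exact: GB.
- by move=> w; exact: step_cvg.
Qed.

Lemma bounded_rv_eval x : (forall i, vertex (x i)) -> bounded_rv (eval_at x).
Proof. by move=> /eval_cvg[]. Qed.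

(** By [mean_obs] the means of the step functions at [x] and at [x'] are the same finite sum; only
    the limit remains. *)
Lemma mean_eval x x' : injective x -> injective x' ->
  (forall i, vertex (x i)) -> (forall i, vertex (x' i)) ->
  mean P (eval_at x) = mean P (eval_at x').
Proof.
move=> xi xi' vx vx'; have [_ h] := eval_cvg vx; have [_ h'] := eval_cvg vx'.
have e : (fun n => mean P (fun w => step G (obs (@D n) x' w))) =
    fun n => mean P (fun w => step G (obs (@D n) x w)).
  by apply/funext => n; rewrite !(mean_obs (@mD n)).
by rewrite e in h'; exact: (cvg_unique _ h h').
Qed.

Lemma mean_eval_indep x x' : injective x -> injective x' -> (forall i j, x i <> x' j) ->
  (forall i, vertex (x i)) -> (forall i, vertex (x' i)) ->
  mean P (fun w => eval_at x w * eval_at x' w) = mean P (eval_at x) * mean P (eval_at x').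
Proof.
move=> xi xi' xx' vx vx'; have [b h] := eval_cvg vx; have [b' h'] := eval_cvg vx'.
have [] := @mean_cvg _ _ _ P (fun n w => step G (obs (@D n) x w) * step G (obs (@D n) x' w))
  (fun w => eval_at x w * eval_at x' w) (B * B).
- move=> n; apply: measurable_funM.
    by have [] := @obs_bounded_rv _ _ (@mD n) I x (@step I G n) vx.
  by have [] := @obs_bounded_rv _ _ (@mD n) I x' (@step I G n) vx'.
- by move=> n w; rewrite normrM ler_pM //; exact: GB.
- by move=> w; apply: cvgM; exact: step_cvg.
move=> _ h''; have e : (fun n => mean P (fun w => step G (obs (@D n) x w) * step G (obs (@D n) x' w))) = fun n =>
  mean P (fun w => step G (obs (@D n) x w)) * mean P (fun w => step G (obs (@D n) x' w)).
  by apply/funext => n; rewrite (mean_obs_indep (@mD n)).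
by rewrite e in h''; exact: (cvg_unique _ h'' (cvgM h h')).
Qed.

End Functional.
End Discretisation.

End Independence.

(** * Left constancy of eigenvalue counts *)

Section PotentialMatrix.
Variable R : realType.

(** There are finitely many eigenvalues, so a small enough interval to the right of E contains
    none. *)
Lemma ncount_gap n (E : R) (A : 'M[R]_n) : A^T = A ->
  exists2 e : R, 0 < e & ncount (E + e) A = ncount E A.
Proof.
move=> /symmetric_spectral[Q [dg [QQ QAQ]]].
have [e [e0 he]] : exists e : R, 0 < e /\ forall i, E < dg 0 i -> E + e < dg 0 i.
  have : \forall e \near 0^'+, forall i, E < dg 0 i -> E + e < dg 0 i.
    apply: filter_forall => i; have [Ei|_] := ltP E (dg 0 i); last by near=> e.
    near=> e => _; rewrite -ltrBrDl; near: e; apply: nbhs_right_lt; by rewrite subr_gt0.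
  move=> h.
  have /filter_ex[e [e0 he]] : \forall e \near (0 : R)^'+, 0 < e /\ forall i, E < dg 0 i -> E + e < dg 0 i.
    by apply: filterI => //; exact: nbhs_right_gt.
  by exists e.
exists e => //; rewrite /ncount !(Ncount_diag _ QQ QAQ) !natrK; apply: eq_card => i.
rewrite !inE; apply/idP/idP => [|h]; last by lra.
by apply: contraTT; rewrite -!ltNge; exact: he.
Unshelve. all: by end_near. Qed.

Definition pmat n (K : 'M[R]_n) (v : 'I_n -> R) : 'M[R]_n :=
  \matrix_(i, j) (K i j + (if i == j then v i else 0)).

Lemma pmat_sym n (K : 'M[R]_n) v : K^T = K -> (pmat K v)^T = pmat K v.
Proof.
move=> Ks; apply/matrixP => i j; rewrite !mxE -[in LHS]Ks mxE eq_sym; congr (_ + _).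
by case: eqP => // ->.
Qed.

Lemma qform_pmat n (K : 'M[R]_n) v w :
  qform (pmat K v) w = qform K w + \sum_i v i * w 0 i ^+ 2.
Proof.
rewrite !qformE -sum_diag_form -big_split /=; apply: eq_bigr => i _.
by rewrite -big_split /=; apply: eq_bigr => j _; rewrite mxE mulrDr.
Qed.

Lemma ncount_pmat_le n (K : 'M[R]_n) (E e : R) v v' : K^T = K ->
  (forall i, v i <= v' i + e) -> (ncount E (pmat K v') <= ncount (E + e) (pmat K v))%N.
Proof.
move=> Ks vv'; apply: ncount_mono; [exact: pmat_sym|exact: pmat_sym|] => w.
rewrite !qform_pmat !nsqE mulrDl.
have : \sum_i v i * w 0 i ^+ 2 <= \sum_i v' i * w 0 i ^+ 2 + e * (\sum_i w 0 i ^+ 2).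
  rewrite mulr_sumr -big_split /=; apply: ler_sum => i _.
  by rewrite -mulrDl ler_wpM2r ?sqr_ge0.
by lra.
Qed.

(** Lowering the potential can only raise the count, and lowering it by at most e costs no more than
    raising the energy to E + e, which by [ncount_gap] changes nothing. *)
Lemma ncount_pmat_left_constant n (K : 'M[R]_n) (E : R) : K^T = K ->
  left_constant (fun v => (ncount E (pmat K v))%:R : R).
Proof.
move=> Ks v; have [e e0 Ee] := ncount_gap E (pmat_sym v Ks).
exists e => // v' h; congr (_%:R); apply/eqP; rewrite eqn_leq; apply/andP; split.
  rewrite -Ee; apply: ncount_pmat_le => // i; by have /andP[] := h i.
rewrite -[E in leqRHS]addr0; apply: ncount_pmat_le => // i.
by rewrite addr0; have /andP[] := h i.
Qed.

Lemma ncount_leq n (E : R) (A : 'M[R]_n) : A^T = A -> (ncount E A <= n)%N.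
Proof. by move=> /(ncount_high E)[]. Qed.

Lemma blockHE m (v : 'I_(size (intv m)) -> R) :
  blockH v = pmat (\matrix_(i, j) tri_kernel R m (@ipt m i) (@ipt m j)) v.
Proof. by apply/matrixP => i j; rewrite !mxE. Qed.

Lemma tri_kernel_sym m : (\matrix_(i, j) tri_kernel R m (@ipt m i) (@ipt m j))^T =
  \matrix_(i, j) tri_kernel R m (@ipt m i) (@ipt m j).
Proof. by apply/matrixP => i j; rewrite !mxE tri_kernelC. Qed.

Lemma HB_pmat L (W : pt -> R) :
  HB L W = pmat (\matrix_(i, j) kernel_sum R L.+1 (@xpt L i) (@xpt L j)) (fun i => W (xpt i)).
Proof. by apply/matrixP => i j; rewrite HBE !mxE. Qed.

Lemma kernel_sum_sym L : (\matrix_(i, j) kernel_sum R L.+1 (@xpt L i) (@xpt L j))^T =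
  \matrix_(i, j) kernel_sum R L.+1 (@xpt L i) (@xpt L j).
Proof. by apply/matrixP => i j; rewrite !mxE kernel_sumC. Qed.

Lemma ncountE_mono n (E E' : R) (A : 'M[R]_n) : A^T = A -> E <= E' ->
  (ncount E A <= ncount E' A)%N.
Proof.
move=> As EE'; apply: ncount_mono => // w; rewrite lerD2l lerN2.
by rewrite ler_wpM2r ?nsq_ge0.
Qed.

End PotentialMatrix.

(** * A law of large numbers along geometric sizes *)

Section LargeNumbers.
Context (R : realType) (d : measure_display) (T : measurableType d) (P : probability T R).

(** Chebyshev and Borel-Cantelli: uncorrelated bounded terms give a deviation probability of order 1
    / |s_k| <= 2^-k, which is summable, so second moments suffice. *)
Lemma lln (C : eqType) (s : nat -> seq C) (U : C -> T -> R) (B : R) :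
  (forall k, uniq (s k)) -> (forall k, (2 ^ k <= size (s k))%N) ->
  (forall c, bounded_rv (U c)) -> (forall c w, `|U c w| <= B) ->
  (forall c c', c <> c' -> mean P (fun w => U c w * U c' w) = 0) ->
  {ae P, forall w, (fun k => (\sum_(c <- s k) U c w) / (size (s k))%:R) @ \oo --> (0 : R)}.
Proof.
move=> us ss bU UB U0.
pose Z k w := \sum_(c <- s k) U c w; pose N k : R := (size (s k))%:R.
have N0 k : 0 < N k by rewrite ltr0n; apply: leq_trans (ss k); rewrite expn_gt0.
have bZ k : bounded_rv (Z k) by exact: bounded_rv_sum.
have bZ2 k : bounded_rv (fun w => Z k w * Z k w) by exact: bounded_rvM.
have mZ2 k : mean P (fun w => Z k w * Z k w) <= N k * B ^+ 2.
  have bUU c c' : bounded_rv (fun w => U c w * U c' w) by exact: bounded_rvM.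
  have -> : (fun w => Z k w * Z k w) = fun w => \sum_(c <- s k) \sum_(c' <- s k) U c w * U c' w.
    by apply/funext => w; rewrite /Z big_distrlr.
  rewrite mean_sum => [|c]; last exact: bounded_rv_sum.
  have -> : N k * B ^+ 2 = \sum_(c <- s k) B ^+ 2.
    by rewrite big_const_seq count_predT iter_addr addr0 mulr_natl.
  rewrite big_seq [leRHS]big_seq; apply: ler_sum => c cs.
  rewrite mean_sum // (bigD1_seq c) //= big1 ?addr0 => [|c' cc']; last first.
    by apply: U0 => e; rewrite e eqxx in cc'.
  rewrite -[leRHS](mean_cst P); apply: mean_le => //; first exact: bounded_rv_cst.
  by move=> w; have := UB c w; rewrite ler_norml => /andP[h1 h2]; nra.
(* The average at stage k is at least 1/(j+1) in absolute value; countably many thresholds j suffice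
   for convergence. *)
pose A j k := [set w | N k <= j.+1%:R * `|Z k w|].
have mA j k : measurable (A j k).
  rewrite (_ : A j k = (fun w => j.+1%:R * `|Z k w|) @^-1` `[N k, +oo[%classic).
    rewrite -[X in measurable X]setTI.
    have mg : measurable_fun setT (fun w => j.+1%:R * `|Z k w|).
      apply: measurable_funM; first exact: measurable_cst.
      by apply: measurableT_comp; [exact: normr_measurable | exact: (bZ k).1].
    by apply: mg.
  by apply/seteqP; split=> w; rewrite /A /= in_itv /= andbT.
have PA j k : (P (A j k) <= ((2 * (B ^+ 2 * j.+1%:R ^+ 2)) / (2 ^ (k + 1))%:R)%:E)%E.
  rewrite -[leLHS]fineK ?fin_num_measure // lee_fin -mean_indic //.
  pose r : R := (j.+1%:R / N k) ^+ 2.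
  apply: (@le_trans _ _ (mean P (fun w => r * (Z k w * Z k w)))).
    apply: mean_le; [exact: bounded_rv_indic | exact: bounded_rvZ |] => w.
    rewrite indicE; case: (boolP (w \in A j k)) => [|_]; last by rewrite mulr_ge0 ?sqr_ge0 // -expr2 sqr_ge0.
    rewrite inE /A /= => hw; have h1 : 1 <= j.+1%:R / N k * `|Z k w|.
      by rewrite mulrAC ler_pdivlMr // mul1r.
    rewrite /r -expr2 -[Z k w ^+ 2]real_normK ?num_real // -exprMn.
    by rewrite exprn_ege1.
  rewrite meanZ //; apply: (@le_trans _ _ (r * (N k * B ^+ 2))).
    by rewrite ler_wpM2l ?sqr_ge0.
  have q0 : 0 < (2 ^ k)%:R :> R by rewrite ltr0n expn_gt0.
  rewrite (_ : _ / (2 ^ (k + 1))%:R = B ^+ 2 * j.+1%:R ^+ 2 / (2 ^ k)%:R); last first.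
    by rewrite addn1 expnS natrM; move: q0; move: ((2 ^ k)%:R) => q q0; field; rewrite gt_eqF.
  rewrite (_ : r * _ = B ^+ 2 * j.+1%:R ^+ 2 / N k); last by rewrite /r; field; exact: lt0r_neq0 (N0 k).
  apply: ler_wpM2l; first by rewrite mulr_ge0 // sqr_ge0.
  by rewrite lef_pV2 ?posrE // ler_nat.
have h j : {ae P, forall w, exists K, forall k, (K <= k)%N -> j.+1%:R * `|Z k w| < N k}.
  exists (lim_sup_set (A j)); split.
  - apply: bigcap_measurable => [|n _]; first by exists 0%N.
    by apply: bigcup_measurable => k _.
  - apply: lim_sup_set_cvg0 => //.
    pose r : R := 2 * (B ^+ 2 * j.+1%:R ^+ 2).
    have /cvg_lim e := @cvg_geometric_eseries_half R r 0.
    apply: (@le_lt_trans _ _ (\sum_(k <oo) (r / (2 ^ (k + 1))%:R)%:E)%E).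
      by apply: lee_nneseries => [k _ _|k _]; [exact: measure_ge0 | exact: PA].
    by rewrite e // ltry.
  - move=> w /= nw n _ /=; apply: contrapT => hn; apply: nw; exists n => k nk.
    by rewrite ltNge; apply/negP => hk; apply: hn; exists k.
have := ae_foralln h; apply: filterS => w hw.
apply/cvgrPdist_lt => e e0.
have [j je] : exists j, j.+1%:R^-1 < e.
  exists (Num.truncn e^-1); rewrite -[ltRHS]invrK ltf_pV2 ?posrE ?invr_gt0 ?ltr0n //.
  exact: truncnS_gt.
have [K hK] := hw j; exists K => // k /= /hK hk.
rewrite sub0r normrN normrM normfV [`|(size _)%:R|]ger0_norm ?ler0n //.
rewrite -/(N k) ltr_pdivrMr //; apply: lt_trans (_ : j.+1%:R^-1 * N k < _); last by rewrite ltr_pM2r.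
by rewrite mulrC ltr_pdivlMr ?ltr0n // mulrC.
Qed.

End LargeNumbers.

(** * Chernoff bound for bad triangles *)

Section Chernoff.
Context (R : realType) (d : measure_display) (T : measurableType d) (P : probability T R).
Context (P0 : probability R R) (V : pt -> T -> R).
Hypothesis iid : iid_potential P V P0.

Let exceeds (t r : R) : bool := t <= r.

Let mexceeds t j : measurable (exceeds t @^-1` [set j]).
Proof.
rewrite (_ : _ @^-1` _ = if j then `[t, +oo[%classic else `]-oo, t[%classic); first by case: j.
apply/seteqP; split=> r; rewrite /exceeds /=.
  by case: j => h; rewrite /= in_itv /= ?andbT ?h // ltNge h.
by case: j; rewrite /= in_itv /= ?andbT // ltNge => /negbTE.
Qed.

Lemma fine_probability_ge0 (A : set R) : 0 <= fine (P0 A).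
Proof. by rewrite fine_ge0 // measure_ge0. Qed.

Lemma fine_probability_le1 (A : set R) : measurable A -> fine (P0 A) <= 1.
Proof.
move=> mA; rewrite -lee_fin fineK ?fin_num_measure //; exact: probability_le1.
Qed.

Lemma bad_cell_measurable m (t theta : R) (x : 'I_(size (intv m)) -> pt) :
  (forall i, vertex (x i)) ->
  bounded_rv (fun w => (~~ good_cells t theta (fun i => V (x i) w))%:R : R).
Proof.
move=> vx.
pose F (u : {ffun 'I_(size (intv m)) -> bool}) : R :=
  (~~ (theta * (size (intv m))%:R <= #|[set i | u i]%SET|%:R))%:R.
have -> : (fun w => (~~ good_cells t theta (fun i => V (x i) w))%:R : R) =
    fun w => F (obs V (exceeds t) x w).
  apply/funext => w /=; rewrite /good_cells /F; congr (~~ (_ <= _%:R))%:R.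
  by apply: eq_card => i; rewrite !inE ffunE.
exact: (@obs_bounded_rv _ _ _ _ _ _ iid _ _ (@mexceeds t) _ x F vx).
Qed.

Definition exceed_prob (t : R) : R := fine (P0 `[t, +oo[%classic).

(** With S the number of sites where V >= t, the indicator of S < pn/4 is at most exp(pn/4 - S), and
    E exp(-S) = (1 - p + p/e)^n <= exp(-pn/2) as 1/e <= 1/2. The threshold p/4 thus leaves the rate
    p/4. *)
Lemma bad_cell_prob m (t : R) (x : 'I_(size (intv m)) -> pt) :
  injective x -> (forall i, vertex (x i)) ->
  mean P (fun w => (~~ good_cells t (exceed_prob t / 4) (fun i => V (x i) w))%:R) <=
    expR (- (exceed_prob t / 4) * (size (intv m))%:R).
Proof.
move=> xi vx; set p := exceed_prob t; set n := size (intv m).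
have p0 : 0 <= p := fine_probability_ge0 _.
have p1 : p <= 1 by exact: fine_probability_le1.
pose F (u : {ffun 'I_n -> bool}) : R := (~~ (p / 4 * n%:R <= #|[set i | u i]%SET|%:R))%:R.
have -> : (fun w => (~~ good_cells t (p / 4) (fun i => V (x i) w))%:R : R) =
    fun w => F (obs V (exceeds t) x w).
  apply/funext => w /=; rewrite /good_cells /F; congr (~~ (_ <= _%:R))%:R.
  by apply: eq_card => i; rewrite !inE ffunE.
rewrite (mean_obs iid (@mexceeds t)) //.
pose pr b : R := obs_prob P0 (exceeds t) b.
have prT : pr true = p.
  rewrite /pr /obs_prob /p /exceed_prob; congr (fine (P0 _)).
  by apply/seteqP; split=> r /=; rewrite /exceeds in_itv /= andbT.
have prF : pr false = 1 - p.
  rewrite /pr /obs_prob (_ : _ @^-1` _ = ~` `[t, +oo[%classic).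
    by rewrite probability_setC //= fineB // fin_num_measure.
  by apply/seteqP; split=> r /=; rewrite /exceeds in_itv /= andbT; [move=> -> | move=> /negP/negbTE].
have pr0 b : 0 <= pr b by exact: fine_probability_ge0.
pose g (b : bool) : R := expR (- (b%:R)) * pr b.
apply: (@le_trans _ _ (expR (p / 4 * n%:R) * \sum_(u : {ffun 'I_n -> bool}) \prod_i g (u i))).
  rewrite mulr_sumr; apply: ler_sum => u _.
  rewrite big_split /= mulrA; apply: ler_wpM2r; first by apply: prodr_ge0 => i _; exact: pr0.
  rewrite -expR_sum -expRD sumrN -natr_sum.
  have -> : (\sum_i u i = #|[set i | u i]%SET|)%N.
    rewrite -sum1_card [RHS]big_mkcond; apply: eq_bigr => i _; rewrite inE; by case: (u i).
  rewrite /F -ltNge; case: (ltP _ (p / 4 * n%:R)) => h /=; last exact: expR_ge0.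
  by apply: le_trans (expR_ge1Dx _); lra.
rewrite -(bigA_distr_bigA (fun (_ : 'I_n) b => g b)) /= (eq_bigr (fun=> 1 - p + expR (-1) * p)); last first.
  by move=> i _; rewrite big_bool /g prT prF /= mulr0n oppr0 expR0 mulr1n; ring.
rewrite prodr_const card_ord.
have e2 : expR (-1) <= 2^-1 :> R.
  rewrite expRN lef_pV2 ?posrE ?expR_gt0 //.
  by have := expR_ge1Dx (1 : R); lra.
have h1 : 1 - p + expR (-1) * p <= expR (- (p / 2)).
  by apply: le_trans (expR_ge1Dx _); have := ler_wpM2r p0 e2; lra.
have h2 : (1 - p + expR (-1) * p) ^+ n <= expR (- (p / 2) * n%:R).
  rewrite expRM_natr; apply: lerXn2r h1; rewrite nnegrE ?expR_ge0 //.
  by have := mulr_ge0 (expR_ge0 (-1 : R)) p0; lra.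
apply: le_trans (ler_wpM2l (expR_ge0 _) h2) _.
by rewrite -expRD ler_expR; lra.
Qed.

End Chernoff.

(** * Consequences of the support hypothesis *)

Section Support.
Context (R : realType) (P0 : probability R R).
Hypothesis hsupp : has_inf (supp P0) /\ inf (supp P0) = 0.

Lemma supp_ge0 x : supp P0 x -> 0 <= x.
Proof. by move=> sx; rewrite -hsupp.2; apply: ge_inf => //; exact: hsupp.1.2. Qed.

(** A negative number is outside the support, hence inside a null interval with rational endpoints;
    there are countably many of these. *)
Lemma negative_null : P0 `]-oo, 0[%classic = 0%E.
Proof.
pose J (n : nat) : set R := if unpickle n is Some (a, b) then
   (if P0 `]ratr a, ratr b[%classic == 0%E then `]ratr a, ratr b[%classic else set0) else set0.
have nJ : P0.-negligible (\bigcup_n J n).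
  apply: negligible_bigcup => n; rewrite /J; case: unpickle => [[a b]|]; last exact: negligible_set0.
  by case: eqP => h; [apply/negligibleP | exact: negligible_set0].
apply/negligibleP => //; apply: negligibleS nJ => x /=; rewrite in_itv /= => x0.
have /existsNP[e /not_implyP[e0 /negP]] : ~ supp P0 x by move=> /supp_ge0; lra.
rewrite -leNgt => Pe.
have [a /[!in_itv]/= /andP[a1 a2]] := @rat_in_itvoo R (x - e) x ltac:(lra).
have [b /[!in_itv]/= /andP[b1 b2]] := @rat_in_itvoo R x (x + e) ltac:(lra).
have Pab : P0 `]ratr a, ratr b[%classic = 0%E.
  apply/eqP; rewrite eq_le measure_ge0 andbT; apply: le_trans Pe; apply: le_measure.
  - by rewrite inE.
  - by rewrite inE; exact: measurable_itv.
  - by move=> y /=; rewrite /open_itv /= !in_itv /=; lra.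
suff h : J (pickle (a, b)) x by exact: (ex_intro2 _ _ (pickle (a, b)) I h).
by rewrite /J pickleK Pab eqxx /= in_itv /= a2 b1.
Qed.

(** Otherwise every [1/(n+1), oo) is null, hence (0, oo), and with [negative_null] all the mass sits
    at 0. *)
Lemma exists_exceed : ~ (exists x : R, P0 [set x] = 1%E) ->
  exists2 t : R, 0 < t & 0 < exceed_prob P0 t.
Proof.
move=> natom; apply: contrapT => h; apply: natom; exists 0.
have z n : P0 `[(n.+1%:R)^-1, +oo[%classic = 0%E.
  apply: contrapT => hn; apply: h; exists (n.+1%:R)^-1; first by rewrite invr_gt0 ltr0n.
  rewrite fine_gt0 // ltey_eq fin_num_measure //= andbT lt_neqAle measure_ge0 andbT eq_sym.
  exact/eqP.
have pos : P0 `]0, +oo[%classic = 0%E.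
  apply/negligibleP => //.
  have nI : P0.-negligible (\bigcup_n `[(n.+1%:R)^-1, +oo[%classic).
    by apply: negligible_bigcup => n; apply/negligibleP => //; exact: z.
  apply: negligibleS nI => x /=; rewrite in_itv /= andbT => x0.
  exists (Num.truncn x^-1) => //=; rewrite in_itv /= andbT.
  rewrite -[leRHS]invrK lef_pV2 ?posrE ?invr_gt0 ?ltr0n // ltW //; exact: truncnS_gt.
have E : [set (0 : R)] = ~` (`]-oo, 0[%classic `|` `]0, +oo[%classic).
  by apply/seteqP; split=> x /=; rewrite !in_itv /= andbT; [move=> -> []; lra|move=> /not_orP[/negP + /negP]; lra].
rewrite E probability_setC; last exact: measurableU.
rewrite measureU //; last by apply/seteqP; split=> x //=; rewrite !in_itv /= andbT; lra.
transitivity (1 - (0 + 0) : \bar R)%E; last by rewrite adde0 sube0.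
by congr (_ - (_ + _))%E; [exact: negative_null | exact: pos].
Qed.

End Support.

(** * The integrated density of states *)

Section Regularisation.
Variable R : realType.
Implicit Types f N : R -> R.

(** N(x) is the infimum of f over (x, oo). The last two properties sandwich N by f and are all that
    later arguments know about their relation. *)
Lemma right_regularisation f : {homo f : x y / x <= y} ->
  exists N, [/\ {homo N : x y / x <= y}, (forall x, N y @[y --> x^'+] --> N x),
    (forall x, f x <= N x) & forall x y, x < y -> N x <= f y].
Proof.
move=> fm; pose S x := [set f y | y in [set y | x < y]].
have S0 x : has_inf (S x).
  split; first by exists (f (x + 1)), (x + 1) => //=; rewrite ltrDl.
  by exists (f x) => _ [y /= xy <-]; exact: fm (ltW xy).
pose N x := inf (S x).
have Nle x y : x < y -> N x <= f y by move=> xy; apply: ge_inf; [exact: (S0 x).2 | exists y].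
have leN x : f x <= N x by apply: lb_le_inf; [exact: (S0 x).1 | move=> _ [y /= xy <-]; exact: fm (ltW xy)].
have Nm : {homo N : x y / x <= y}.
  move=> x y; rewrite le_eqVlt => /predU1P[-> //|xy].
  by apply: lb_le_inf; [exact: (S0 y).1 | move=> _ [z /= yz <-]; apply: Nle; exact: lt_trans yz].
exists N; split=> // x; apply/cvgrPdist_lt => e e0.
have [_ [y /= xy <-] fy] := inf_adherent e0 (S0 x).
near=> z; have xz : x < z by near: z; exact: nbhs_right_gt.
have zy : z < y by near: z; exact: nbhs_right_lt.
rewrite distrC ger0_norm ?subr_ge0 ?Nm ?(ltW xz) // ltrBlDl.
by apply: le_lt_trans fy; exact: Nle.
Unshelve. all: by end_near. Qed.

(** E is bracketed by rationals q1 < E < q2 within the continuity scale of N; monotonicity of u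
    squeezes u(E) between values that converge to f(q1) and f(q2), both close to N(E). *)
Lemma continuous_sandwich f N (u : nat -> R -> R) E :
  (forall L, {homo u L : x y / x <= y}) ->
  (forall x, f x <= N x) -> (forall x y, x < y -> N x <= f y) ->
  (forall q : rat, (fun L => u L (ratr q)) @ \oo --> f (ratr q)) ->
  {for E, continuous N} -> (fun L => u L E) @ \oo --> N E.
Proof.
move=> um fN Nf uq Nc; apply/cvgrPdist_lt => e e0.
have e20 : 0 < e / 2 by lra.
have /cvgrPdist_lt/(_ _ e20)[r /= r0 Nr] := Nc.
have [q1 /[!in_itv]/= /andP[a1 a2]] := @rat_in_itvoo R (E - r / 2) E ltac:(lra).
have [q2 /[!in_itv]/= /andP[b1 b2]] := @rat_in_itvoo R E (E + r / 2) ltac:(lra).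
have near1 : `|N E - N (E - r / 2)| < e / 2 by apply: Nr; rewrite /= ltr_norml; lra.
have near2 : `|N E - N (ratr q2)| < e / 2 by apply: Nr; rewrite /= ltr_norml; lra.
have l1 := Nf _ _ a1; have l2 := fN (ratr q2).
have /cvgrPdist_lt/(_ _ e20) c1 := uq q1; have /cvgrPdist_lt/(_ _ e20) c2 := uq q2.
near=> L.
have d1 : `|f (ratr q1) - u L (ratr q1)| < e / 2 by near: L.
have d2 : `|f (ratr q2) - u L (ratr q2)| < e / 2 by near: L.
have m1 := um L _ _ (ltW a2); have m2 := um L _ _ (ltW b1).
move: near1 near2 d1 d2; rewrite !ltr_norml => /andP[? ?] /andP[? ?] /andP[? ?] /andP[? ?].
by apply/andP; split; lra.
Unshelve. all: by end_near. Qed.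

End Regularisation.

(** * Convergence of the normalised counts *)

Section DensityOfStates.
Context (R : realType) (d : measure_display) (T : measurableType d) (P : probability T R).
Context (P0 : probability R R) (V : pt -> T -> R).
Hypothesis iid : iid_potential P V P0.

(** Membership at some level, so that statements about one block do not depend on the ball that
    contains it. *)
Definition valid_cell (c : bool * pt) : Prop := exists k, c \in cells2 k.
Definition cell_points m (c : bool * pt) (i : 'I_(size (intv m))) : pt := place m c (ipt i).
Definition block_count m (E : R) (c : bool * pt) (w : T) : R :=
  (ncount E (@blockH R m (cellpot (V ^~ w) c)))%:R.
Definition ball_count L (E : R) (w : T) : R := Ncount E (HB L (V ^~ w)).

Lemma ball_countE L E w : ball_count L E w = (ncount E (HB L (V ^~ w)))%:R.
Proof. by rewrite /ball_count ncountE // HB_sym. Qed.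

Lemma cell_points_vertex m c i : valid_cell c -> vertex (@cell_points m c i).
Proof.
move=> [k ck]; have := place_verts ck (intv_verts (ipt_mem i)).
by move=> /ball_vertex[].
Qed.

Lemma cell_points_inj m c : valid_cell c -> injective (@cell_points m c).
Proof.
move=> [k ck] i j /(place_inj ck ck (ipt_mem i) (intv_verts (ipt_mem j)))[_].
exact: ipt_inj.
Qed.

Lemma cell_points_disjoint m c c' i j : valid_cell c -> valid_cell c' -> c <> c' ->
  @cell_points m c i <> @cell_points m c' j.
Proof.
move=> [k ck] [k' ck'] cc' e; apply: cc'.
have h : c \in cells2 (maxn k k') by apply: cells2_mono ck; rewrite leq_maxl.
have h' : c' \in cells2 (maxn k k') by apply: cells2_mono ck'; rewrite leq_maxr.
by have [] := place_inj h h' (ipt_mem i) (intv_verts (ipt_mem j)) e.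
Qed.

Let G m (E : R) (v : 'I_(size (intv m)) -> R) : R := (ncount E (blockH v))%:R.

Let G_bound m E v : `|@G m E v| <= (size (intv m))%:R.
Proof. by rewrite /G ger0_norm ?ler0n // ler_nat ncount_leq // blockH_sym. Qed.

Let G_left m E : left_constant (@G m E).
Proof.
rewrite /G (_ : (fun _ => _) = fun v =>
  (ncount E (pmat (\matrix_(i, j) tri_kernel R m (@ipt m i) (@ipt m j)) v))%:R).
  by apply: ncount_pmat_left_constant; exact: tri_kernel_sym.
by apply/funext => v; rewrite blockHE.
Qed.

Definition block_mean m E : R := mean P (block_count m E (false, O)).

Lemma valid0 : valid_cell (false, O).
Proof. by exists 0%N; rewrite mem_cells2 inE. Qed.

Lemma block_bounded m E c : valid_cell c -> bounded_rv (block_count m E c).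
Proof.
move=> vc; exact: (bounded_rv_eval iid (@G_bound m E) (@G_left m E) (fun i => cell_points_vertex i vc)).
Qed.

Lemma mean_block m E c : valid_cell c -> mean P (block_count m E c) = block_mean m E.
Proof.
move=> vc; exact: (mean_eval iid (@G_bound m E) (@G_left m E)
  (@cell_points_inj m _ vc) (@cell_points_inj m _ valid0)
  (fun i => cell_points_vertex i vc) (fun i => cell_points_vertex i valid0)).
Qed.

Lemma mean_block_indep m E c c' : valid_cell c -> valid_cell c' -> c <> c' ->
  mean P (fun w => block_count m E c w * block_count m E c' w) = block_mean m E ^+ 2.
Proof.
move=> vc vc' cc'; rewrite expr2 -{1}(mean_block m E vc) -(mean_block m E vc').
exact: (mean_eval_indep iid (@G_bound m E) (@G_left m E) (@cell_points_inj m _ vc) (@cell_points_inj m _ vc')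
  (fun i j => @cell_points_disjoint m c c' i j vc vc' cc')
  (fun i => cell_points_vertex i vc) (fun i => cell_points_vertex i vc')).
Qed.

Lemma ball_bounded L E : bounded_rv (ball_count L E).
Proof.
pose K : 'M[R]_#|BallL L| := \matrix_(i, j) kernel_sum R L.+1 (@xpt L i) (@xpt L j).
have Ks : K^T = K by exact: kernel_sum_sym.
pose F (v : 'I_#|BallL L| -> R) : R := (ncount E (pmat K v))%:R.
rewrite (_ : ball_count L E = eval_at V F (@xpt L)); last first.
  by apply/funext => w; rewrite ball_countE /eval_at /F HB_pmat.
apply: (bounded_rv_eval iid (B := (#|BallL L|)%:R)).
- by move=> v; rewrite /F ger0_norm ?ler0n // ler_nat ncount_leq // pmat_sym.
- exact: ncount_pmat_left_constant.
- by move=> i; have [] := ball_vertex (xpt_mem i).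
Qed.

Lemma ball_count_cells k m E w :
  \sum_(c <- cells2 k) block_count m E c w <= ball_count (k + m) E w /\
  ball_count (k + m) E w <= \sum_(c <- cells2 k) block_count m E c w + (3 ^+ k.+1 + 2).
Proof.
have [h1 h2] := @ncount_cells R k m E (V ^~ w).
rewrite ball_countE /block_count -natr_sum; split; first by rewrite ler_nat.
by rewrite -natrX -!natrD ler_nat.
Qed.

Definition ball_avg L E : R := mean P (ball_count L E) / (#|BallL L|)%:R.

Lemma mean_cells k m E : mean P (fun w => \sum_(c <- cells2 k) block_count m E c w) =
  2 * 3 ^+ k * block_mean m E.
Proof.
(* [mean_sum] asks for boundedness at every index, which is available for valid cells only;
   elsewhere [F] is 0. *)
pose F c w := if `[< valid_cell c >] then block_count m E c w else 0.
have bF c : bounded_rv (F c).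
  rewrite /F; case: asboolP => [vc|_]; [exact: block_bounded | exact: bounded_rv_cst].
rewrite (_ : (fun w => _) = fun w => \sum_(c <- cells2 k) F c w); last first.
  apply/funext => w; apply: eq_big_seq => c ck; rewrite /F asboolT //; by exists k.
rewrite mean_sum // (eq_big_seq (fun=> block_mean m E)) => [|c ck].
  by rewrite big_const_seq count_predT iter_addr addr0 size_cells2 -[LHS]mulr_natl natrM natrX.
rewrite /F asboolT; last by exists k.
by apply: mean_block; exists k.
Qed.

Lemma cells_bounded k m E : bounded_rv (fun w => \sum_(c <- cells2 k) block_count m E c w).
Proof.
pose F c w := if `[< valid_cell c >] then block_count m E c w else 0.
rewrite (_ : (fun w => _) = fun w => \sum_(c <- cells2 k) F c w).
  apply: bounded_rv_sum => c; rewrite /F; case: asboolP => [vc|_]; [exact: block_bounded | exact: bounded_rv_cst].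
apply/funext => w; apply: eq_big_seq => c ck; rewrite /F asboolT //; by exists k.
Qed.

Lemma mean_ball_cells k m E :
  2 * 3 ^+ k * block_mean m E <= mean P (ball_count (k + m) E) /\
  mean P (ball_count (k + m) E) <= 2 * 3 ^+ k * block_mean m E + (3 ^+ k.+1 + 2).
Proof.
rewrite -mean_cells; split.
  by apply: mean_le; [exact: cells_bounded|exact: ball_bounded|move=> w; have [] := ball_count_cells k m E w].
rewrite -[X in _ + X](mean_cst P) -meanD; [|exact: cells_bounded|exact: bounded_rv_cst].
apply: mean_le; [exact: ball_bounded| |move=> w; have [] := ball_count_cells k m E w; by []].
by apply: bounded_rvD; [exact: cells_bounded|exact: bounded_rv_cst].
Qed.

Lemma block_mean_bounds m E : 0 <= block_mean m E <= (size (intv m))%:R.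
Proof.
have bb := block_bounded m E valid0; apply/andP; split.
  rewrite -[leLHS](mean_cst P); apply: mean_le => //; first exact: bounded_rv_cst.
rewrite -[leRHS](mean_cst P); apply: mean_le => //; first exact: bounded_rv_cst.
by move=> w; rewrite ler_nat ncount_leq // blockH_sym.
Qed.

Lemma card_BallLR L : (#|BallL L|)%:R = 3 ^+ L.+1 + 2 :> R.
Proof. by rewrite card_BallL natrD natrX. Qed.

Lemma boundary_ratio k m : (3 ^+ k.+1 + 2) / (#|BallL (k + m)|)%:R <= 2 / 3 ^+ m :> R.
Proof.
rewrite card_BallLR -addSn exprD.
have h1 : 3 <= 3 ^+ k.+1 :> R by rewrite exprS ler_peMr // exprn_ege1 // ler1n.
have h2 : 1 <= 3 ^+ m :> R by rewrite exprn_ege1 // ler1n.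
move: (3 ^+ k.+1) (3 ^+ m) h1 h2 => a b h1 h2.
rewrite ler_pdivrMr; last by nra.
by rewrite mulrAC ler_pdivlMr; [nra | lra].
Qed.

(** The density seen by level-m blocks: 2 * 3^k blocks among about 3^(k+m+1) sites, a value
    independent of k. Being close to it makes the ball averages a Cauchy sequence. *)
Definition alpha m E : R := 2 * block_mean m E / 3 ^+ m.+1.

Lemma ball_avg_alpha m L E : (m <= L)%N -> `|ball_avg L E - alpha m E| <= 2 / 3 ^+ m.
Proof.
move=> /subnK <-; set k := (L - m)%N; apply: le_trans (boundary_ratio k m).
have [h1 h2] := mean_ball_cells k m E; have /andP[b0 bn] := block_mean_bounds m E.
rewrite /ball_avg /alpha; set b := (#|_|)%:R; set X := mean P _.
have b1 : 0 < b by rewrite /b card_BallLR ltr_wpDr // exprn_gt0.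
rewrite ler_pdivlMr // -[b in _ * b]ger0_norm ?(ltW b1) // -normrM mulrBl divfK ?gt_eqF //.
have q0 : 0 < 3 ^+ m.+1 :> R by rewrite exprn_gt0.
(* The last term comes from the 2 in |B_L| = 3^(L+1) + 2; it is at most 2 because a block has fewer
   than 3^(m+1) / 2 sites. *)
have bE : 2 * block_mean m E / 3 ^+ m.+1 * b = 2 * 3 ^+ k * block_mean m E + 4 * block_mean m E / 3 ^+ m.+1.
  rewrite /b card_BallLR -addnS exprD; move: q0; move: (3 ^+ m.+1) (3 ^+ k) => q r q0.
  by field; rewrite gt_eqF.
rewrite bE; have r0 : 0 <= 4 * block_mean m E / 3 ^+ m.+1 by rewrite divr_ge0 ?mulr_ge0 // ltW.
have r1 : 4 * block_mean m E / 3 ^+ m.+1 <= 2.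
  rewrite ler_pdivrMr //; have := size_intv m => /(congr1 (fun n : nat => n%:R : R)).
  by rewrite natrD natrM natrX; lra.
have k1 : 0 <= 3 ^+ k.+1 :> R by rewrite exprn_ge0.
rewrite -/X in h1 h2; rewrite ler_norml; apply/andP; split; lra.
Qed.

Lemma small_power (e : R) : 0 < e -> exists m, 2 / 3 ^+ m < e.
Proof.
move=> e0; have h : (fun n => (3^-1 : R) ^+ n) @ \oo --> 0.
  by apply: cvg_expr; rewrite ger0_norm; lra.
have e2 : 0 < e / 2 by lra.
have /cvgrPdist_lt/(_ _ e2)[m _ hm] := h; exists m.
have := hm m (leqnn m); rewrite sub0r normrN ger0_norm ?exprn_ge0 ?invr_ge0 // exprVn.
by rewrite ltr_pdivlMr // mulrC.
Qed.

Lemma ball_avg_cvg E : cvgn (fun L => ball_avg L E).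
Proof.
apply: cauchy_cvg; apply: cauchy_exP => e e0; have [m me] := small_power e0.
exists (alpha m E); exists m => // L /= mL; rewrite /ball /= distrC.
exact: le_lt_trans (ball_avg_alpha E mL) me.
Qed.

Lemma ball_count_mono L w : {homo (fun E => ball_count L E w) : x y / x <= y}.
Proof. by move=> x y xy; rewrite !ball_countE ler_nat ncountE_mono // HB_sym. Qed.

Lemma ball_avg_mono L : {homo ball_avg L : x y / x <= y}.
Proof.
move=> x y xy; rewrite /ball_avg ler_wpM2r ?invr_ge0 //.
by apply: mean_le => [||w]; [exact: ball_bounded|exact: ball_bounded|exact: ball_count_mono].
Qed.

(** For each m the centred block counts obey the law of large numbers; the remaining error is
    deterministic and at most 2 / 3^m. Intersecting the countably many events over m lets m grow
    with the required precision. *)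
Lemma ball_count_ae E :
  {ae P, forall w, (fun L => ball_count L E w / (#|BallL L|)%:R - ball_avg L E) @ \oo --> (0 : R)}.
Proof.
pose U m c w := if `[< valid_cell c >] then block_count m E c w - block_mean m E else 0.
have h m : {ae P, forall w, (fun k => (\sum_(c <- cells2 k) U m c w) / (size (cells2 k))%:R) @ \oo --> (0 : R)}.
  apply: (@lln _ _ _ P _ cells2 (U m) (size (intv m))%:R).
  - exact: uniq_cells2.
  - move=> k; rewrite size_cells2.
    by apply: (@leq_trans (3 ^ k)); [case: k => // k; rewrite leq_exp2r | rewrite leq_pmull].
  - move=> c; rewrite /U; case: asboolP => [vc|_]; last exact: bounded_rv_cst.
    by apply: bounded_rvD; [exact: block_bounded|exact: bounded_rv_cst].
  - move=> c w; rewrite /U; case: asboolP => [vc|_]; last by rewrite normr0 ler0n.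
    have /andP[b0 bn] := block_mean_bounds m E.
    have : 0 <= block_count m E c w <= (size (intv m))%:R.
      by rewrite /block_count ler0n ler_nat ncount_leq // blockH_sym.
    by rewrite ler_norml => /andP[? ?]; lra.
  - move=> c c' cc'; rewrite /U; case: asboolP => [vc|_]; last first.
      by rewrite -[RHS](mean_cst P); congr mean; apply/funext => w; rewrite mul0r.
    case: asboolP => [vc'|_]; last first.
      by rewrite -[RHS](mean_cst P); congr mean; apply/funext => w; rewrite mulr0.
    set b := block_mean m E.
    rewrite (_ : (fun w => _) = fun w => block_count m E c w * block_count m E c' w +
       (- b * block_count m E c w + (- b * block_count m E c' w + b ^+ 2))); last first.
      by apply/funext => w; ring.
    have bc := block_bounded m E vc; have bc' := block_bounded m E vc'.
    have b1 : bounded_rv (fun w : T => b ^+ 2) by exact: bounded_rv_cst.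
    have b2 := bounded_rvD (bounded_rvZ (- b) bc') b1.
    have b3 := bounded_rvD (bounded_rvZ (- b) bc) b2.
    rewrite meanD //; last exact: bounded_rvM.
    rewrite meanD //; last exact: bounded_rvZ.
    rewrite meanD //; last exact: bounded_rvZ.
    rewrite mean_cst !meanZ // mean_block_indep // !mean_block // -/b; ring.
have := ae_foralln h; apply: filterS => w hw.
apply/cvgrPdist_lt => e e0; have e20 : 0 < e / 2 by lra.
have [m me] := small_power e20.
have /cvgrPdist_lt/(_ _ e20)[K _ hK] := hw m.
exists (K + m)%N => // L /= KL.
have mL : (m <= L)%N by apply: leq_trans KL; rewrite leq_addl.
have kK : (K <= L - m)%N by rewrite leq_subRL // addnC.
have := hK _ kK; move: mL => /subnK <-; rewrite addnK; set k := (L - m)%N.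
have -> : \sum_(c <- cells2 k) U m c w = \sum_(c <- cells2 k) block_count m E c w - 2 * 3 ^+ k * block_mean m E.
  rewrite (eq_big_seq (fun c => block_count m E c w - block_mean m E)) => [|c ck].
    rewrite sumrB; congr (_ - _).
    by rewrite big_const_seq count_predT iter_addr addr0 size_cells2 -[LHS]mulr_natl natrM natrX.
  by rewrite /U asboolT //; exists k.
have [h1 h2] := mean_ball_cells k m E; have [h3 h4] := ball_count_cells k m E w.
have br := boundary_ratio k m; rewrite /ball_avg.
have sE : (size (cells2 k))%:R = 2 * 3 ^+ k :> R by rewrite size_cells2 natrM natrX.
have bs : 2 * 3 ^+ k <= (#|BallL (k + m)|)%:R :> R.
  rewrite -sE ler_nat size_cells2 card_BallL -addSn expnD expnS.
  by have := expn_gt0 3 m; move: (3 ^ k)%N (3 ^ m)%N => a b /= b0; nia.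
have s0 : 0 < 2 * 3 ^+ k :> R by rewrite mulr_gt0 ?exprn_gt0.
rewrite !sub0r !normrN sE normrM normfV [`|2 * 3 ^+ k|]gtr0_norm //.
move: h1 h2 h3 h4 br bs; set b := (#|_|)%:R; set N := 2 * 3 ^+ k; set X := mean P _; set Y := ball_count _ _ _.
set S := \sum_(c <- _) _; set q := 3 ^+ k.+1 + 2; set Nb := N * _ => h1 h2 h3 h4 br bs hS.
have b0 : 0 < b by apply: lt_le_trans bs.
have hS' : `|S - Nb| / b < e / 2.
  apply: le_lt_trans hS; apply: ler_wpM2l => //; by rewrite lef_pV2 ?posrE.
rewrite -mulrBl normrM normfV [`|b|]gtr0_norm //.
(* Both Y - S and X - Nb lie in [0, q], so their difference is at most q in absolute value. *)
have tri : `|Y - X| <= `|S - Nb| + q.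
  rewrite ler_norml; have := ler_norm (S - Nb); have := ler_norm (- (S - Nb)); rewrite normrN; lra.
apply: (@le_lt_trans _ _ (`|S - Nb| / b + q / b)).
  by rewrite -mulrDl ler_wpM2r ?invr_ge0 ?(ltW b0).
lra.
Qed.

End DensityOfStates.

(** * Lifshitz tails *)

Section LifshitzLimit.
Variables (R : realType) (N : R -> R) (A c C kappa e0 : R).
Hypotheses (A0 : 0 < A) (c0 : 0 < c) (C0 : 0 < C) (kappa0 : 0 < kappa) (e00 : 0 < e0).
Hypothesis upper : forall m e, (0 < m)%N -> 0 < e -> A * e * 5 ^+ m < 1 -> N e <= 2 * expR (- c * 3 ^+ m).
Hypothesis lower : forall m e, 0 < e -> e < e0 -> 20 <= e * 5 ^+ m ->
  C * (e / 2) `^ kappa <= 1 /\ (C * (e / 2) `^ kappa) ^+ (3 ^ m.+3) / 3 ^+ m.+3 <= N e.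

Let a : R := ln 3 / ln 5.
Let l3 : 0 < ln (3 : R). Proof. by apply: ln_gt0; lra. Qed.
Let l5 : 0 < ln (5 : R). Proof. by apply: ln_gt0; lra. Qed.

Let ln_pow (b : R) m : 0 < b -> ln (b ^+ m) = m%:R * ln b.
Proof. by move=> b0; rewrite lnXn // mulr_natl. Qed.

Let ln_quot (b q x : R) n : 0 < b -> 0 < q -> n%:R = q -> b ^+ n / q <= x ->
  - ln x <= ln q + q * - ln b.
Proof.
move=> b0 q0 nq h; have bq0 : 0 < b ^+ n / q by rewrite divr_gt0 ?exprn_gt0.
have : ln (b ^+ n / q) <= ln x by rewrite ler_ln ?posrE // (lt_le_trans bq0 h).
rewrite lnM ?posrE ?invr_gt0 ?exprn_gt0 // lnV ?posrE // ln_pow // nq.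
by move: (ln b) (ln q) (ln x) => u v w; lra.
Qed.

(** Take for m the integer part of z = log_5(20 / e) plus one. Then m + 3 <= z + 4 explains 4 ln 3,
    the denominator 3^(m+3) is absorbed by ln q <= q, and the polynomial lower bound on P0 costs
    only a factor linear in - ln e. *)
Let lower_log e : 0 < e -> e < e0 -> e < 1 ->
  0 < N e /\ - ln (N e) <= expR (a * - ln e + (a * ln 20 + 4 * ln 3)) *
     (1 - ln C + kappa * ln 2 + kappa * - ln e) /\ 1 <= 1 - ln C + kappa * ln 2 + kappa * - ln e.
Proof.
move=> ep ee0 e1; set y := - ln e; have y0 : 0 < y by rewrite oppr_gt0 ln_lt0 // ep.
have l20 : 0 < ln (20 : R) by apply: ln_gt0; lra.
pose z := (y + ln 20) / ln 5; have z0 : 0 <= z by rewrite divr_ge0 ?addr_ge0 ?ltW.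
have [m [m1 m2]] : exists m, m%:R <= z + 1 /\ z <= m%:R.
  exists (Num.truncn z).+1; have /andP[m1 m2] := truncn_itv z0.
  by split; [rewrite -natr1 lerD2r | exact: ltW].
have h20 : 20 <= e * 5 ^+ m.
  rewrite -ler_ln ?posrE ?mulr_gt0 ?exprn_gt0 // lnM ?posrE ?exprn_gt0 // ln_pow //.
  have : z * ln 5 <= m%:R * ln 5 by rewrite ler_pM2r.
  by rewrite /z divfK ?gt_eqF // /y; lra.
have [b1 bN] := lower ep ee0 h20; set b := C * _ in b1 bN.
have b0 : 0 < b by rewrite mulr_gt0 // powR_gt0 ?divr_gt0.
have lnb : - ln b = - ln C + kappa * ln 2 + kappa * y.
  rewrite /b lnM ?posrE ?powR_gt0 ?divr_gt0 // ln_powR lnM ?posrE ?invr_gt0 // lnV ?posrE // /y; ring.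
have lnb0 : 0 <= - ln b by rewrite oppr_ge0 ln_le0.
have N0 : 0 < N e by apply: lt_le_trans bN; rewrite divr_gt0 ?exprn_gt0.
have qn : (3 ^ m.+3)%:R = 3 ^+ m.+3 :> R by rewrite natrX.
have q0 : 0 < 3 ^+ m.+3 :> R by rewrite exprn_gt0.
have h := ln_quot b0 q0 qn bN.
have lq : ln (3 ^+ m.+3) <= 3 ^+ m.+3 :> R by rewrite ltW // ln_sublinear.
have q1 : 3 ^+ m.+3 <= expR (a * y + (a * ln 20 + 4 * ln 3)).
  rewrite -[leLHS]lnK ?posrE // ler_expR ln_pow // -addn3 natrD.
  have : m%:R * ln 3 <= (z + 1) * ln 3 by rewrite ler_pM2r.
  have : z * ln 3 = a * y + a * ln 20 by rewrite /z /a; field; rewrite gt_eqF.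
  by move: (a * y) (a * ln 20) (ln 3) => u v w; lra.
split; first exact: N0.
split; last by rewrite -!addrA lerDl !addrA -lnb.
apply: le_trans h _; apply: (@le_trans _ _ (3 ^+ m.+3 * (1 + - ln b))).
  by rewrite mulrDr mulr1 lerD2r.
rewrite lnb (_ : 1 + _ = 1 - ln C + kappa * ln 2 + kappa * y); last by rewrite !addrA.
by apply: ler_wpM2r q1; rewrite -!addrA addr_ge0 // !addrA -lnb.
Qed.

(** Here z = log_5(1 / (A e)), and m > z - 2 explains 2 ln 3. *)
Let upper_log e : 0 < e -> 2 * ln 5 <= - ln e - ln A -> 0 < N e ->
  c * expR (a * - ln e - (a * ln A + 2 * ln 3)) - ln 2 <= - ln (N e).
Proof.
move=> ep; set y := - ln e => yA N0.
pose z := (y - ln A) / ln 5; have z2 : 2 <= z by rewrite ler_pdivlMr.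
have z0 : 0 <= z by lra.
(* One less than the integer part of z: [upper] needs m strictly below z, and z >= 2 keeps m
   positive. *)
have [m [m0 m1]] : exists m, (0 < m)%N /\ m.+1%:R <= z < m.+2%:R.
  have t1 : (1 < Num.truncn z)%N by rewrite truncn_ge_nat.
  by exists (Num.truncn z).-1; rewrite prednK ?(ltnW t1) // -ltnS prednK ?(ltnW t1) // truncn_itv.
have {m1} [m1 m2] : m%:R + 1 <= z /\ z < m%:R + 2.
  by move: m1; rewrite natr1 -(natrD _ m 2) addn2 => /andP[].
have zE : z * ln 5 = y - ln A by rewrite /z divfK // gt_eqF.
have h1 : A * e * 5 ^+ m < 1.
  rewrite -ltr_ln ?posrE ?mulr_gt0 ?exprn_gt0 // ln1 lnM ?posrE ?mulr_gt0 ?exprn_gt0 // lnM ?posrE // ln_pow //.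
  have : m%:R * ln 5 < z * ln 5 by rewrite ltr_pM2r //; lra.
  by rewrite zE /y; lra.
have hN := upper m0 ep h1.
have h2 : - ln 2 + c * 3 ^+ m <= - ln (N e).
  have : ln (N e) <= ln (2 * expR (- c * 3 ^+ m)) by rewrite ler_ln ?posrE ?mulr_gt0 ?expR_gt0.
  by rewrite lnM ?posrE ?expR_gt0 // expRK; move: (3 ^+ m) (ln 2) (ln (N e)) => u v w; lra.
apply: le_trans h2; rewrite addrC lerD2l ler_pM2l //.
rewrite -[leRHS]lnK ?posrE ?exprn_gt0 // ler_expR ln_pow // {h1 hN}.
have : (z - 2) * ln 3 <= m%:R * ln 3 by rewrite ler_pM2r //; lra.
have : z * ln 3 = a * y - a * ln A by rewrite /z /a; field; rewrite gt_eqF.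
by lra.
Qed.

(** With y = - ln e, the two bounds give ln |ln N(e)| = a y + O(ln y); dividing by ln e = - y leaves
    - a. *)
Lemma lifshitz_limit : (ln `|ln (N e)| / ln e) @[e --> 0^'+] --> - (ln 3 / ln 5).
Proof.
rewrite -/a; apply/cvgrPdist_le => eps eps0.
have a0 : 0 < a by rewrite divr_gt0.
pose K1 := a * ln A + 2 * ln 3; pose K2 := a * ln 20 + 4 * ln 3.
(* [delta] is chosen so that ln u <= delta u - ln delta, at u = C4 + kappa y, has slope eps / 2 in
   y. *)
pose C4 := 1 - ln C + kappa * ln 2; pose delta := eps / (2 * kappa).
have d0 : 0 < delta by rewrite divr_gt0 // mulr_gt0.
(* A sum of thresholds for y: its terms serve, in order, [yA], [hexp], [f1], [f2] and the positivity
   of y. *)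
pose Y := `|2 * ln 5 + ln A| + `|K1 + `|ln (2 * ln 2 / c)| | / a + `|K1 - ln (c / 2)| / eps +
   2 * `|K2 + delta * C4 - ln delta| / eps + 1.
have near_small : \forall e \near (0 : R)^'+, e < expR (- Y).
  by apply: nbhs_right_lt; exact: expR_gt0.
near=> e.
have ep : 0 < e by near: e; exact: nbhs_right_gt.
have ee0 : e < e0 by near: e; exact: nbhs_right_lt.
have e1 : e < 1 by near: e; exact: nbhs_right_lt.
have eY : e < expR (- Y) by near: e.
set y := - ln e.
have yY : Y < y by rewrite /y ltrNr -ltr_expR lnK.
have [N0 [hl hl1]] := lower_log ep ee0 e1; rewrite -/y in hl hl1.
have t1 := normr_ge0 (2 * ln 5 + ln A); have t2 := normr_ge0 (K1 + `|ln (2 * ln 2 / c)|).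
have t3 := normr_ge0 (K1 - ln (c / 2)); have t4 := normr_ge0 (K2 + delta * C4 - ln delta).
have t2' := divr_ge0 t2 (ltW a0); have t3' := divr_ge0 t3 (ltW eps0).
have t4' : 0 <= 2 * `|K2 + delta * C4 - ln delta| / eps by rewrite divr_ge0 ?mulr_ge0 // ltW.
have y0 : 0 < y by move: yY; rewrite /Y; lra.
have yA : 2 * ln 5 <= y - ln A.
  by move: yY (ler_norm (2 * ln 5 + ln A)); rewrite /Y; lra.
have hu := upper_log ep yA N0; rewrite -/y -/K1 in hu.
have hK1 : K1 + `|ln (2 * ln 2 / c)| <= a * y.
  rewrite (mulrC a) -ler_pdivrMr //; apply: le_trans (_ : `|K1 + `|ln (2 * ln 2 / c)| | / a <= _).
    by rewrite ler_wpM2r ?invr_ge0 ?(ltW a0) // ler_norm.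
  by move: yY; rewrite /Y; lra.
have l2 : 0 < ln (2 : R) by apply: ln_gt0; lra.
have hexp : 2 * ln 2 <= c * expR (a * y - K1).
  rewrite -ler_pdivrMl // mulrC -[leLHS]lnK ?posrE ?divr_gt0 ?mulr_gt0 //.
  by rewrite ler_expR; have := ler_norm (ln (2 * ln 2 / c)); lra.
have hu2 : c / 2 * expR (a * y - K1) <= - ln (N e) by lra.
have lN0 : 0 < - ln (N e) by apply: lt_le_trans hu2; rewrite mulr_gt0 ?divr_gt0 ?expR_gt0.
have absE : `|ln (N e)| = - ln (N e) by rewrite ltr0_norm // -oppr_gt0.
have lo : ln (c / 2) + (a * y - K1) <= ln `|ln (N e)|.
  rewrite absE -[X in _ + X]expRK -lnM ?posrE ?expR_gt0 ?divr_gt0 //.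
  by rewrite ler_ln ?posrE ?mulr_gt0 ?divr_gt0 ?expR_gt0.
have hi : ln `|ln (N e)| <= a * y + K2 + ln (C4 + kappa * y).
  have w0 : 0 < C4 + kappa * y by apply: lt_le_trans hl1.
  rewrite absE -[X in X + ln _]expRK -lnM ?posrE ?expR_gt0 //.
  by rewrite ler_ln ?posrE ?mulr_gt0 ?expR_gt0.
have hlog : ln (C4 + kappa * y) <= delta * C4 + eps / 2 * y - ln delta.
  have w0 : 0 < C4 + kappa * y by apply: lt_le_trans hl1.
  have := @ln_sublinear R (delta * (C4 + kappa * y)) (mulr_gt0 d0 w0).
  rewrite lnM ?posrE // mulrDr.
  have -> : delta * (kappa * y) = eps / 2 * y by rewrite /delta; field; rewrite gt_eqF.
  by lra.
have f1 : K1 - ln (c / 2) <= eps * y.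
  rewrite (mulrC eps) -ler_pdivrMr //; apply: le_trans (_ : `|K1 - ln (c / 2)| / eps <= _).
    by rewrite ler_wpM2r ?invr_ge0 ?(ltW eps0) // ler_norm.
  by move: yY; rewrite /Y; lra.
have f2 : K2 + delta * C4 - ln delta <= eps / 2 * y.
  have h : 2 * `|K2 + delta * C4 - ln delta| / eps <= y by move: yY; rewrite /Y; lra.
  rewrite ler_pdivrMr // in h.
  by have := ler_norm (K2 + delta * C4 - ln delta); lra.
have -> : - a - ln `|ln (N e)| / ln e = (ln `|ln (N e)| - a * y) / y.
  by rewrite /y; field; rewrite -oppr_eq0 -/y gt_eqF.
rewrite normrM normfV [`|y|]gtr0_norm // ler_pdivrMr // ler_norml; apply/andP; split; lra.
Unshelve. all: by end_near. Qed.

End LifshitzLimit.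

(** * Tail bounds for the ball averages *)

Section Tails.
Context (R : realType) (d : measure_display) (T : measurableType d) (P : probability T R).
Context (P0 : probability R R) (V : pt -> T -> R).
Hypothesis iid : iid_potential P V P0.

Lemma vertexO : vertex O.
Proof. by apply/vertexP; exists 0%N, (false, O); rewrite mem_cells2 !inE eqxx. Qed.

Lemma potential_nonneg L : has_inf (supp P0) /\ inf (supp P0) = 0 ->
  {ae P, forall w, forall x, x \in ballpts L -> 0 <= V x w}.
Proof.
move=> hs; have hx x : vertex x -> {ae P, forall w, 0 <= V x w}.
  move=> vx; exists (V x @^-1` `]-oo, 0[%classic); split.
  - exact: (iid_preimage iid).
  - by have [_ [law _]] := iid; rewrite law //; exact: negative_null.
  - by move=> w /= /negP; rewrite -ltNge in_itv.
(* Past the end of the list the default [O] is again a vertex, so every index n gives an almost sure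
   event. *)
pose x n := nth O (ballpts L) n.
have vx n : vertex (x n).
  rewrite /x; have [nL|nL] := ltnP n (size (ballpts L)); last by rewrite nth_default //; exact: vertexO.
  by have [] := ball_vertex (mem_nth O nL).
have := ae_foralln (fun n => hx _ (vx n)); apply: filterS => w hw y /(nthP O)[n _ <-].
exact: hw.
Qed.

(** Each of the 2 * 3^k triangles is bad with probability at most exp(- p/4 * 3^m) and then costs
    3^(m+1) eigenvalues; dividing by |B| > 3^(k+m+1) leaves the factor 2, whatever k is. *)
Lemma ball_avg_upper k m E t : has_inf (supp P0) /\ inf (supp P0) = 0 ->
  (0 < m)%N -> 0 < t -> 0 < exceed_prob P0 t ->
  E * ((12 / (t * (exceed_prob P0 t / 4)) + 360) * 5 ^+ m) < 1 ->
  ball_avg P V (k + m) E <= 2 * expR (- (exceed_prob P0 t / 4) * 3 ^+ m).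
Proof.
move=> hs m0 t0 p0 hE; set p := exceed_prob P0 t in p0 hE *.
pose bad c w : R := (~~ good_cells t (p / 4) (fun i => V (@cell_points m c i) w))%:R.
have bb c : valid_cell c -> bounded_rv (bad c).
  by move=> vc; apply: (bad_cell_measurable iid) => i; exact: cell_points_vertex.
have mb c : valid_cell c -> mean P (bad c) <= expR (- (p / 4) * 3 ^+ m).
  move=> vc; apply: le_trans (bad_cell_prob iid t (cell_points_inj vc) (fun i => cell_points_vertex i vc)) _.
  rewrite ler_expR -/p mulNr mulNr lerN2 ler_wpM2l ?divr_ge0 ?(ltW p0) //.
  by rewrite -natrX ler_nat le_size_intv.
pose F c w := if `[< valid_cell c >] then bad c w else 0.
have bF c : bounded_rv (F c).
  by rewrite /F; case: asboolP => [vc|_]; [exact: bb | exact: bounded_rv_cst].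
have bS : bounded_rv (fun w => 3 ^+ m.+1 * \sum_(c <- cells2 k) F c w).
  by apply: bounded_rvZ; exact: bounded_rv_sum.
have h1 : mean P (ball_count V (k + m) E) <= mean P (fun w => 3 ^+ m.+1 * \sum_(c <- cells2 k) F c w).
  apply: mean_le_ae => //; first exact: (ball_bounded iid).
  apply: filterS (potential_nonneg (k + m) hs) => w hw.
  have p40 : 0 < p / 4 by rewrite divr_gt0.
  have := ncount_bad m0 t0 p40 hw hE; rewrite -(ler_nat R) -ball_countE => h; apply: le_trans h _.
  rewrite natrM natrX mulrC; apply: ler_wpM2l; first by rewrite exprn_ge0.
  rewrite -sum1_count natr_sum big_mkcond /= le_eqVlt; apply/orP; left; apply/eqP.
  apply: eq_big_seq => c ck; rewrite /F asboolT; last by exists k.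
  by rewrite /bad /cell_points /cellpot; case: (good_cells _ _ _).
have h2 : mean P (fun w => 3 ^+ m.+1 * \sum_(c <- cells2 k) F c w) <=
    3 ^+ m.+1 * (2 * 3 ^+ k * expR (- (p / 4) * 3 ^+ m)).
  rewrite meanZ; last exact: bounded_rv_sum.
  rewrite ler_wpM2l ?exprn_ge0 // mean_sum //.
  have -> : 2 * 3 ^+ k * expR (- (p / 4) * 3 ^+ m) = \sum_(c <- cells2 k) expR (- (p / 4) * 3 ^+ m).
    by rewrite big_const_seq count_predT iter_addr addr0 size_cells2 -[RHS]mulr_natl natrM natrX.
  rewrite big_seq [leRHS]big_seq; apply: ler_sum => c ck; have vc : valid_cell c by exists k.
  rewrite (_ : F c = bad c); first exact: mb.
  by apply/funext => w; rewrite /F asboolT.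
have b0 : 0 < (#|BallL (k + m)|)%:R :> R by rewrite card_BallLR ltr_wpDr // exprn_gt0.
rewrite /ball_avg ler_pdivrMr //; apply: le_trans h1 _; apply: le_trans h2 _.
rewrite card_BallLR -addnS exprD; have := expR_ge0 (- (p / 4) * 3 ^+ m).
move: (expR _) (3 ^+ m.+1) (3 ^+ k) => x y z x0; lra.
Qed.

(** A block of level m+2 has at most 3^(m+3) sites; if V lies in [0, E/2] on all of them it has an
    eigenvalue below E. The ratio of 2 * 3^k blocks to |B| is at least 1 / 3^(m+3). *)
Lemma ball_avg_lower k m E : 10 / 5 ^+ m <= E / 2 ->
  fine (P0 (closed_itv 0 (E / 2))) ^+ (3 ^ m.+3) / 3 ^+ m.+3 <= ball_avg P V (k + m.+2) E.
Proof.
move=> mE; set p := fine _; set M := m.+2.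
have p0 : 0 <= p := fine_probability_ge0 _ _.
have p1 : p <= 1 by apply: fine_probability_le1; exact: measurable_itv.
pose D := \big[setI/setT]_i (V (@cell_points M (false, O) i) @^-1` closed_itv 0 (E / 2)).
have vO i := @cell_points_vertex M _ i valid0.
have mD : measurable D.
  by apply: bigsetI_measurable => i _; apply: (iid_preimage iid) => //; exact: measurable_itv.
have h1 : p ^+ (3 ^ m.+3) <= block_mean P V M E.
  apply: (@le_trans _ _ (mean P \1_D)).
    rewrite mean_indic // /D (iid_prob iid) //=; last first.
    - by move=> i; exact: measurable_itv.
    - exact: (cell_points_inj valid0).
    rewrite prodr_const card_ord -/p; apply: ler_wiXn2l => //.
    by rewrite -[(3 ^ _)%N](size_intv M) mul2n -addnn addnCA leq_addr.
  apply: mean_le; [exact: bounded_rv_indic | exact: (block_bounded iid M E valid0) | move=> w].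
  rewrite indicE; case: (boolP (w \in D)) => [|_]; last exact: ler0n.
  rewrite inE /D -bigcap_seq => hw; rewrite /block_count ler1n; apply: ncount_block_gt0 => // i.
  have := hw i; rewrite /= mem_index_enum => /(_ isT); rewrite /closed_itv /= in_itv /=.
  by case/andP.
have [h2 _] := mean_ball_cells iid k M E.
have b0 : 0 < (#|BallL (k + M)|)%:R :> R by rewrite card_BallLR ltr_wpDr // exprn_gt0.
rewrite /ball_avg ler_pdivlMr // -/M.
apply: le_trans h2; apply: (@le_trans _ _ (2 * 3 ^+ k * p ^+ (3 ^ m.+3))); last first.
  by rewrite ler_wpM2l // mulr_ge0 ?exprn_ge0.
rewrite card_BallLR -addnS exprD -/M.
have q0 : 1 <= 3 ^+ M.+1 :> R by rewrite exprn_ege1 // ler1n.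
have k0 : 1 <= 3 ^+ k :> R by rewrite exprn_ege1 // ler1n.
have r0 : 0 <= p ^+ (3 ^ m.+3) by rewrite exprn_ge0.
have q3 : 3 <= 3 ^+ M.+1 :> R by rewrite exprS ler_peMr // exprn_ege1 // ler1n.
move: q0 k0 r0 q3; move: (p ^+ _) (3 ^+ M.+1) (3 ^+ k) => x y z y0 z0 x0 y3.
rewrite mulrAC ler_pdivrMr; last by lra.
rewrite (mulrC _ x) -mulrA; apply: ler_wpM2l => //; nra.
Qed.

End Tails.

Unset Implicit Arguments.

Theorem theorem1p2 (R : realType) (d : measure_display) (T : measurableType d)
    (P : probability T R) (P0 : probability R R) (V : pt -> T -> R) :
  iid_potential P V P0 ->
  exists N : R -> R,
    {homo N : x y / x <= y} /\
    (forall x, N y @[y --> x^'+] --> N x) /\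
    (forall E, {for E, continuous N} ->
       (fun L : nat => ((#|BallL L|%:R : R)^-1)%:E *
                       'E_P[fun w => Ncount E (HB L (V^~ w))])%E
         @ \oo --> (N E)%:E) /\
    {ae P, forall w, forall E, {for E, continuous N} ->
       (fun L : nat => Ncount E (HB L (V^~ w)) / #|BallL L|%:R) @ \oo --> N E} /\
    ((has_inf (supp P0) /\ inf (supp P0) = 0) ->
     ~ (exists x : R, P0 [set x] = 1%E) ->
     (exists C kappa : R, 0 < C /\ 0 < kappa /\
        \forall e \near 0^'+, ((C * e `^ kappa)%:E <= P0 (closed_itv 0 e))%E) ->
     (ln `|ln (N e)| / ln e) @[e --> 0^'+] --> - (ln 3 / ln 5)).
Proof.
move=> iid; pose f E := limn (fun L => ball_avg P V L E).
have fc E : (fun L => ball_avg P V L E) @ \oo --> f E by exact: (ball_avg_cvg iid).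
have fm : {homo f : x y / x <= y}.
  move=> x y xy; apply: ler_lim; [exact: (ball_avg_cvg iid)|exact: (ball_avg_cvg iid)|].
  by apply: nearW => L; exact: (ball_avg_mono iid).
have [N [Nm Nr fN Nf]] := right_regularisation fm.
exists N; split=> //; split=> //; split; [|split].
- move=> E Nc.
  have := continuous_sandwich (ball_avg_mono iid) fN Nf (fun q => fc (ratr q)) Nc.
  move=> h; rewrite (_ : (fun L => _) = fun L => (ball_avg P V L E)%:E).
    by apply: cvg_EFin => //; exact: nearW.
  apply/funext => L; rewrite -/(ball_count V L E) (meanE P (ball_bounded iid L E)).
  by rewrite -EFinM mulrC.
(* Enumerating the rationals by [unpickle] gives one null set for all of them; a number coding no
   rational carries [True]. *)
- pose Q n w := if unpickle n is Some q then
    (fun L => ball_count V L (ratr q) w / (#|BallL L|)%:R - ball_avg P V L (ratr q)) @ \oo --> (0 : R) else True.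
  have hQ n : {ae P, forall w, Q n w}.
    rewrite /Q; case: (unpickle n) => [q|]; last exact: aeW.
    exact: (ball_count_ae iid).
  have := ae_foralln hQ; apply: filterS => w hw E Nc.
  apply: (continuous_sandwich (u := fun L x => ball_count V L x w / (#|BallL L|)%:R) _ fN Nf _ Nc).
    by move=> L x y xy; rewrite ler_wpM2r ?invr_ge0 //; exact: ball_count_mono.
  move=> q; have := hw (pickle q); rewrite /Q pickleK => hq.
  rewrite (_ : (fun L => _) = fun L => ball_count V L (ratr q) w / (#|BallL L|)%:R -
      ball_avg P V L (ratr q) + ball_avg P V L (ratr q)).
    by rewrite -[f _]add0r; apply: cvgD hq (fc _).
  by apply/funext => L; rewrite subrK.
- move=> hs natom [C [kappa [C0 [k0 hC]]]].
  have [t t0 p0] := exists_exceed hs natom.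
  pose p := exceed_prob P0 t; pose A := 12 / (t * (p / 4)) + 360.
  have A0 : 0 < A by rewrite addr_gt0 ?divr_gt0 ?mulr_gt0 ?divr_gt0 ?ltr0n.
  have [e0 /= e00 he0] := hC.
  apply: (@lifshitz_limit R N A (p / 4) C kappa e0) => //.
  + by rewrite divr_gt0.
  + move=> m e m0 e1 hA.
    have p5 : 0 < A * 5 ^+ m by rewrite mulr_gt0 // exprn_gt0.
    have he : e < (A * 5 ^+ m)^-1 by rewrite -div1r ltr_pdivlMr //; lra.
    (* N(e) is bounded by f only at energies strictly above e; the midpoint between e and the
       threshold still satisfies the strict condition of [ball_avg_upper]. *)
    pose e' := (e + (A * 5 ^+ m)^-1) / 2.
    apply: (@le_trans _ _ (f e')); first by apply: Nf; rewrite /e'; lra.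
    apply: limr_le; first exact: (ball_avg_cvg iid).
    exists m => // L /= mL; rewrite -(subnK mL); apply: (ball_avg_upper iid _ hs m0 t0 p0).
    by rewrite -/p -/A -ltr_pdivlMr // div1r /e'; lra.
  + move=> m e e1 ee0 h20.
    have q0 : 0 < 5 ^+ m :> R by rewrite exprn_gt0.
    have hP := he0 (e / 2) _ _.
    have {}hP : C * (e / 2) `^ kappa <= fine (P0 (closed_itv 0 (e / 2))).
      rewrite -lee_fin fineK ?fin_num_measure //; last exact: measurable_itv.
      by apply: hP; [rewrite /= sub0r normrN ger0_norm; lra | lra].
    split.
      by apply: le_trans hP _; apply: fine_probability_le1; exact: measurable_itv.
    apply: (@le_trans _ _ (f e)); last exact: fN.
    apply: limr_ge; first exact: (ball_avg_cvg iid).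
    exists m.+2 => // L /= mL; rewrite -(subnK mL).
    (* The condition 20 <= e 5^m is 10 / 5^m <= e / 2: half of e pays for the energy of the test
       function, the other half for the potential. *)
    apply: le_trans (ball_avg_lower iid _ _); last first.
      by rewrite ler_pdivrMr //; lra.
    rewrite ler_pM2r ?invr_gt0 ?exprn_gt0 //; apply: lerXn2r hP; rewrite nnegrE.
      by rewrite mulr_ge0 ?(ltW C0) ?powR_ge0.
    exact: fine_probability_ge0.
Qed.
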